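(* Let $\mathcal D$ and $\mathcal D'$ be 3d mirror dual brane diagrams. There is a natural bijection between the torus fixed points of $\mathcal C(\mathcal D)$ and those of $\mathcal C(\mathcal D')$.
   Context: **Brane diagrams.** A brane diagram $\mathcal D$ is a finite sequence of 5-branes arranged from left to right, each being either a D5 brane or an NS5 brane. The D3 branes are the intervals between consecutive 5-branes, together with one D3 brane to the left of all 5-branes and one to the right of all of them. Each D3 brane $X$ carries a multiplicity $d_X\in\mathbb Z_{\ge0}$; the two outer D3 branes have multiplicity $0$. The D5 branes are $U_1,\dots,U_n$ and the NS5 branes are $V_1,\dots,V_m$, numbered left to right. For a 5-brane $W$, $W^-$ and $W^+$ are the D3 branes directly left and right of it; for a D3 brane $X$, $X^-$ and $X^+$ are the 5-branes directly left and right of it. Put $\mathrm{charge}(V)=d_{V^+}-d_{V^-}+\#\{\text{D5 branes left of }V\}$ for NS5 branes and $\mathrm{charge}(U)=d_{U^-}-d_{U^+}+\#\{\text{NS5 branes right of }U\}$ for D5 branes; $r_i=\mathrm{charge}(V_i)$, $c_j=\mathrm{charge}(U_j)$. Standing assumption, part of the definition of brane diagram: there is at least one $m\times n$ matrix with entries in $\{0,1\}$ with row sums $r$ and column sums $c$. **3d mirror.** The 3d mirror dual $\mathcal D'$ of $\mathcal D$ is obtained by replacing every D5 brane by an NS5 brane and every NS5 brane by a D5 brane, keeping the left-to-right positions and all D3 multiplicities. **Bow variety.** For each D3 brane $X$ let $W_X$ be a complex vector space of dimension $d_X$; for each D5 brane $U$ let $\mathbb C_U$ be a one-dimensional vector space.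 Let $\mathbb M_U=\mathrm{Hom}(W_{U^+},W_{U^-})\oplus\mathrm{Hom}(W_{U^+},\mathbb C_U)\oplus\mathrm{Hom}(\mathbb C_U,W_{U^-})\oplus\mathrm{End}(W_{U^-})\oplus\mathrm{End}(W_{U^+})\ni(A_U,b_U,a_U,B_U,B'_U)$ for D5 branes $U$, $\mathbb M_V=\mathrm{Hom}(W_{V^+},W_{V^-})\oplus\mathrm{Hom}(W_{V^-},W_{V^+})\ni(C_V,D_V)$ for NS5 branes $V$, and $\mathbb M=\bigoplus_U\mathbb M_U\oplus\bigoplus_V\mathbb M_V$. Let $\mathbb N=\bigoplus_{U}\mathrm{Hom}(W_{U^+},W_{U^-})\oplus\bigoplus_{X}\mathrm{End}(W_X)$. The moment map $\mu:\mathbb M\to\mathbb N$ has $U$-component $B_UA_U-A_UB'_U+a_Ub_U$, and $X$-component: $B'_{X^-}-B_{X^+}$ if $X^-,X^+$ are both D5; $C_{X^+}D_{X^+}-D_{X^-}C_{X^-}$ if both are NS5; $-D_{X^-}C_{X^-}-B_{X^+}$ if $X^-$ is NS5 and $X^+$ is D5; $C_{X^+}D_{X^+}+B'_{X^-}$ if $X^-$ is D5 and $X^+$ is NS5. Let $\widetilde{\mathcal M}$ be the set of points of $\mu^{-1}(0)$ such that for every D5 brane $U$: (S1) if $S\le W_{U^+}$ with $B'_U(S)\subset S$, $A_U(S)=0$, $b_U(S)=0$ then $S=0$; (S2) if $T\le W_{U^-}$ with $B_U(T)\subset T$, $\mathrm{Im}A_U+\mathrm{Im}\,a_U\subset T$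 then $T=W_{U^-}$. Let $\mathcal G=\prod_X\mathrm{GL}(W_X)$ act naturally on $\mathbb M$, and let $\chi:\mathcal G\to\mathbb C^\times$, $\chi((g_X)_X)=\prod_{X'}\det g_{X'}$, the product over D3 branes $X'$ for which $X'^-$ is an NS5 brane. Let $\mathcal G$ act on $\widetilde{\mathcal M}\times\mathbb C$ by $g.(m,z)=(gm,\chi^{-1}(g)z)$. Then $m\in\widetilde{\mathcal M}$ is stable, $m\in\widetilde{\mathcal M}^s$, if for $z\ne0$ the orbit $\mathcal G(m,z)$ is closed and the stabilizer of $(m,z)$ is finite. The bow variety is $\mathcal C(\mathcal D)=\widetilde{\mathcal M}^s/\mathcal G$ (a smooth variety). **Torus action.** $\mathbb A=(\mathbb C^\times)^{\{\text{D5 branes}\}}$ acts by rescaling the lines $\mathbb C_U$. The torus $\mathbb C^\times_\hbar$ acts on $\mathbb M$ by multiplying all $B_U,B'_U,b_U,C_V$ by the scalar $\hbar$ and fixing all $A_U,a_U,D_V$. Both descend to $\mathcal C(\mathcal D)$; $\mathbb T=\mathbb A\times\mathbb C^\times_\hbar$. ''Torus fixed points'' of $\mathcal C(\mathcal D)$ are the points fixed by $\mathbb T$; those of $\mathcal C(\mathcal D')$ are the points fixed by the analogous torus of $\mathcal D'$. *)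

(* Defs.v *)
From HB Require Import structures.
From mathcomp Require Import all_boot all_order all_algebra.
From mathcomp Require Import complex.
From mathcomp Require Import boolp classical_sets functions cardinality reals.
From mathcomp Require Import zify.

Set Implicit Arguments.
Unset Strict Implicit.
Unset Printing Implicit Defensive.

Import GRing.Theory.

Local Open Scope ring_scope.
Local Open Scope classical_set_scope.

(** * Brane diagrams *)

(* The 5-branes are the positions 0, ..., nb - 1 (left to right) and the D3
   branes are the positions 0, ..., nb: the 5-brane [p] lies between the D3
   branes [p] and [p.+1], so p^- is [p] and p^+ is [p.+1].  The multiplicities
   are indexed by [nat], so that "the D3 brane to the right of [p]" and "the D3
   brane to the left of [p.+1]" have convertible dimensions; the values beyond
   [nb] do not correspond to any D3 brane. *)
Record brane_data := BraneData {
  nb : nat;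
  isD5 : pred 'I_nb;
  mult : nat -> nat }.

Definition D5 (D : brane_data) := {p : 'I_(nb D) | isD5 p}.
Definition NS5 (D : brane_data) := {p : 'I_(nb D) | ~~ isD5 p}.
Definition mkD5 (D : brane_data) (p : 'I_(nb D)) (hp : isD5 p) : D5 D :=
  exist _ p hp.
Definition mkNS5 (D : brane_data) (p : 'I_(nb D)) (hp : ~~ isD5 p) : NS5 D :=
  exist _ p hp.
Definition D3 (D : brane_data) := 'I_(nb D).+1.

Definition lft (D : brane_data) (p : 'I_(nb D)) : D3 D :=
  widen_ord (leqnSn (nb D)) p.
Definition rgt (D : brane_data) (p : 'I_(nb D)) : D3 D :=
  @Ordinal (nb D).+1 p.+1 (ltn_ord p).

Definition charge (D : brane_data) (p : 'I_(nb D)) : int :=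
  if isD5 p then
    (mult D (lft p))%:Z - (mult D (rgt p))%:Z
      + #|[pred q : 'I_(nb D) | ~~ isD5 q & (p < q)%N]|%:Z
  else
    (mult D (rgt p))%:Z - (mult D (lft p))%:Z
      + #|[pred q : 'I_(nb D) | isD5 q & (q < p)%N]|%:Z.

Definition is_bct (D : brane_data) (M : NS5 D -> D5 D -> bool) : Prop :=
  (forall V : NS5 D, (\sum_(U : D5 D) M V U)%N%:Z = charge (val V)) /\
  (forall U : D5 D, (\sum_(V : NS5 D) M V U)%N%:Z = charge (val U)).

(* [mult_right] at [nb] says that the rightmost D3 brane has multiplicity 0;
   beyond [nb] it only normalizes the unused values. *)
Record brane_diagram := BraneDiagram {
  brane_diagram_data :> brane_data;
  mult_left : mult brane_diagram_data 0 = 0%N;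
  mult_right : forall x, (nb brane_diagram_data <= x)%N ->
    mult brane_diagram_data x = 0%N;
  bct_exists : exists M, @is_bct brane_diagram_data M }.

Definition mirror_data (D : brane_data) : brane_data :=
  @BraneData (nb D) (fun p => ~~ isD5 p) (mult D).

(* For the mirror dual, the charge condition is met by the complement of the
   transposed matrix. *)
Lemma mirror_bct (D : brane_data) :
  (exists M, @is_bct D M) -> exists M, @is_bct (mirror_data D) M.
Proof.
case=> M [Mr Mc].
pose toD5 (V : NS5 (mirror_data D)) : D5 D := exist _ (val V) (negbNE (valP V)).
have arith (s s' c c' N N' x y : nat) : (s' + s = N)%N -> (c + c' = N')%N ->
  N = N' -> s%:Z = x%:Z - y%:Z + c%:Z -> s'%:Z = y%:Z - x%:Z + c'%:Z by lia.
have sumC (I : finType) (F : I -> bool) :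
    (\sum_i ~~ F i + \sum_i F i)%N = #|I|.
  rewrite -big_split /= -sum1_card; apply: eq_bigr => i _.
  by case: (F i).
have split5 (P : pred 'I_(nb D)) (p : 'I_(nb D)) : ~~ P p ->
    (#|[pred q : 'I_(nb D) | P q & (p < q)%N]|
     + #|[pred q : 'I_(nb D) | P q & (q < p)%N]|)%N = #|P|.
  move=> Pp; rewrite -!sum1_card [RHS](bigID (fun q : 'I_(nb D) => (p < q)%N)) /=.
  apply: (f_equal2 addn); apply: eq_bigl => q; rewrite !inE //.
  rewrite -leqNgt ltn_neqAle unfold_in; case Pq: (P q) => //=.
  by rewrite (_ : (q : nat) != p) //; apply: contraNneq Pp => /val_inj <-.
exists (fun V U => ~~ M U (toD5 V)); split.
- move=> V.
  have V5 := valP (toD5 V); rewrite /= in V5.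
  have := sumC _ (fun U : NS5 D => M U (toD5 V)); rewrite card_sig => sum1.
  have := split5 (fun q => ~~ isD5 q) (val V); rewrite V5 => /(_ isT) sum2.
  have := Mc (toD5 V); rewrite /charge /= V5 /= => sum3.
  by apply: arith sum1 sum2 _ sum3; apply: eq_card.
- move=> U.
  have U5 : isD5 (sval U : 'I_(nb D)) = false by apply/negbTE; exact: (valP U).
  pose ofD5 (W : D5 D) : NS5 (mirror_data D) :=
    exist _ (val W) (introT negPn (valP W)).
  have toK : cancel ofD5 toD5 by move=> W; apply: val_inj.
  have ofK : cancel toD5 ofD5 by move=> W; apply: val_inj.
  have -> : (\sum_(V : NS5 (mirror_data D)) ~~ M U (toD5 V))%N
          = (\sum_(W : D5 D) ~~ M U W)%N.
    rewrite (reindex ofD5) /=; first by apply: eq_bigr => W _; rewrite toK.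
    by exists toD5 => W _; [exact: toK | exact: ofK].
  have := sumC _ (fun W : D5 D => M U W); rewrite card_sig => sum1.
  have := split5 (@isD5 D) (val U); rewrite /= U5 addnC => /(_ isT) sum2.
  have := Mr U; rewrite /charge /= U5 /= => sum3.
  rewrite (eq_card (B := [pred q | isD5 q & (sval U < q)%N])); last first.
    by move=> q; rewrite !inE negbK.
  by apply: arith sum1 sum2 _ sum3; apply: eq_card.
Qed.

Definition mirror (D : brane_diagram) : brane_diagram :=
  @BraneDiagram (mirror_data D) (@mult_left D) (@mult_right D)
    (mirror_bct (bct_exists D)).

(** * Bow varieties *)

Section BowVariety.
Variables (R : realType) (D : brane_data).

Local Notation C := R[i].
Local Notation w x := (mult D x).
Local Notation lW W := (lft (val W)).
Local Notation rW W := (rgt (val W)).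

(* W_X is the space 'cV[C]_(w X) of column vectors, C_U is 'cV[C]_1, and a
   linear map acts by multiplication on the left. *)
Record pt := Pt {
  pA : forall U : D5 D, 'M[C]_(w (lW U), w (rW U));
  pb : forall U : D5 D, 'M[C]_(1, w (rW U));
  pa : forall U : D5 D, 'M[C]_(w (lW U), 1);
  pB : forall U : D5 D, 'M[C]_(w (lW U));
  pB' : forall U : D5 D, 'M[C]_(w (rW U));
  pC : forall V : NS5 D, 'M[C]_(w (lW V), w (rW V));
  pD : forall V : NS5 D, 'M[C]_(w (rW V), w (lW V)) }.

(* The inner D3 branes are the positions [p.+1] with [p.+1 < nb D], between the
   5-branes [p] and [p.+1].  At the outer D3 branes W_X is the zero space, so
   there is no equation. *)
Definition moment_zero (m : pt) : Prop :=
  [/\ forall U : D5 D,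
        pB m U *m pA m U - pA m U *m pB' m U + pa m U *m pb m U = 0,
      forall (p : nat) (lp : (p < nb D)%N) (lq : (p.+1 < nb D)%N)
             (hp : isD5 (Ordinal lp)) (hq : isD5 (Ordinal lq)),
        pB' m (mkD5 hp) - pB m (mkD5 hq) = 0,
      forall (p : nat) (lp : (p < nb D)%N) (lq : (p.+1 < nb D)%N)
             (hp : ~~ isD5 (Ordinal lp)) (hq : ~~ isD5 (Ordinal lq)),
        pC m (mkNS5 hq) *m pD m (mkNS5 hq)
          - pD m (mkNS5 hp) *m pC m (mkNS5 hp) = 0,
      forall (p : nat) (lp : (p < nb D)%N) (lq : (p.+1 < nb D)%N)
             (hp : ~~ isD5 (Ordinal lp)) (hq : isD5 (Ordinal lq)),
        - (pD m (mkNS5 hp) *m pC m (mkNS5 hp))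
          - pB m (mkD5 hq) = 0
    & forall (p : nat) (lp : (p < nb D)%N) (lq : (p.+1 < nb D)%N)
             (hp : isD5 (Ordinal lp)) (hq : ~~ isD5 (Ordinal lq)),
        pC m (mkNS5 hq) *m pD m (mkNS5 hq)
          + pB' m (mkD5 hp) = 0].

Definition condS1 (m : pt) (U : D5 D) : Prop :=
  forall S : {vspace 'cV[C]_(w (rW U))},
    (forall v, v \in S -> pB' m U *m v \in S) ->
    (forall v, v \in S -> pA m U *m v = 0) ->
    (forall v, v \in S -> pb m U *m v = 0) ->
    S = 0%VS.

Definition condS2 (m : pt) (U : D5 D) : Prop :=
  forall T : {vspace 'cV[C]_(w (lW U))},
    (forall v, v \in T -> pB m U *m v \in T) ->
    (forall v : 'cV[C]_(w (rW U)), pA m U *m v \in T) ->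
    (forall v : 'cV[C]_1, pa m U *m v \in T) ->
    T = fullv.

Definition Mtilde : set pt :=
  [set m | moment_zero m /\ forall U : D5 D, condS1 m U /\ condS2 m U].

Definition gauge := forall x : D3 D, 'M[C]_(w x).
Definition in_gauge_group : set gauge :=
  [set g | forall x, g x \in unitmx].

Definition act (g : gauge) (m : pt) : pt := {|
  pA := fun U => g (lW U) *m pA m U *m invmx (g (rW U));
  pb := fun U => pb m U *m invmx (g (rW U));
  pa := fun U => g (lW U) *m pa m U;
  pB := fun U => g (lW U) *m pB m U *m invmx (g (lW U));
  pB' := fun U => g (rW U) *m pB' m U *m invmx (g (rW U));
  pC := fun V => g (lW V) *m pC m V *m invmx (g (rW V));
  pD := fun V => g (rW V) *m pD m V *m invmx (g (lW V)) |}.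

(* The D3 branes X' with X'^- an NS5 brane are the V^+ for V an NS5 brane. *)
Definition chi (g : gauge) : C := \prod_(V : NS5 D) \det (g (rW V)).

Definition act_lift (g : gauge) (q : pt * C) : pt * C :=
  (act g q.1, (chi g)^-1 * q.2).

Inductive polyfun : (pt * C -> C) -> Prop :=
| polyfun_const c : polyfun (fun=> c)
| polyfun_A U i j : polyfun (fun q => pA q.1 U i j)
| polyfun_b U i j : polyfun (fun q => pb q.1 U i j)
| polyfun_a U i j : polyfun (fun q => pa q.1 U i j)
| polyfun_B U i j : polyfun (fun q => pB q.1 U i j)
| polyfun_B' U i j : polyfun (fun q => pB' q.1 U i j)
| polyfun_C V i j : polyfun (fun q => pC q.1 V i j)
| polyfun_D V i j : polyfun (fun q => pD q.1 V i j)
| polyfun_z : polyfun (fun q => q.2)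
| polyfun_add f h : polyfun f -> polyfun h -> polyfun (fun q => f q + h q)
| polyfun_mul f h : polyfun f -> polyfun h -> polyfun (fun q => f q * h q).

(* The topology on Mtilde * C is the Zariski topology; a constructible set,
   such as an orbit of an algebraic group, has the same closure in the classical
   topology. *)
Definition zariski_closed_in (Y S : set (pt * C)) : Prop :=
  exists2 F : set (pt * C -> C), F `<=` polyfun &
    S = Y `&` [set q | forall f, F f -> f q = 0].

Definition orbit (m : pt) : set pt :=
  [set m' | exists2 g, in_gauge_group g & m' = act g m].
Definition orbit_lift (q : pt * C) : set (pt * C) :=
  [set q' | exists2 g, in_gauge_group g & q' = act_lift g q].
Definition stabilizer_lift (q : pt * C) : set gauge :=
  [set g | in_gauge_group g /\ act_lift g q = q].

Definition stable : set pt :=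
  [set m | Mtilde m /\ forall z : C, z != 0 ->
     zariski_closed_in (Mtilde `*` setT) (orbit_lift (m, z)) /\
     finite_set (stabilizer_lift (m, z))].

(* The points of C(D) = Mtilde^s / G are the orbits of stable points. *)
Definition bow_variety : set (set pt) :=
  [set P | exists2 m, stable m & P = orbit m].

(** * Torus fixed points *)

(* An element (t, h) of T = A * C^x_hbar; t U acts on the line C_U. *)
Definition in_torus (t : D5 D -> C) (h : C) : Prop :=
  (forall U, t U != 0) /\ h != 0.

Definition torus_act (t : D5 D -> C) (h : C) (m : pt) : pt := {|
  pA := pA m;
  pb := fun U => (h * t U) *: pb m U;
  pa := fun U => (t U)^-1 *: pa m U;
  pB := fun U => h *: pB m U;
  pB' := fun U => h *: pB' m U;
  pC := fun V => h *: pC m V;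
  pD := pD m |}.

Definition fixed_points : set (set pt) :=
  [set P | bow_variety P /\
     forall t h, in_torus t h -> torus_act t h @` P = P].

(** * Tie diagrams *)

Definition covers (s : 'I_(nb D) * 'I_(nb D)) (x : D3 D) : bool :=
  (s.1 < x <= s.2)%N.

(* A tie (p, q) joins two 5-branes of different kind, p being the left one. *)
Definition is_tie_diagram (T : {set 'I_(nb D) * 'I_(nb D)}) : Prop :=
  (forall s, s \in T -> (s.1 < s.2)%N /\ isD5 s.1 != isD5 s.2) /\
  (forall x : D3 D, #|[set s in T | covers s x]| = w x).

(* The fibre at the fixed point P of the tautological bundle with fibre W_X is
   the A-module on which t acts by the element g X below; its character is the
   sum, over the ties of T covering X, of the weight of the D5 brane of the
   tie.  This determines T, and as ties are recorded by the positions of their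
   two 5-branes, a tie diagram of D is also one of the 3d mirror of D. *)
Definition has_tie_diagram (P : set pt) (T : {set 'I_(nb D) * 'I_(nb D)}) :
    Prop :=
  is_tie_diagram T /\
  forall (m : pt) (t : D5 D -> C) (g : gauge),
    P m -> in_torus t 1 -> in_gauge_group g -> act g (torus_act t 1 m) = m ->
    forall x : D3 D,
      \tr (g x) = \sum_(U : D5 D)
        t U *+ #|[set s in T | covers s x &
                   (s.1 == val U) || (s.2 == val U)]|.

End BowVariety.

Arguments fixed_points : clear implicits.

(* Main.v *)
(* A stable point m generates everything from the vectors a_U: no proper family of
   subspaces contains them and is closed under all maps and under preimages by
   the A_U. Conversely such an m is stable: homomorphisms m -> m' solve a linear
   system with at most one solution, so Cramer's rule expresses them as regular
   functions on the closure of the orbit, and z prod det <> 0 makes the limit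
   invertible.
   At a fixed point a generic torus element gives g in the gauge group; by
   generation g is diagonalizable with eigenvalues t_U h^j. The part of W_X on which
   these weights occur is, for each U, a single Jordan block of B = - D C, spanned
   by a string: to the left of U the string of the transported a_U, to the right
   that of a vector lying over it. Its length changes by at most one at each NS5
   brane, and not at all at the other D5 branes; the places where it changes are
   the ties of U. Conversely the lengths determine all maps in the string bases,
   and any tie diagram defines such a normal form. Since tie diagrams treat both
   kinds of 5-branes symmetrically, those of D and of its mirror coincide. *)
Require Import Defs.
From mathcomp Require Import all_boot all_order all_algebra.
From mathcomp Require Import complex.
From mathcomp Require Import boolp classical_sets functions cardinality reals.
From mathcomp Require Import zify ring.

Set Implicit Arguments.
Unset Strict Implicit.
Unset Printing Implicit Defensive.

Import GRing.Theory Num.Theory.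

Local Open Scope ring_scope.

(** * Linear subspaces *)

(** The obstacle is that stability speaks of closed orbits while fixed points are classified by
    linear algebra. Closure under preimages by A bridges the two: it keeps (S1) and (S2) valid in
    the limit of a one-parameter subgroup, and for kernels of homomorphisms it is supplied by (S1)
    of the target. One torus element suffices for the classification: with t_u = 3^u and h = 2 the
    weights t_u h^j are pairwise distinct by unique factorization. On the part of W_X belonging to
    u, the map A of every other D5 brane is bijective, so a string can change only at NS5 branes and
    at u. Strings are indexed from the end killed by B, because their lengths change at the other
    end; every structure map then keeps the index or lowers it by one, up to the sign of C forced by
    the moment map. At u itself the length may jump arbitrarily. Hence the lengths are matched with
    tie counts by two separate inductions, one from each end of the diagram. The tie diagram is read
    off from traces at h = 1: these depend neither on the point of the orbit nor on bases, and
    varying a single t_U isolates the ties at U. *)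

Section Submodules.
Variables (F : fieldType).

(** Subspaces are predicates, so that kernels, images, strings and sets given by existential
    formulas can be used directly; [submod_vspace] converts to [{vspace _}] where (S1) and (S2)
    require it. *)
Definition submod (n : nat) (S : 'cV[F]_n -> Prop) : Prop :=
  S 0 /\ forall c u v, S u -> S v -> S (c *: u + v).

Section Closure.
Variables (n : nat) (S : 'cV[F]_n -> Prop).
Hypothesis subS : submod S.

Lemma submod0 : S 0. Proof. exact: subS.1. Qed.

Lemma submodZ c u : S u -> S (c *: u).
Proof. by move=> Su; rewrite -[c *: u]addr0; apply: subS.2 => //; exact: submod0. Qed.

Lemma submodD u v : S u -> S v -> S (u + v).
Proof. by move=> Su Sv; rewrite -[u]scale1r; exact: subS.2. Qed.

Lemma submodN u : S u -> S (- u).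
Proof. by rewrite -scaleN1r; exact: submodZ. Qed.

Lemma submodB u v : S u -> S v -> S (u - v).
Proof. by move=> Su Sv; apply: submodD => //; exact: submodN. Qed.

Lemma submod_sum I (r : seq I) (P : pred I) (f : I -> 'cV[F]_n) :
  (forall i, P i -> S (f i)) -> S (\sum_(i <- r | P i) f i).
Proof. by move=> Sf; elim/big_ind: _ => //; [exact: submod0 | exact: submodD]. Qed.
End Closure.

Lemma cV0_eq n (u v : 'cV[F]_n) : n = 0%N -> u = v.
Proof. by move=> n0; subst n; apply/colP; case. Qed.

Lemma eq_mulmx_cV m n (M N : 'M[F]_(m, n)) :
  (forall v : 'cV_n, M *m v = N *m v) -> M = N.
Proof.
move=> MN; apply/trmx_inj/row_matrixP => j.
by apply: trmx_inj; rewrite !tr_row !trmxK !colE MN.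
Qed.

Lemma mx0_submod m n (M : 'M[F]_(m, n)) : submod (fun v : 'cV_n => M *m v = 0).
Proof.
split=> [|c u v Mu Mv]; first by rewrite mulmx0.
by rewrite mulmxDr -scalemxAr Mu Mv scaler0 addr0.
Qed.

(** A maximal linearly independent family of covectors from Q must be a basis. This serves both to
    choose a square subsystem of equations and to choose an eigenbasis. *)
Lemma spanning_rows n (Q : 'rV[F]_n -> Prop) :
  (forall v : 'cV_n, (forall q, Q q -> q *m v = 0) -> v = 0) ->
  exists2 N : 'M[F]_n, N \in unitmx & forall i, Q (row i N).
Proof.
move=> trivQ.
have [k lek]: exists2 k, (k <= n)%N & (exists2 M : 'M[F]_(k, n), row_free M &
   forall i, Q (row i M)) /\ forall l (M : 'M[F]_(l, n)), row_free M ->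
   (forall i, Q (row i M)) -> (l <= k)%N.
  pose P k := `[< exists2 M : 'M[F]_(k, n), row_free M & forall i, Q (row i M) >].
  have exP : exists k, P k.
    by exists 0; apply/asboolP; exists 0; [rewrite /row_free mxrank0 | case].
  have ubP k : P k -> (k <= n)%N.
    by move=> /asboolP[M /eqP fM _]; rewrite -fM; exact: rank_leq_col.
  case: (ex_maxnP exP ubP) => k Pk maxk; exists k; first exact: ubP.
  split; first exact/asboolP.
  by move=> l M fM QM; apply: maxk; apply/asboolP; exists M.
case=> -[M fM QM] maxk.
suff fullM : row_full M.
  have eqk : k = n by move/eqP: fM => <-; exact/eqP.
  clear fullM; move: M fM QM; rewrite eqk => M fM QM.
  by exists M => //; rewrite -row_free_unit.
(* A covector of Q outside the row space of M would enlarge the independent family. *)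
have QsubM q : Q q -> (q <= M)%MS.
  move=> Qq; apply: contraT => nqM.
  suff /maxk : row_free (col_mx M q).
    move=> /(_ _) h; suff : (k + 1 <= k)%N by rewrite addn1 ltnn.
    apply: h => i; case: (split_ordP i) => j ->; first by rewrite rowKu.
    by rewrite rowKd ord1 row_id.
  rewrite /row_free -addsmxE; have := mxrank_sum_cap M q.
  rewrite (eqP fM).
  have q0 : q != 0 by apply: contraNneq nqM => ->; rewrite sub0mx.
  rewrite rank_rV q0 => <-.
  suff -> : (M :&: q)%MS = 0 by rewrite mxrank0 addn0.
  apply/eqP; rewrite -submx0; apply/rV_subP => v; rewrite sub_capmx.
  case/andP=> vM /sub_rVP[c vE]; rewrite vE submx0 scaler_eq0.
  rewrite (negbTE q0) orbF; apply: contraT => c0.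
  by move: vM; rewrite vE eqmx_scale // (negbTE nqM).
(* Every covector of Q kills the columns of [cokermx M], so these columns vanish by hypothesis and M
   has full row space. *)
rewrite -sub1mx; apply/row_subP => i.
rewrite submxE; apply/eqP/trmx_inj; rewrite trmx0.
have cok j : col j (cokermx M) = 0.
  apply: trivQ => q /QsubM; rewrite submxE => /eqP qM.
  by rewrite colE mulmxA qM mul0mx.
suff -> : cokermx M = 0 by rewrite mulmx0 trmx0.
by apply/matrixP => a b; move/colP: (cok b) => /(_ a); rewrite !mxE.
Qed.

(** Take p to be the projection to a complement along S. The complement is what the one-parameter
    subgroup of the degeneration rescales. *)
Lemma submod_kernel_idempotent n (S : 'cV[F]_n -> Prop) : submod S ->
  exists2 p : 'M[F]_n, p *m p = p & forall v, S v <-> p *m v = 0.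
Proof.
move=> subS.
(* A matrix of maximal rank with all rows in S has row space exactly S. *)
pose P k := `[< exists2 M : 'M[F]_n, forall i, S (row i M)^T & \rank M = k >].
have exP : exists k, P k.
  exists 0%N; apply/asboolP; exists 0; last by rewrite mxrank0.
  by move=> i; rewrite row0 trmx0; exact: submod0.
have ubP k : P k -> (k <= n)%N by move=> /asboolP[M _ <-]; exact: rank_leq_row.
case: (ex_maxnP exP ubP) => k /asboolP[M SM rM] maxM.
have SuM u : (u <= M)%MS -> S u^T.
  case/submxP=> c ->; rewrite mulmx_sum_row linear_sum /=.
  by apply: (submod_sum subS) => i _; rewrite linearZ /=; apply: (submodZ subS).
have MS v : S v -> (v^T <= M)%MS.
  move=> Sv; suff: (M + v^T <= M)%MS by rewrite addsmx_sub => /andP[].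
  rewrite -mxrank_leqif_sup ?addsmxSl //.
  rewrite eqn_leq mxrankS ?addsmxSl // rM andTb.
  apply: maxM; apply/asboolP; exists (M + v^T)%MS => // i.
  have /sub_addsmxP[[a b] /= ->] : (row i (M + v^T)%MS <= M + v^T)%MS.
    exact: row_sub.
  rewrite linearD /=; apply: submodD => //; first by apply: SuM; exact: submxMl.
  by rewrite trmx_mul trmxK [b]mx11_scalar tr_scalar_mx mul_mx_scalar; exact: submodZ.
pose q := proj_mx M^C%MS M.
have dis : (M^C :&: M)%MS = 0 by rewrite capmxC capmx_compl.
have ful (u : 'rV_n) : (u <= M^C + M)%MS.
  by rewrite addsmxC submx_full // addsmx_compl_full.
exists q^T; first by rewrite -trmx_mul (proj_mx_proj dis).
move=> v; split=> [/MS vM|qv].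
  by apply: trmx_inj; rewrite trmx_mul trmxK trmx0 (proj_mx_0 dis).
rewrite -[v]trmxK; apply: SuM.
have := proj_mx_compl_sub (ful v^T); rewrite -/q.
have -> : v^T *m q = 0 by apply: trmx_inj; rewrite trmx_mul trmxK trmx0.
by rewrite subr0.
Qed.

Lemma submod_vspace n (S : 'cV[F]_n -> Prop) : submod S ->
  exists T : {vspace 'cV[F]_n}, forall v, (v \in T) <-> S v.
Proof.
move=> /submod_kernel_idempotent[p _ Sp].
exists (lker (linfun (mulmx p))) => v.
by rewrite memv_ker lfunE /= Sp; split=> [/eqP|->].
Qed.

Lemma vspace_submod n (T : {vspace 'cV[F]_n}) : submod (fun v => v \in T).
Proof. by split=> [|c u v uT vT]; [exact: mem0v | rewrite memvD ?memvZ]. Qed.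
End Submodules.

(** * Stable points are generated by the framing *)

Section PolynomialPaths.
Variable F : numFieldType.

Definition polynomial_path (f : F -> F) : Prop :=
  exists P : {poly F}, forall s, f s = @horner F P s.

Lemma polynomial_path0 f : polynomial_path f -> (forall s, s != 0 -> f s = 0) ->
  f 0 = 0.
Proof.
case=> P fE f0; rewrite fE; have [->|nzP] := eqVneq P 0; first by rewrite horner0.
(* The points 1, ..., [size P] are distinct in characteristic zero: too many roots for P. *)
pose rs := [seq i.+1%:R : F | i <- iota 0 (size P)].
suff : (size rs < size P)%N by rewrite size_map size_iota ltnn.
apply: max_poly_roots nzP _ _.
  apply/allP => _ /mapP[i _ ->]; apply/eqP; rewrite -fE f0 //.
  by rewrite pnatr_eq0.
rewrite map_inj_uniq ?iota_uniq // => i j /eqP.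
by rewrite eqr_nat => /eqP[].
Qed.

Lemma polynomial_path_const c : polynomial_path (fun=> c).
Proof. by exists c%:P => s; rewrite hornerC. Qed.

Lemma polynomial_pathD f g : polynomial_path f -> polynomial_path g ->
  polynomial_path (fun s => f s + g s).
Proof. by move=> [P fE] [Q gE]; exists (P + Q) => s; rewrite hornerD fE gE. Qed.

Lemma polynomial_pathM f g : polynomial_path f -> polynomial_path g ->
  polynomial_path (fun s => f s * g s).
Proof. by move=> [P fE] [Q gE]; exists (P * Q) => s; rewrite hornerM fE gE. Qed.

Lemma polynomial_path_prod (I : finType) (f : I -> F -> F) :
  (forall i, polynomial_path (f i)) -> polynomial_path (fun s => \prod_i f i s).
Proof.
move=> pf; exists (\prod_i sval (cid (pf i))) => s; rewrite horner_prod.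
by apply: eq_bigr => i _; case: cid.
Qed.

Lemma polynomial_path_sum (I : finType) (f : I -> F -> F) :
  (forall i, polynomial_path (f i)) -> polynomial_path (fun s => \sum_i f i s).
Proof.
move=> pf; exists (\sum_i sval (cid (pf i))) => s; rewrite horner_sum.
by apply: eq_bigr => i _; case: cid.
Qed.

Lemma polynomial_path_line x y : polynomial_path (fun s => x + s * y).
Proof.
apply: polynomial_pathD; first exact: polynomial_path_const.
apply: polynomial_pathM; last exact: polynomial_path_const.
by exists 'X => s; rewrite hornerX.
Qed.

Lemma polynomial_path_det n (M N : 'M[F]_n) :
  polynomial_path (fun s => \det (M + s *: N)).
Proof.
rewrite /determinant; apply: polynomial_path_sum => sg.
apply: polynomial_pathM; first exact: polynomial_path_const.
apply: polynomial_path_prod => i; under eq_fun do rewrite mxE [X in _ + X]mxE.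
exact: polynomial_path_line.
Qed.
End PolynomialPaths.

Section Stability.
Variables (R : realType) (D : brane_diagram).
Local Notation C := R[i].
Local Notation w x := (mult D x).
Local Notation lW W := (lft (val W)).
Local Notation rW W := (rgt (val W)).

(** Walking from left to right across the 5-branes; families are indexed by all of [nat], whence the
    last case. *)
Lemma brane_ind (P : nat -> Prop) :
  P 0%N -> (forall U : D5 D, P (lW U) -> P (rW U)) ->
  (forall V : NS5 D, P (lW V) -> P (rW V)) ->
  (forall k, (nb D <= k)%N -> P k) -> forall k, P k.
Proof.
move=> P0 PU PV Pout; elim=> [//|k IHk].
have [ltk|lek] := ltnP k (nb D); last by apply: Pout; exact: leqW.
have [h|h] := boolP (isD5 (Ordinal ltk)).
  exact: (PU (mkD5 h)).
exact: (PV (mkNS5 h)).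
Qed.

(** The lines C_U count as belonging to the family: this is why [pa] has to land in S, and why
    mapping to C_U by [pb] imposes no condition. *)
Record closed_family (m : pt R D) (S : forall k, 'cV[C]_(w k) -> Prop) : Prop :=
  ClosedFamily {
  cf_sub : forall k, submod (@S k);
  cf_a : forall U : D5 D, S (lW U) (pa m U);
  cf_A : forall (U : D5 D) v, S (rW U) v -> S (lW U) (pA m U *m v);
  cf_Ainv : forall (U : D5 D) v, S (lW U) (pA m U *m v) -> S (rW U) v;
  cf_B : forall (U : D5 D) v, S (lW U) v -> S (lW U) (pB m U *m v);
  cf_B' : forall (U : D5 D) v, S (rW U) v -> S (rW U) (pB' m U *m v);
  cf_C : forall (V : NS5 D) v, S (rW V) v -> S (lW V) (pC m V *m v);
  cf_D : forall (V : NS5 D) v, S (lW V) v -> S (rW V) (pD m V *m v) }.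

(* Stability without limits. The one-parameter subgroup acting by 1 on S and by
   s^-1 on a complement has a limit in Mtilde as s tends to 0 as soon as A is
   bijective on the quotients W / S, which is what [cf_Ainv] ensures. *)
Definition generated (m : pt R D) : Prop :=
  forall S, closed_family m S -> forall k v, S k v.

Lemma condS1P (m : pt R D) U : condS1 m U <->
  (forall S : 'cV[C]_(w (rW U)) -> Prop, submod S ->
    (forall v, S v -> S (pB' m U *m v)) ->
    (forall v, S v -> pA m U *m v = 0) ->
    (forall v, S v -> pb m U *m v = 0) -> forall v, S v -> v = 0).
Proof.
split=> [S1 S subS SB SA Sb v Sv|S1 S SB SA Sb].
  have [T TS] := submod_vspace subS.
  have T0 : T = 0%VS.
    apply: S1 => u /TS Su; [exact/TS/SB | exact: SA | exact: Sb].
  by apply/eqP; rewrite -memv0 -T0; exact/TS.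
apply/eqP; rewrite -subv0; apply/subvP => v vS; rewrite memv0; apply/eqP.
exact: (S1 _ (vspace_submod S) SB SA Sb).
Qed.

Lemma condS2P (m : pt R D) U : condS2 m U <->
  (forall T : 'cV[C]_(w (lW U)) -> Prop, submod T ->
    (forall v, T v -> T (pB m U *m v)) ->
    (forall v, T (pA m U *m v)) ->
    T (pa m U) -> forall v, T v).
Proof.
split=> [S2 S subS SB SA Sa v|S2 S SB SA Sa].
  have [T TS] := submod_vspace subS.
  suff Tf : T = fullv by apply/TS; rewrite Tf memvf.
  apply: S2 => u; [by move=> /TS Su; exact/TS/SB | exact/TS/SA | apply/TS].
  by rewrite [u]mx11_scalar mul_mx_scalar; exact: submodZ.
apply/eqP; rewrite eqEsubv subvf; apply/subvP => v _.
apply: (S2 _ (vspace_submod S) SB SA).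
by rewrite -[pa m U]mulmx1; exact: Sa.
Qed.

(** * The limit of a one-parameter subgroup attached to a closed family *)

Section Degeneration.
Variables (m : pt R D) (S : forall k, 'cV[C]_(w k) -> Prop).
Arguments S : clear implicits.
Hypotheses (mM : Mtilde m) (cfS : closed_family m S).
Variable p : forall k, 'M[C]_(w k).
Hypotheses (pp : forall k, p k *m p k = p k)
  (Sp : forall k v, S k v <-> p k *m v = 0).

(** For idempotents q, r and Y mapping ker r to ker q, this is the block diagonal part of Y: Y (1 -
    r) is the block on the kernels, q Y = q Y r the block on the images. What is removed is the
    block (1 - q) Y r. *)
Definition blockdiag a b (q : 'M[C]_a) (r : 'M[C]_b) (Y : 'M_(a, b)) :=
  Y - Y *m r + q *m Y.

(* The point moved by that subgroup; at s = 0 this is its limit. *)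
Definition degeneration (s : C) : pt R D := {|
  pA := fun U => blockdiag (p (lW U)) (p (rW U)) (pA m U)
     + s *: (pA m U *m p (rW U) - p (lW U) *m pA m U);
  pb := fun U => pb m U - pb m U *m p (rW U) + s *: (pb m U *m p (rW U));
  pa := fun U => pa m U;
  pB := fun U => blockdiag (p (lW U)) (p (lW U)) (pB m U)
     + s *: (pB m U *m p (lW U) - p (lW U) *m pB m U);
  pB' := fun U => blockdiag (p (rW U)) (p (rW U)) (pB' m U)
     + s *: (pB' m U *m p (rW U) - p (rW U) *m pB' m U);
  pC := fun V => blockdiag (p (lW V)) (p (rW V)) (pC m V)
     + s *: (pC m V *m p (rW V) - p (lW V) *m pC m V);
  pD := fun V => blockdiag (p (rW V)) (p (lW V)) (pD m V)
     + s *: (pD m V *m p (lW V) - p (rW V) *m pD m V) |}.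

(** Taking diagonal blocks is multiplicative on block triangular matrices. The moment map equations
    are therefore inherited by the limit. *)
Lemma blockdiag_mul a b c (q : 'M[C]_a) (r : 'M[C]_b) (t : 'M[C]_c)
    (Y : 'M_(a, b)) (Z : 'M_(b, c)) : r *m r = r ->
  q *m Y = q *m Y *m r -> r *m Z = r *m Z *m t ->
  blockdiag q t (Y *m Z) = blockdiag q r Y *m blockdiag r t Z.
Proof.
move=> rr hY hZ; rewrite {3}/blockdiag mulmxDr.
have -> : blockdiag q r Y *m (r *m Z) = q *m (Y *m Z).
  rewrite mulmxA /blockdiag !(mulmxDl, mulNmx) -(mulmxA Y r r) rr subrr add0r -hY.
  by rewrite mulmxA.
have rZ : r *m (Z - Z *m t) = 0 by rewrite mulmxBr mulmxA -hZ subrr.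
rewrite /blockdiag; congr (_ + _).
rewrite !(mulmxDl, mulNmx) -(mulmxA Y r) rZ mulmx0 subr0 hY -(mulmxA _ r) rZ.
by rewrite mulmx0 addr0 mulmxBr mulmxA.
Qed.

(** The image of 1 - r is ker r, so the invariance of the kernels says q Y (1 - r) = 0. *)
Lemma kernel_family_inv a b (Y : 'M[C]_(a, b)) (q : 'M_a) (r : 'M_b) :
  r *m r = r -> (forall v : 'cV_b, r *m v = 0 -> q *m (Y *m v) = 0) ->
  q *m Y = q *m Y *m r.
Proof.
move=> rr inv; apply/eqP; rewrite -subr_eq0 -[X in X - _]mulmx1 -mulmxBr.
apply/eqP/eq_mulmx_cV => v; rewrite mul0mx -!mulmxA; apply: inv.
by rewrite mulmxA mulmxBr mulmx1 rr subrr mul0mx.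
Qed.

Let pA_inv (U : D5 D) : p (lW U) *m pA m U = p (lW U) *m pA m U *m p (rW U).
Proof.
by apply: kernel_family_inv => // v /Sp Sv; apply/Sp; exact: (cf_A cfS).
Qed.
Let pB_inv (U : D5 D) : p (lW U) *m pB m U = p (lW U) *m pB m U *m p (lW U).
Proof.
by apply: kernel_family_inv => // v /Sp Sv; apply/Sp; exact: (cf_B cfS).
Qed.
Let pB'_inv (U : D5 D) : p (rW U) *m pB' m U = p (rW U) *m pB' m U *m p (rW U).
Proof.
by apply: kernel_family_inv => // v /Sp Sv; apply/Sp; exact: (cf_B' cfS).
Qed.
Let pC_inv (V : NS5 D) : p (lW V) *m pC m V = p (lW V) *m pC m V *m p (rW V).
Proof.
by apply: kernel_family_inv => // v /Sp Sv; apply/Sp; exact: (cf_C cfS).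
Qed.
Let pD_inv (V : NS5 D) : p (rW V) *m pD m V = p (rW V) *m pD m V *m p (lW V).
Proof.
by apply: kernel_family_inv => // v /Sp Sv; apply/Sp; exact: (cf_D cfS).
Qed.
Let pa0 (U : D5 D) : p (lW U) *m pa m U = 0.
Proof. by apply/Sp; exact: (cf_a cfS). Qed.

Lemma blockdiagD a b (q : 'M[C]_a) (r : 'M[C]_b) (Y Z : 'M_(a, b)) :
  blockdiag q r (Y + Z) = blockdiag q r Y + blockdiag q r Z.
Proof.
rewrite /blockdiag mulmxDl mulmxDr opprD [RHS]addrACA; congr (_ + _).
by rewrite addrACA.
Qed.
Lemma blockdiagN a b (q : 'M[C]_a) (r : 'M[C]_b) (Y : 'M_(a, b)) :
  blockdiag q r (- Y) = - blockdiag q r Y.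
Proof. by rewrite /blockdiag mulNmx mulmxN !opprD. Qed.
Lemma blockdiag0 a b (q : 'M[C]_a) (r : 'M[C]_b) :
  blockdiag q r (0 : 'M_(a, b)) = 0.
Proof. by rewrite /blockdiag mul0mx mulmx0 subrr addr0. Qed.

Lemma degeneration_moment : moment_zero (degeneration 0).
Proof.
have [[m1 m2 m3 m4 m5] _] := mM.
split=> [U|p0 lp lq hp hq|p0 lp lq hp hq|p0 lp lq hp hq|p0 lp lq hp hq] /=;
  rewrite !scale0r !addr0.
- rewrite -(blockdiag_mul (pp _) (pB_inv U) (pA_inv U)).
  rewrite -(blockdiag_mul (pp _) (pA_inv U) (pB'_inv U)) mulmxBr mulmxA.
  (* Since [pa] lands in S, the product a b has no block on the complement, and only b (1 - p)
     survives. *)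
  have -> : pa m U *m pb m U - pa m U *m pb m U *m p (rW U)
    = blockdiag (p (lW U)) (p (rW U)) (pa m U *m pb m U).
    by rewrite /blockdiag mulmxA pa0 mul0mx addr0.
  by rewrite -blockdiagN -!blockdiagD m1 blockdiag0.
- by rewrite -blockdiagN -blockdiagD (m2 _ _ _ hp hq) blockdiag0.
- have h := m3 _ _ _ hp hq.
  have i1 := pC_inv (mkNS5 hq); have i2 := pD_inv (mkNS5 hq).
  have i3 := pC_inv (mkNS5 hp); have i4 := pD_inv (mkNS5 hp).
  rewrite -(blockdiag_mul (pp _) i1 i2) -(blockdiag_mul (pp _) i4 i3).
  by rewrite -blockdiagN -blockdiagD h blockdiag0.
- have h := m4 _ _ _ hp hq.
  rewrite -(blockdiag_mul (pp _) (pD_inv (mkNS5 hp)) (pC_inv (mkNS5 hp))).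
  by rewrite -!blockdiagN -blockdiagD h blockdiag0.
- have h := m5 _ _ _ hp hq.
  rewrite -(blockdiag_mul (pp _) (pC_inv (mkNS5 hq)) (pD_inv (mkNS5 hq))).
  by rewrite -blockdiagD h blockdiag0.
Qed.

Let Ainj U (v : 'cV_(w (rW U))) :
  p (lW U) *m (pA m U *m v) = 0 -> p (rW U) *m v = 0.
Proof. by move=> /Sp /(cf_Ainv cfS) /Sp. Qed.

(** If the limit of A kills u, then p A u = 0, and closure under preimages by A puts u into S. On S
    the limit maps agree with those of m, so (S1) for m applies. *)
Lemma degeneration_S1 U : condS1 (degeneration 0) U.
Proof.
apply/condS1P => T subT /= TB TA Tb v Tv.
have [_ /(_ U)[/condS1P S1 _]] := mM.
have TS u : T u -> p (rW U) *m u = 0.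
  move=> /TA /(congr1 (mulmx (p (lW U)))).
  rewrite scale0r addr0 mulmx0 /blockdiag mulmxA mulmxDr mulmxBr !mulmxA.
  rewrite -pA_inv subrr add0r pp -mulmxA; exact: Ainj.
apply: S1 Tv => // u Tu; have pu := TS _ Tu.
- have := TB _ Tu; rewrite scale0r addr0 /blockdiag mulmxDl mulmxBl -!mulmxA pu.
  by rewrite mulmx0 subr0 mulmxA pB'_inv -!mulmxA pu !mulmx0 addr0.
- have := TA _ Tu; rewrite scale0r addr0 /blockdiag mulmxDl mulmxBl -!mulmxA pu.
  by rewrite mulmx0 subr0 mulmxA pA_inv -!mulmxA pu !mulmx0 addr0.
- have := Tb _ Tu; rewrite scale0r addr0 mulmxBl -!mulmxA pu.
  by rewrite mulmx0 subr0.
Qed.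

(** By (S2) for m, the space (T meet S) + im A is everything. For v = u + A x in S, also x lies in
    S, where the limit of A equals A; hence S is contained in T. Modulo S, the vector v is p A x, a
    value of the limit of A at p x. *)
Lemma degeneration_S2 U : condS2 (degeneration 0) U.
Proof.
apply/condS2P => T subT /= TB TA Ta.
have [[m1 _ _ _ _] /(_ U)[_ /condS2P S2]] := mM.
have TAp u : T (pA m U *m (u - p (rW U) *m u) + p (lW U) *m (pA m U *m u)).
  move: (TA u); rewrite scale0r addr0 /blockdiag mulmxDl mulmxBl mulmxBr.
  by rewrite -!mulmxA.
have TBp u : T (pB m U *m (u - p (lW U) *m u) + p (lW U) *m (pB m U *m u)) \/ ~ T u.
  have [Tu|] := EM (T u); [left | by right].
  move: (TB _ Tu); rewrite scale0r addr0 /blockdiag mulmxDl mulmxBl mulmxBr.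
  by rewrite -!mulmxA.
pose T' v := exists2 u, T u /\ p (lW U) *m u = 0 & exists x, v = u + pA m U *m x.
have dec : forall v, T' v.
  apply: S2.
  - split; first by exists 0; [split; [exact: submod0|rewrite mulmx0] | exists 0; rewrite mulmx0 addr0].
    move=> c _ _ [u [Tu pu] [x ->]] [u' [Tu' pu'] [x' ->]].
    exists (c *: u + u').
      by split; [exact: subT.2|rewrite mulmxDr -scalemxAr pu pu' scaler0 addr0].
    by exists (c *: x + x'); rewrite mulmxDr -scalemxAr scalerDr addrACA.
  - move=> _ [u [Tu pu] [x ->]].
    have pBu : p (lW U) *m (pB m U *m u) = 0.
      by rewrite mulmxA pB_inv -!mulmxA pu !mulmx0.
    (* The moment equation gives B A x = A B' x - a b x; the last term lies in both T and S and is
       absorbed into the first summand. *)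
    exists (pB m U *m u - pa m U *m (pb m U *m x)).
      split; last by rewrite mulmxBr pBu (mulmxA (p _)) pa0 mul0mx subrr.
      apply: submodB => //.
        by case: (TBp u) => // ; rewrite pu subr0 pBu addr0.
      by rewrite [pb m U *m x]mx11_scalar mul_mx_scalar; exact: submodZ.
    exists (pB' m U *m x).
    have := congr1 (mulmx^~ x) (m1 U).
    rewrite mul0mx mulmxDl mulmxBl -!mulmxA => h.
    rewrite mulmxDr -addrA; congr (_ + _); rewrite addrC.
    apply/eqP; rewrite -subr_eq0 -h; apply/eqP.
    by rewrite opprD opprK addrA.
  - move=> v; exists 0; first by split; [exact: submod0|rewrite mulmx0].
    by exists v; rewrite add0r.
  - by exists (pa m U); [split|exists 0; rewrite mulmx0 addr0].
have TS v : p (lW U) *m v = 0 -> T v.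
  move=> pv; have [u [Tu pu] [x vE]] := dec v.
  have pAx : p (lW U) *m (pA m U *m x) = 0.
    by move: pv; rewrite vE mulmxDr pu add0r.
  rewrite vE; apply: submodD => //; have := TAp x.
  by rewrite (Ainj pAx) subr0 pAx addr0.
move=> v; have [u [Tu pu] [x vE]] := dec v.
have -> : v = (v - p (lW U) *m v) + p (lW U) *m v by rewrite subrK.
apply: submodD => //; first by apply: TS; rewrite mulmxBr mulmxA pp subrr.
have := TAp (p (rW U) *m x); rewrite mulmxA pp subrr mulmx0 add0r.
by rewrite vE mulmxDr pu add0r [in X in _ -> T X]mulmxA pA_inv -!mulmxA.
Qed.

Lemma degeneration_Mtilde : Mtilde (degeneration 0).
Proof.
split; first exact: degeneration_moment.
by move=> U; split; [exact: degeneration_S1 | exact: degeneration_S2].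
Qed.

Definition contraction (s : C) k : 'M[C]_(w k) := 1%:M - p k + s *: p k.

Lemma contraction_mul s s' k :
  contraction s k *m contraction s' k = contraction (s * s') k.
Proof.
have qp : (1%:M - p k) *m p k = 0 by rewrite mulmxBl mul1mx pp subrr.
have pq : p k *m (1%:M - p k) = 0 by rewrite mulmxBr mulmx1 pp subrr.
rewrite /contraction mulmxDl (mulmxDr (1%:M - _)) (mulmxDr (s *: _)) -!scalemxAl -!scalemxAr qp pq pp.
rewrite !scaler0 addr0 add0r scalerA; congr (_ + _).
by rewrite mulmxBr mulmx1 qp subr0.
Qed.

Lemma contraction1 k : contraction 1 k = 1%:M.
Proof. by rewrite /contraction scale1r subrK. Qed.

Lemma contraction_inv s k : s != 0 ->
  invmx (contraction s^-1 k) = contraction s k.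
Proof.
move=> s0; have h : contraction s^-1 k *m contraction s k = 1%:M.
  by rewrite contraction_mul mulVf // contraction1.
have [u _] := mulmx1_unit h.
by rewrite -[LHS]mulmx1 -h mulmxA mulVmx // mul1mx.
Qed.

Lemma contraction_gauge s : s != 0 ->
  in_gauge_group (fun x : D3 D => contraction s^-1 x).
Proof.
move=> s0 x; have h : contraction s^-1 x *m contraction s x = 1%:M.
  by rewrite contraction_mul mulVf // contraction1.
by have [u _] := mulmx1_unit h.
Qed.

(** The element acts by 1 on S and by s^-1 on the complement. Conjugation fixes the diagonal blocks
    and multiplies the block from the complement to S by s, so the result is polynomial in s. *)
Lemma contraction_conj a b (Y : 'M[C]_(w a, w b)) s : s != 0 ->
  p a *m Y = p a *m Y *m p b ->
  contraction s^-1 a *m Y *m invmx (contraction s^-1 b)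
    = blockdiag (p a) (p b) Y + s *: (Y *m p b - p a *m Y).
Proof.
move=> s0 h; rewrite contraction_inv // /contraction /blockdiag.
set L := (_ *m Y); have LE : L = Y - p a *m Y + s^-1 *: (p a *m Y).
  by rewrite /L mulmxDl mulmxBl mul1mx -scalemxAl.
have Lp : L *m p b = Y *m p b - p a *m Y + s^-1 *: (p a *m Y).
  by rewrite LE mulmxDl mulmxBl -scalemxAl -h.
rewrite mulmxDr mulmxBr mulmx1 -scalemxAr Lp LE scalerDr scalerA mulfV // scale1r.
by apply/matrixP => i j; rewrite !mxE; ring.
Qed.

Lemma act_contraction s : s != 0 ->
  act (fun x : D3 D => contraction s^-1 x) m = degeneration s.
Proof.
move=> s0; rewrite /act /degeneration; congr Pt; apply/functional_extensionality_dep => U.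
- exact: contraction_conj.
- rewrite contraction_inv // /contraction mulmxDr mulmxBr mulmx1.
  by rewrite -scalemxAr.
- by rewrite /contraction mulmxDl mulmxBl mul1mx -scalemxAl pa0 subr0 scaler0 addr0.
- exact: contraction_conj.
- exact: contraction_conj.
- exact: contraction_conj.
- exact: contraction_conj.
Qed.

Lemma chi_contraction s : s != 0 ->
  (chi (fun x : D3 D => contraction s^-1 x))^-1
    = \prod_(V : NS5 D) \det (contraction s (rW V)).
Proof.
move=> s0; rewrite /chi -prodfV; apply: eq_bigr => V _.
by rewrite -det_inv contraction_inv.
Qed.

(** The inverse of [chi] along the path is a product of determinants polynomial in s, so the
    coordinate z extends to s = 0 as well. *)
Lemma polyfun_path z f : polyfun f -> polynomial_path (fun s =>
  f (degeneration s, (\prod_(V : NS5 D) \det (contraction s (rW V))) * z)).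
Proof.
elim=> [c|U i j|U i j|U i j|U i j|U i j|V i j|V i j||f1 f2 _ h1 _ h2
       |f1 f2 _ h1 _ h2] /=.
- exact: polynomial_path_const.
- under eq_fun do rewrite mxE [X in _ + X]mxE.
  exact: polynomial_path_line.
- under eq_fun do rewrite mxE [X in _ + X]mxE.
  exact: polynomial_path_line.
- exact: polynomial_path_const.
- under eq_fun do rewrite mxE [X in _ + X]mxE.
  exact: polynomial_path_line.
- under eq_fun do rewrite mxE [X in _ + X]mxE.
  exact: polynomial_path_line.
- under eq_fun do rewrite mxE [X in _ + X]mxE.
  exact: polynomial_path_line.
- under eq_fun do rewrite mxE [X in _ + X]mxE.
  exact: polynomial_path_line.
- apply: polynomial_pathM; last exact: polynomial_path_const.
  by apply: polynomial_path_prod => V; exact: polynomial_path_det.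
- exact: polynomial_pathD.
- exact: polynomial_pathM.
Qed.

(** The limit at s = 0 lies in the closed lifted orbit, where the last coordinate never vanishes. So
    1 - p is invertible at every V^+, forcing p = 0 there; closure under preimages by A carries p =
    0 across the D5 branes. *)
Lemma stable_contraction_trivial : stable m -> forall k, p k = 0.
Proof.
case=> _ /(_ 1 (oner_neq0 _))[[E polyE EE] _].
pose z s : C := \prod_(V : NS5 D) \det (contraction s (rW V)).
have vanish f : E f -> forall s, s != 0 -> f (degeneration s, z s * 1) = 0.
  move=> Ef s s0.
  have : orbit_lift (m, 1) (degeneration s, z s * 1).
    exists (fun x : D3 D => contraction s^-1 x); first exact: contraction_gauge.
    by rewrite /act_lift /= act_contraction // chi_contraction.
  by rewrite EE => -[_ /(_ f Ef)].
have : orbit_lift (m, 1) (degeneration 0, z 0 * 1).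
  rewrite EE; split; first by split => //; exact: degeneration_Mtilde.
  by move=> f Ef; apply: polynomial_path0 (vanish f Ef); exact: polyfun_path (polyE _ Ef).
case=> g gG /(congr1 snd) /= z0.
have {z0} z0 : z 0 != 0.
  rewrite -[z 0]mulr1 z0 mulr1 invr_eq0 /chi; apply/prodf_neq0 => V _.
  by have := gG (rW V); rewrite unitmxE unitfE.
(* At s = 0 the contraction is 1 - p, and (1 - p) p = 0. *)
have pV (V : NS5 D) : p (rW V) = 0.
  have : contraction 0 (rW V) \in unitmx.
    by rewrite unitmxE unitfE; move/prodf_neq0: z0; apply.
  rewrite /contraction scale0r addr0 => u.
  have h : (1%:M - p (rW V)) *m p (rW V) = 0 by rewrite mulmxBl mul1mx pp subrr.
  by rewrite -[LHS](mulKmx u) h mulmx0.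
have p00 k : w k = 0%N -> p k = 0.
  by move=> wk; apply: eq_mulmx_cV => v; exact: cV0_eq.
apply: brane_ind => [|U pU|V _|k lek]; [exact/p00/mult_left| |exact: pV|].
  apply: eq_mulmx_cV => v; rewrite mul0mx; apply: Ainj.
  by rewrite pU mul0mx.
exact/p00/mult_right.
Qed.
End Degeneration.

Theorem stable_generated (m : pt R D) : stable m -> generated m.
Proof.
move=> sm S cfS k v.
have pS k' := submod_kernel_idempotent (cf_sub cfS k').
pose p k' := s2val (cid2 (pS k')).
have pp k' : p k' *m p k' = p k' by rewrite /p; case: cid2.
have Sp k' u : S k' u <-> p k' *m u = 0 by rewrite /p; case: cid2.
by rewrite Sp (stable_contraction_trivial sm.1 cfS pp Sp sm) mul0mx.
Qed.

End Stability.

(** * Generated points are stable *)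

Section Elimination.
Variables (F : fieldType) (Q : Type) (poly : (Q -> F) -> Prop).
Hypothesis poly_const : forall c, poly (fun=> c).
Hypothesis poly_add : forall f h, poly f -> poly h -> poly (fun q => f q + h q).
Hypothesis poly_mul : forall f h, poly f -> poly h -> poly (fun q => f q * h q).

Lemma poly_sum (I : Type) (r : seq I) (f : I -> Q -> F) :
  (forall i, poly (f i)) -> poly (fun q => \sum_(i <- r) f i q).
Proof.
move=> pf; elim: r => [|i r IHr].
  by under eq_fun do rewrite big_nil.
by under eq_fun do rewrite big_cons; exact: poly_add.
Qed.

Lemma poly_prod (I : Type) (r : seq I) (f : I -> Q -> F) :
  (forall i, poly (f i)) -> poly (fun q => \prod_(i <- r) f i q).
Proof.
move=> pf; elim: r => [|i r IHr].
  by under eq_fun do rewrite big_nil.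
by under eq_fun do rewrite big_cons; exact: poly_mul.
Qed.

Lemma poly_det n (N : Q -> 'M[F]_n) : (forall i j, poly (fun q => N q i j)) ->
  poly (fun q => \det (N q)).
Proof.
move=> pN; rewrite /determinant; apply: poly_sum => s; apply: poly_mul => //.
by apply: poly_prod => i.
Qed.

Lemma poly_mulmx l m n (M : Q -> 'M[F]_(l, m)) (N : Q -> 'M[F]_(m, n)) :
  (forall i j, poly (fun q => M q i j)) -> (forall i j, poly (fun q => N q i j)) ->
  forall i j, poly (fun q => (M q *m N q) i j).
Proof.
move=> pM pN i j; under eq_fun do rewrite mxE.
by apply: poly_sum => k; exact: poly_mul.
Qed.

Lemma poly_adj n (N : Q -> 'M[F]_n) : (forall i j, poly (fun q => N q i j)) ->
  forall i j, poly (fun q => (\adj (N q)) i j).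
Proof.
move=> pN i j; under eq_fun do rewrite mxE /cofactor.
apply: poly_mul => //; apply: poly_det => k l.
by under eq_fun do rewrite !mxE.
Qed.

Variables (n : nat) (eqs : (Q -> 'cV[F]_n -> F) -> Prop) (c : 'rV[F]_n).
Hypothesis eqs_lin : forall E, eqs E -> forall q a u v,
  E q (a *: u + v) = a * E q u + E q v.
Hypothesis eqs_poly : forall E, eqs E -> forall v, poly (fun q => E q v).

Definition solution q v := (forall E, eqs E -> E q v = 0) /\ c *m v = 1%:M.

(* A system of linear equations with polynomial coefficients, normalized by
   [c v = 1], is solvable over O; Cramer's rule extends the solution to a point
   of the closure of O where the homogeneous system has no nonzero solution. *)
Lemma elimination (O : Q -> Prop) (q0 : Q) :
  (forall q, O q -> exists v, solution q v) ->
  (forall f, poly f -> (forall q, O q -> f q = 0) -> f q0 = 0) ->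
  (forall v, (forall E, eqs E -> E q0 v = 0) -> c *m v = 0 -> v = 0) ->
  exists v0 (kap : Q -> 'cV[F]_n) d,
    [/\ solution q0 v0, poly d /\ d q0 != 0,
      forall i, poly (fun q => kap q i 0), kap q0 = d q0 *: v0 &
      forall q v, O q -> solution q v -> kap q = d q *: v].
Proof.
move=> solO clo triv.
pose rowE (E : Q -> 'cV[F]_n -> F) q : 'rV_n := \row_i E q (delta_mx i 0).
have rowEE E q v : eqs E -> rowE E q *m v = (E q v)%:M.
  move=> eE; apply/matrixP => i j; rewrite !ord1 !mxE mulr1n.
  have E0 : E q 0 = 0.
    have := eqs_lin eE q 1 0 0; rewrite scale1r addr0 mul1r => /eqP.
    by rewrite -subr_eq0 opprD addrA subrr sub0r oppr_eq0 => /eqP.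
  have Esum (r : seq 'I_n) (f : 'I_n -> 'cV_n) (a : 'I_n -> F) :
      E q (\sum_(k <- r) a k *: f k) = \sum_(k <- r) a k * E q (f k).
    elim: r => [|k r IHr]; first by rewrite !big_nil.
    by rewrite !big_cons eqs_lin // IHr.
  have -> : v = \sum_k v k 0 *: delta_mx k 0.
    rewrite {1}[v]matrix_sum_delta; apply: eq_bigr => k _.
    by rewrite big_ord1.
  rewrite Esum; apply: eq_bigr => k _; rewrite mxE mulrC; congr (_ * _).
  rewrite summxE (bigD1 k) //= big1 => [|l lk]; rewrite !mxE ?eqxx /=.
    by rewrite mulr1 addr0.
  by rewrite eq_sym (negbTE lk) mulr0.
(* At q0 the equations together with c have trivial common kernel, so n of these covectors form an
   invertible matrix. The same n equations at a general q give [N q], with right-hand side 1 for c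
   and 0 for the others. *)
pose Qs (r : 'rV_n) := r = c \/ exists2 E, eqs E & r = rowE E q0.
have [N0 N0u QN0] : exists2 N : 'M[F]_n, N \in unitmx & forall i, Qs (row i N).
  apply: spanning_rows => v Qv; apply: triv; last by apply: Qv; left.
  move=> E eE; have := Qv (rowE E q0) (or_intror (ex_intro2 _ _ E eE erefl)).
  rewrite rowEE // => /matrixP/(_ 0 0); rewrite !mxE mulr1n; exact.
have /choice[Re ReP] : forall i, exists Re : (Q -> 'rV[F]_n) * F,
    [/\ Re.1 q0 = row i N0, forall j, poly (fun q => Re.1 q 0 j) &
    forall q v, solution q v -> Re.1 q *m v = Re.2%:M].
  move=> i; case: (QN0 i) => [->|[E eE ->]].
    by exists (fun=> c, 1); split=> //= q v [].
  exists (rowE E, 0); split=> //= [j|q v [/(_ E eE) Ev _]].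
    under eq_fun do rewrite mxE; exact: eqs_poly.
  by rewrite rowEE // Ev.
pose N q := \matrix_i (Re i).1 q.
pose r := \col_i (Re i).2.
have NN0 : N q0 = N0.
  by apply/row_matrixP => i; rewrite rowK; case: (ReP i).
have polyN i j : poly (fun q => N q i j).
  by under eq_fun do rewrite mxE; case: (ReP i).
have Nsol q v : solution q v -> N q *m v = r.
  move=> sv; apply/row_matrixP => i; rewrite row_mul rowK.
  have [_ _ ->//] := ReP i.
  by apply/matrixP => a b; rewrite !ord1 !mxE mulr1n.
(* The Cramer numerator and denominator, polynomial on all of Q even where [N q] is singular. *)
pose kap q := \adj (N q) *m r; pose d q := \det (N q).
have kapO q v : O q -> solution q v -> kap q = d q *: v.
  by move=> _ /Nsol h; rewrite /kap -h mulmxA mul_adj_mx mul_scalar_mx.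
have d0 : d q0 != 0 by rewrite /d NN0 -unitfE -unitmxE.
pose v0 := invmx N0 *m r.
have kap0 : kap q0 = d q0 *: v0.
  have rE : N0 *m v0 = r by rewrite /v0 mulKVmx.
  by rewrite /kap /d NN0 -rE mulmxA mul_adj_mx mul_scalar_mx.
have polyk i : poly (fun q => kap q i 0).
  apply: poly_mulmx; first exact: poly_adj.
  by move=> k l; exact: poly_const.
have polyd : poly d by exact: poly_det.
suff sol0 : solution q0 v0.
  by exists v0, kap, d.
split.
  move=> E eE.
  have Elin q v : E q v = (rowE E q *m v) 0 0 by rewrite rowEE // mxE mulr1n.
  (* The equation holds for [kap] on O, passes to q0 by closure, and is then divided by d q0. *)
  have : E q0 (kap q0) = 0.
    rewrite Elin; apply: (clo (fun q => (rowE E q *m kap q) 0 0)).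
      apply: poly_mulmx => i j; last by rewrite (ord1 j).
      by under eq_fun do rewrite mxE; exact: eqs_poly.
    move=> q Oq; have [v sv] := solO q Oq.
    by rewrite (kapO q v Oq sv) -scalemxAr rowEE // sv.1 // !mxE mul0rn mulr0.
  rewrite kap0 Elin -scalemxAr mxE -Elin => /eqP.
  by rewrite mulf_eq0 (negbTE d0) => /eqP.
apply/matrixP => i j; rewrite !ord1 [in RHS]mxE mulr1n.
have h : (c *m kap q0) 0 0 + -1 * d q0 = 0.
  apply: (clo (fun q => (c *m kap q) 0 0 + -1 * d q)).
    apply: poly_add; last exact: poly_mul.
    by apply: poly_mulmx => k l; [exact: poly_const | rewrite (ord1 l)].
  move=> q Oq; have [v sv] := solO q Oq.
  by rewrite (kapO q v Oq sv) -scalemxAr sv.2 !mxE mulr1n mulr1 mulN1r subrr.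
move: h; rewrite kap0 -scalemxAr mxE mulN1r => /eqP.
rewrite subr_eq0 -{2}[d q0]mulr1 => /eqP; exact: mulfI.
Qed.
End Elimination.

(** * Homomorphisms between points *)

Section ClosedOrbit.
Variables (R : realType) (D : brane_diagram).
Local Notation C := R[i].
Local Notation w x := (mult D x).
Local Notation lW W := (lft (val W)).
Local Notation rW W := (rgt (val W)).

(** Padding by the identity turns a gauge element indexed by D3 branes into a family over [nat], as
    required by [brane_ind] and [closed_family]. *)
Definition extend (g : gauge R D) (k : nat) : 'M[C]_(w k) :=
  if @idP (k < (nb D).+1)%N is ReflectT h then g (Ordinal h) else 1%:M.

Lemma extendE (g : gauge R D) (x : D3 D) : extend g x = g x.
Proof.
rewrite /extend; case: x => k lk /=; case: {-}_ / idP => [h|]; last by [].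
by rewrite (bool_irrelevance h lk).
Qed.

Lemma extend_gauge (g : gauge R D) : g = (fun x : D3 D => extend g x).
Proof. by apply/functional_extensionality_dep => x; rewrite extendE. Qed.

(** Homomorphisms that are zero on the lines C_U, such as the difference of two [pt_hom]. *)
Record null_hom (m m' : pt R D) (h : forall k, 'M[C]_(w k)) : Prop := NullHom {
  nh_A : forall U : D5 D, h (lW U) *m pA m U = pA m' U *m h (rW U);
  nh_b : forall U : D5 D, pb m' U *m h (rW U) = 0;
  nh_a : forall U : D5 D, h (lW U) *m pa m U = 0;
  nh_B : forall U : D5 D, h (lW U) *m pB m U = pB m' U *m h (lW U);
  nh_B' : forall U : D5 D, h (rW U) *m pB' m U = pB' m' U *m h (rW U);
  nh_C : forall V : NS5 D, h (lW V) *m pC m V = pC m' V *m h (rW V);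
  nh_D : forall V : NS5 D, h (rW V) *m pD m V = pD m' V *m h (lW V) }.

(** The kernels of h form a closed family for m, hence are everything. Closure under preimages by A
    comes from (S1) for m'. *)
Lemma null_hom0 m m' h : generated m -> Mtilde m' -> null_hom m m' h ->
  forall k, h k = 0.
Proof.
move=> gen [[mu _ _ _ _] S12] [hA hb ha hB hB' hC hD] k.
apply: eq_mulmx_cV => v; rewrite mul0mx.
apply: (gen (fun k x => h k *m x = 0)); split=> {k v}.
- by move=> k; exact: mx0_submod.
- exact: ha.
- by move=> U v hv; rewrite mulmxA hA -mulmxA hv mulmx0.
- move=> U v hv; have [/condS1P S1 _] := S12 U.
  (* On the intersection of im h with ker A', the map b' vanishes, so the moment equation makes it
     stable under B'. *)
  apply: (S1 (fun y => pA m' U *m y = 0 /\ exists x, y = h (rW U) *m x)).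
  + split; first by split; [rewrite mulmx0 | exists 0; rewrite mulmx0].
    move=> c y y' [A1 [x1 yE]] [A2 [x2 yE']]; subst y y'; split.
      by rewrite mulmxDr -scalemxAr A1 A2 scaler0 addr0.
    by exists (c *: x1 + x2); rewrite mulmxDr -scalemxAr.
  + move=> y [A1 [x1 yE]]; subst y; split; last first.
      by exists (pB' m U *m x1); rewrite !mulmxA hB'.
    have := congr1 (mulmx^~ (h (rW U) *m x1)) (mu U).
    rewrite mul0mx mulmxDl mulmxBl -!mulmxA A1 mulmx0 sub0r.
    rewrite [pb m' U *m _]mulmxA hb mul0mx mulmx0 addr0 => /eqP.
    by rewrite oppr_eq0 => /eqP.
  + by move=> y [].
  + by move=> y [_ [x ->]]; rewrite mulmxA hb mul0mx.
  + by split; [rewrite mulmxA -hA -mulmxA | exists v].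
- by move=> U v hv; rewrite mulmxA hB -mulmxA hv mulmx0.
- by move=> U v hv; rewrite mulmxA hB' -mulmxA hv mulmx0.
- by move=> V v hv; rewrite mulmxA hC -mulmxA hv mulmx0.
- by move=> V v hv; rewrite mulmxA hD -mulmxA hv mulmx0.
Qed.

Record pt_hom (m m' : pt R D) (h : forall k, 'M[C]_(w k)) : Prop := Hom {
  hom_A : forall U : D5 D, h (lW U) *m pA m U = pA m' U *m h (rW U);
  hom_b : forall U : D5 D, pb m' U *m h (rW U) = pb m U;
  hom_a : forall U : D5 D, h (lW U) *m pa m U = pa m' U;
  hom_B : forall U : D5 D, h (lW U) *m pB m U = pB m' U *m h (lW U);
  hom_B' : forall U : D5 D, h (rW U) *m pB' m U = pB' m' U *m h (rW U);
  hom_C : forall V : NS5 D, h (lW V) *m pC m V = pC m' V *m h (rW V);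
  hom_D : forall V : NS5 D, h (rW V) *m pD m V = pD m' V *m h (lW V) }.

Lemma act_hom m (h : forall k, 'M[C]_(w k)) :
  in_gauge_group (fun x : D3 D => h x) -> pt_hom m (act (fun x : D3 D => h x) m) h.
Proof.
by move=> hu; split=> W; have ul := hu (lW W); have ur := hu (rW W);
  rewrite //= -?mulmxA mulVmx ?mulmx1.
Qed.

Lemma hom_act m m' (h : forall k, 'M[C]_(w k)) :
  in_gauge_group (fun x : D3 D => h x) -> pt_hom m m' h ->
  m' = act (fun x : D3 D => h x) m.
Proof.
move=> hu [hA hb ha hB hB' hC hD]; case: m' hA hb ha hB hB' hC hD.
move=> A b a B B' Cm Dm /= hA hb ha hB hB' hC hD; rewrite /act.
have simp n (y : D3 D) (Y : 'M_(n, w y)) : Y = Y *m h y *m invmx (h y).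
  by rewrite mulmxK //; exact: hu.
congr Pt; apply/functional_extensionality_dep => W.
- by rewrite [LHS]simp hA.
- by rewrite [LHS]simp hb.
- by rewrite ha.
- by rewrite [LHS]simp hB.
- by rewrite [LHS]simp hB'.
- by rewrite [LHS]simp hC.
- by rewrite [LHS]simp hD.
Qed.

Lemma hom_unique m m' h h' : generated m -> Mtilde m' ->
  pt_hom m m' h -> pt_hom m m' h' -> forall k, h k = h' k.
Proof.
move=> gen Mm' [hA hb ha hB hB' hC hD] [kA kb ka kB kB' kC kD] k.
apply/eqP; rewrite -subr_eq0; apply/eqP.
apply: (null_hom0 (h := fun k => h k - h' k) gen Mm').
by split=> W; rewrite ?mulmxBl ?mulmxBr ?hA ?hb ?ha ?hB ?hB' ?hC ?hD
  ?kA ?kb ?ka ?kB ?kB' ?kC ?kD ?subrr.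
Qed.

Lemma act_unique (m : pt R D) (g g' : gauge R D) : generated m -> Mtilde (act g m) ->
  in_gauge_group g -> in_gauge_group g' -> act g m = act g' m -> g = g'.
Proof.
move=> gen Mg gu gu' e; apply/functional_extensionality_dep => x.
rewrite -!(extendE _ x).
have gE := extend_gauge g; have gE' := extend_gauge g'.
have h1 : pt_hom m (act g m) (extend g).
  by rewrite [X in act X]gE; apply: act_hom; rewrite -gE.
have h2 : pt_hom m (act g m) (extend g').
  by rewrite e [X in act X]gE'; apply: act_hom; rewrite -gE'.
exact: (hom_unique gen Mg h1 h2 x).
Qed.

(** Across a D5 brane invertibility propagates to the right: if h is injective at U^-, its kernel at
    U^+ is killed by A and b and is stable under B', so (S1) applies. Thus the determinants entering
    [chi] decide invertibility everywhere. *)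
Lemma hom_unit m m' h : Mtilde m -> pt_hom m m' h ->
  (forall V : NS5 D, h (rW V) \in unitmx) -> forall k, h k \in unitmx.
Proof.
move=> [_ S12] [hA hb ha hB hB' hC hD] uV.
have u0 n (M : 'M[C]_n) : n = 0%N -> M \in unitmx.
  by move=> n0; subst n; rewrite unitmxE det_mx00 unitr1.
apply: brane_ind => [|U hU|V _|k lek].
- exact/u0/mult_left.
- have [/condS1P S1 _] := S12 U.
  rewrite -unitmx_tr -row_free_unit -kermx_eq0; apply/rowV0P => v.
  move/sub_kermxP => v0; apply: trmx_inj; rewrite trmx0.
  apply: (S1 _ (mx0_submod (h (rW U)))).
  + by move=> x hx; rewrite mulmxA hB' -mulmxA hx mulmx0.
  + move=> x hx; rewrite -[LHS](mulKmx hU) (mulmxA (h _)) hA.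
    by rewrite -(mulmxA _ _ x) hx !mulmx0.
  + by move=> x hx; rewrite -hb -mulmxA hx mulmx0.
  + by apply: trmx_inj; rewrite trmx_mul trmxK trmx0.
- exact: uV.
- exact/u0/mult_right.
Qed.

Lemma act_Mtilde (m : pt R D) (g : gauge R D) : in_gauge_group g -> Mtilde m -> Mtilde (act g m).
Proof.
rewrite (extend_gauge g); set h := extend g => hu [mu S12].
have V k : w k = 0%N \/ h k \in unitmx.
  have [lek|ltk] := ltnP k (nb D).+1; first by right; exact: (hu (Ordinal lek)).
  by left; apply: mult_right; exact: ltnW.
have {V} V k : h k \in unitmx.
  have [k0|//] := V k; rewrite unitmxE.
  suff -> : h k = 1%:M by rewrite det1 unitr1.
  by apply: eq_mulmx_cV => v; exact: cV0_eq.
have Vk n (k : nat) (Y : 'M[C]_(n, w k)) : Y *m invmx (h k) *m h k = Y.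
  by rewrite mulmxKV.
split.
  have [m1 m2 m3 m4 m5] := mu.
  split=> [U|p0 lp lq hp hq|p0 lp lq hp hq|p0 lp lq hp hq|p0 lp lq hp hq] /=;
    rewrite ?mulmxA ?Vk -?mulmxBl -?mulmxDl.
  - rewrite -!(mulmxA (h _)) -mulmxBr -mulmxDr m1.
    by rewrite mulmx0 mul0mx.
  - by rewrite -mulmxBr (m2 _ _ _ hp hq) mulmx0 mul0mx.
  - rewrite -!(mulmxA (h _)) -mulmxBr.
    by have /= -> := m3 _ _ _ hp hq; rewrite mulmx0 mul0mx.
  - rewrite -opprD -mulmxDl -!(mulmxA (h _)) -mulmxDr.
    have := m4 _ _ _ hp hq; rewrite -opprD => /eqP; rewrite oppr_eq0 => /eqP /= ->.
    by rewrite mulmx0 mul0mx oppr0.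
  - rewrite -!(mulmxA (h _)) -mulmxDr.
    by have /= -> := m5 _ _ _ hp hq; rewrite mulmx0 mul0mx.
move=> U; have [/condS1P S1 /condS2P S2] := S12 U; split.
  apply/condS1P => S subS /= SB SA Sb v Sv.
  rewrite -[v](mulKVmx (V _)).
  suff -> : invmx (h (rW U)) *m v = 0 by rewrite mulmx0.
  apply: (S1 (fun x => S (h (rW U) *m x))).
  - split; first by rewrite mulmx0; exact: submod0.
    move=> c x y Sx Sy; rewrite mulmxDr -scalemxAr; exact: subS.2.
  - by move=> x /SB; rewrite -!mulmxA mulKmx.
  - move=> x /SA; rewrite -!mulmxA mulKmx // => /(congr1 (mulmx (invmx (h (lW U))))).
    by rewrite mulKmx // mulmx0.
  - by move=> x /Sb; rewrite -!mulmxA mulKmx.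
  - by rewrite mulKVmx.
apply/condS2P => T subT /= TB TA Ta v.
rewrite -[v](mulKVmx (V _)).
apply: (S2 (fun x => T (h (lW U) *m x))).
- split; first by rewrite mulmx0; exact: submod0.
  move=> c x y Sx Sy; rewrite mulmxDr -scalemxAr; exact: subT.2.
- by move=> x /TB; rewrite -!mulmxA mulKmx.
- by move=> x; have := TA (h (rW U) *m x); rewrite -!mulmxA mulKmx.
- exact: Ta.
Qed.

End ClosedOrbit.

(** * Orbits of generated points are closed *)

Section OrbitEquations.
Variables (R : realType) (D : brane_diagram).
Local Notation C := R[i].
Local Notation w x := (mult D x).
Local Notation lW W := (lft (val W)).
Local Notation rW W := (rgt (val W)).

(** [None] is the common scalar by which the homomorphism acts on all lines C_U. It makes the
    equations homogeneous; [normalization] later sets it to 1. *)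
Definition unknowns : finType := option {x : D3 D & ('I_(w x) * 'I_(w x))%type}.
Local Notation n := #|unknowns|.

Definition family (v : 'cV[C]_n) : gauge R D := fun x =>
  \matrix_(i, j) v (enum_rank (Some (Tagged (fun x : D3 D => ('I_(w x) * 'I_(w x))%type) (i, j)) : unknowns)) 0.
Definition scalar (v : 'cV[C]_n) : C := v (enum_rank (None : unknowns)) 0.
Definition pack (g : gauge R D) (c : C) : 'cV[C]_n :=
  \col_k if enum_val k is Some t then g (tag t) (tagged t).1 (tagged t).2 else c.

Lemma family_pack g c x : family (pack g c) x = g x.
Proof. by apply/matrixP => i j; rewrite !mxE enum_rankK. Qed.

Lemma scalar_pack g c : scalar (pack g c) = c.
Proof. by rewrite /scalar mxE enum_rankK. Qed.

Lemma family_lin a u v x : family (a *: u + v) x = a *: family u x + family v x.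
Proof. by apply/matrixP => i j; rewrite !mxE. Qed.

Lemma scalar_lin a u v : scalar (a *: u + v) = a * scalar u + scalar v.
Proof. by rewrite /scalar !mxE. Qed.

Lemma unknowns_eq0 v : (forall x, family v x = 0) -> scalar v = 0 -> v = 0.
Proof.
move=> fv sv; apply/colP => k; rewrite [RHS]mxE -(enum_valK k).
case: (enum_val k) => [[x [i j]]|]; last exact: sv.
by have /matrixP/(_ i j) := fv x; rewrite !mxE.
Qed.

Definition normalization : 'rV[C]_n := delta_mx 0 (enum_rank (None : unknowns)).

Lemma normalizationE v : normalization *m v = (scalar v)%:M.
Proof.
rewrite /normalization -rowE; apply/matrixP => i j.
by rewrite !ord1 !mxE mulr1n.
Qed.

Variable m : pt R D.

Inductive hom_eqs : (pt R D * C -> 'cV[C]_n -> C) -> Prop :=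
| hom_eqs_A (U : D5 D) i j : hom_eqs (fun q v =>
    (family v (lW U) *m pA m U - pA q.1 U *m family v (rW U)) i j)
| hom_eqs_b (U : D5 D) i j : hom_eqs (fun q v =>
    (scalar v *: pb m U - pb q.1 U *m family v (rW U)) i j)
| hom_eqs_a (U : D5 D) i j : hom_eqs (fun q v =>
    (family v (lW U) *m pa m U - scalar v *: pa q.1 U) i j)
| hom_eqs_B (U : D5 D) i j : hom_eqs (fun q v =>
    (family v (lW U) *m pB m U - pB q.1 U *m family v (lW U)) i j)
| hom_eqs_B' (U : D5 D) i j : hom_eqs (fun q v =>
    (family v (rW U) *m pB' m U - pB' q.1 U *m family v (rW U)) i j)
| hom_eqs_C (V : NS5 D) i j : hom_eqs (fun q v =>
    (family v (lW V) *m pC m V - pC q.1 V *m family v (rW V)) i j)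
| hom_eqs_D (V : NS5 D) i j : hom_eqs (fun q v =>
    (family v (rW V) *m pD m V - pD q.1 V *m family v (lW V)) i j).

Let lin_comb a b c d (h1 h2 : 'M[C]_(a, b)) (k1 k2 : 'M[C]_(c, d)) x
   (Y : 'M_(b, d)) (Z : 'M_(a, c)) i j :
  ((x *: h1 + h2) *m Y - Z *m (x *: k1 + k2)) i j =
   x * (h1 *m Y - Z *m k1) i j + (h2 *m Y - Z *m k2) i j.
Proof.
have -> : (x *: h1 + h2) *m Y - Z *m (x *: k1 + k2) =
   x *: (h1 *m Y - Z *m k1) + (h2 *m Y - Z *m k2).
  rewrite mulmxDl mulmxDr -scalemxAl -scalemxAr scalerBr opprD.
  by rewrite addrACA.
by rewrite !mxE.
Qed.

Lemma hom_eqs_lin E : hom_eqs E -> forall q a u v,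
  E q (a *: u + v) = a * E q u + E q v.
Proof.
case=> W i j q x u v; rewrite ?family_lin ?scalar_lin ?lin_comb //.
- rewrite mulmxDr -scalemxAr !mxE; ring.
- rewrite mulmxDl -scalemxAl !mxE; ring.
Qed.

Lemma hom_eqs_poly E : hom_eqs E -> forall v, polyfun (fun q => E q v).
Proof.
have pM a b c (Y : 'M[C]_(a, c)) (Z : pt R D * C -> 'M[C]_(a, b)) (h : 'M_(b, c)) i j :
    (forall i j, polyfun (fun q => Z q i j)) ->
    polyfun (fun q => (Y - Z q *m h) i j).
  move=> pZ; under eq_fun do rewrite mxE [X in _ + X]mxE -mulN1r.
  apply: polyfun_add; first exact: polyfun_const.
  apply: polyfun_mul; first exact: polyfun_const.
  apply: (poly_mulmx (@polyfun_const R D) (@polyfun_add R D) (@polyfun_mul R D)) => //.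
  by move=> k l; exact: polyfun_const.
case=> W i j v; try (by apply: pM => k l; constructor).
under eq_fun do rewrite mxE [X in _ + X]mxE [X in - X]mxE -mulN1r mulrA.
apply: polyfun_add; first exact: polyfun_const.
by apply: polyfun_mul; [exact: polyfun_const | constructor].
Qed.

Lemma hom_solution q (h : forall k, 'M[C]_(w k)) : pt_hom m q.1 h ->
  solution hom_eqs normalization q (pack (fun x : D3 D => h x) 1).
Proof.
move=> [hA hb ha hB hB' hC hD]; split; last by rewrite normalizationE scalar_pack.
move=> E; case=> W i j; rewrite ?family_pack ?scalar_pack ?scale1r
  ?hA ?hb ?ha ?hB ?hB' ?hC ?hD ?subrr mxE //.
Qed.

(** The scalar is named E' so that it can be specialized to 1 for homomorphisms and to 0 for their
    differences. *)
Lemma eqs_family E' q v : (forall E, hom_eqs E -> E q v = 0) -> E' = scalar v ->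
  [/\ forall U : D5 D, family v (lW U) *m pA m U = pA q.1 U *m family v (rW U),
    forall U : D5 D, E' *: pb m U = pb q.1 U *m family v (rW U),
    forall U : D5 D, family v (lW U) *m pa m U = E' *: pa q.1 U,
    forall U : D5 D, family v (lW U) *m pB m U = pB q.1 U *m family v (lW U)
    & (forall U : D5 D, family v (rW U) *m pB' m U = pB' q.1 U *m family v (rW U))
   /\ (forall V : NS5 D, family v (lW V) *m pC m V = pC q.1 V *m family v (rW V))
   /\ (forall V : NS5 D, family v (rW V) *m pD m V = pD q.1 V *m family v (lW V))].
Proof.
move=> Ev ->.
have sub0 a b (Y Z : 'M[C]_(a, b)) : (forall i j, (Y - Z) i j = 0) -> Y = Z.
  move=> YZ; apply/eqP; rewrite -subr_eq0; apply/eqP/matrixP => i j.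
  by rewrite YZ mxE.
split; last split; last split; move=> W; apply: sub0 => i j.
- exact: (Ev _ (hom_eqs_A i j)).
- exact: (Ev _ (hom_eqs_b i j)).
- exact: (Ev _ (hom_eqs_a i j)).
- exact: (Ev _ (hom_eqs_B i j)).
- exact: (Ev _ (hom_eqs_B' i j)).
- exact: (Ev _ (hom_eqs_C i j)).
- exact: (Ev _ (hom_eqs_D i j)).
Qed.

Lemma solution_hom q v : solution hom_eqs normalization q v ->
  pt_hom m q.1 (extend (family v)).
Proof.
case=> Ev; rewrite normalizationE => /matrixP/(_ 0 0); rewrite !mxE !mulr1n => sv.
have [hA hb ha hB [hB' [hC hD]]] := eqs_family Ev (esym sv).
split=> W; rewrite !extendE //; first by rewrite -hb scale1r.
by rewrite ha scale1r.
Qed.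

Hypotheses (mM : Mtilde m) (gen : generated m).

Lemma homogeneous_trivial q v : Mtilde q.1 ->
  (forall E, hom_eqs E -> E q v = 0) -> normalization *m v = 0 -> v = 0.
Proof.
move=> Mq Ev; rewrite normalizationE => /matrixP/(_ 0 0); rewrite !mxE !mulr1n => sv.
have [hA hb ha hB [hB' [hC hD]]] := eqs_family Ev (esym sv).
apply: unknowns_eq0 => // x; rewrite -extendE.
apply: (null_hom0 gen Mq); split=> W; rewrite !extendE //.
  by rewrite -hb scale0r.
by rewrite ha scale0r.
Qed.

(** The equations used are all polynomials vanishing on the orbit. Elimination yields a homomorphism
    to any common zero in Mtilde, and the relation between z' and the determinants makes it
    invertible. *)
Lemma orbit_closed (z : C) : z != 0 ->
  zariski_closed_in (@Mtilde R D `*` setT)%classic (orbit_lift (m, z)).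
Proof.
move=> z0; pose O := orbit_lift (m, z).
exists [set f | polyfun f /\ forall q, O q -> f q = 0]%classic; first by move=> f [].
apply/seteqP; split=> [q Oq|[m' z'] [[/= Mm' _] clo]].
  split; last by move=> f [_]; exact.
  by case: Oq => g gu -> /=; split => //; exact: act_Mtilde.
have homO q : O q -> exists h : forall k, 'M[C]_(w k),
   [/\ pt_hom m q.1 h, in_gauge_group (fun x : D3 D => h x) &
     q.2 = (chi (fun x : D3 D => h x))^-1 * z].
  case=> g gu ->; exists (extend g); rewrite -extend_gauge; split=> //=.
  by rewrite {1}(extend_gauge g); apply: act_hom; rewrite -extend_gauge.
have [|||v0 [kap [d [sol0 [pd d0] pk k0 kO]]]] :=
  elimination (@polyfun_const R D) (@polyfun_add R D) (@polyfun_mul R D)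
   hom_eqs_lin hom_eqs_poly (c := normalization) (O := O) (q0 := (m', z')).
- by move=> q /homO[h [hm _ _]]; exists (pack (fun x : D3 D => h x) 1); exact: hom_solution.
- by move=> f pf fO; exact: clo.
- by move=> v; exact: homogeneous_trivial.
(* The relation z' chi(h) = z on the orbit with denominators cleared: each determinant of size w
   contributes d^w. *)
pose P q := q.2 * (\prod_(V : NS5 D) \det (family (kap q) (rW V)))
   + - z * \prod_(V : NS5 D) \prod_(i < w (rW V)) d q.
have pP : polyfun P.
  apply: polyfun_add; apply: polyfun_mul; first exact: polyfun_z.
  - apply: poly_prod => [||V]; [exact: polyfun_const | exact: polyfun_mul|].
    apply: poly_det; [exact: polyfun_const|exact: polyfun_add|exact: polyfun_mul|].
    by move=> i j; under eq_fun do rewrite mxE; exact: pk.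
  - exact: polyfun_const.
  - apply: poly_prod => [||V]; [exact: polyfun_const | exact: polyfun_mul|].
    by apply: poly_prod => [||i]; [exact: polyfun_const | exact: polyfun_mul|].
have famZ a v x : family (a *: v) x = a *: family v x.
  by apply/matrixP => i j; rewrite !mxE.
have detk q v (V : NS5 D) : kap q = d q *: v ->
    \det (family (kap q) (rW V)) =
    (\prod_(i < w (rW V)) d q) * \det (family v (rW V)).
  by move=> ->; rewrite famZ detZ big_const_ord iter_mulr_1.
have Pz : P (m', z') = 0.
  apply: (clo P); split=> // q Oq.
  have [h [hm hu qz]] := homO q Oq.
  rewrite /P; under eq_bigr do rewrite (detk _ _ _ (kO _ _ Oq (hom_solution hm))).
  rewrite big_split /= qz mulrACA.
  set x := \prod_V _; set y := \prod_(V : NS5 D) \det _.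
  have -> : y = chi (fun x : D3 D => h x).
    by apply: eq_bigr => V _; rewrite family_pack.
  have c0 : chi (fun x : D3 D => h x) != 0.
    by apply/prodf_neq0 => V _; rewrite -unitfE -unitmxE; exact: hu.
  by field.
have zE : z' * \prod_(V : NS5 D) \det (family v0 (rW V)) = z.
  move: Pz; rewrite /P; under eq_bigr do rewrite (detk _ _ _ k0).
  rewrite big_split /=; set x := \prod_V _; set y := \prod_(V : NS5 D) \det _.
  have x0 : x != 0 by apply/prodf_neq0 => V _; apply/prodf_neq0.
  rewrite mulNr mulrCA mulrC -mulrBl => /eqP.
  by rewrite mulf_eq0 (negbTE x0) orbF subr_eq0 => /eqP.
have hm := solution_hom sol0; set h := extend _ in hm.
have hu : forall k, h k \in unitmx.
  apply: (hom_unit mM hm) => V; rewrite /h extendE unitmxE unitfE.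
  have : \prod_(V : NS5 D) \det (family v0 (rW V)) != 0.
    by apply: contraNneq z0 => e; rewrite -zE e mulr0.
  by move/prodf_neq0; apply.
exists (family v0); first by move=> x; rewrite -extendE; exact: hu.
rewrite /act_lift /= {1}(extend_gauge (family v0)).
rewrite -(hom_act (m' := m')) //; congr pair.
rewrite -zE mulrCA mulVf ?mulr1 //.
apply/prodf_neq0 => V _; rewrite -extendE -unitfE -unitmxE; exact: hu.
Qed.

(** The stabilizer is even trivial, by uniqueness of homomorphisms. *)
Theorem generated_stable : stable m.
Proof.
split=> // z z0; split; first exact: orbit_closed.
apply: (sub_finite_set (B := [set (fun x : D3 D => 1%:M)]%classic)); last exact: finite_set1.
move=> g [gu /(congr1 fst) /= gm]; apply: (act_unique gen) => //.
- exact: act_Mtilde.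
- by move=> x; exact: unitmx1.
- rewrite gm; apply: (hom_act (m := m) (h := fun k => 1%:M)).
    by move=> x; exact: unitmx1.
  by split=> W; rewrite ?mul1mx ?mulmx1.
Qed.
End OrbitEquations.

(** * Eigenprojections *)

Section Eigenprojections.
Variables (F : fieldType) (T : choiceType) (L : pred T) (lam : T -> F).
Hypothesis lam_inj : {in L &, injective lam}.

(** The polynomial with roots lam l, l in s, evaluated at g. Indexing by labels lets weight-shifting
    maps act on s through [map]. *)
Definition annihilator n (g : 'M[F]_n) (s : seq T) : 'M_n :=
  foldr (fun l M => (g - (lam l)%:M) *m M) 1%:M s.

Section OneSpace.
Variables (n : nat) (g : 'M[F]_n).
Local Notation ann := (annihilator g).

Lemma annihilator_cat s s' : ann (s ++ s') = ann s *m ann s'.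
Proof. by elim: s => [|l s IHs] /=; rewrite ?mul1mx // IHs mulmxA. Qed.

Lemma annihilator_comm_mx M s : M *m g = g *m M -> M *m ann s = ann s *m M.
Proof.
move=> Mg; elim: s => [|l s IHs] /=; first by rewrite mul1mx mulmx1.
rewrite -mulmxA -IHs !mulmxA; congr (_ *m _).
by rewrite mulmxBr mulmxBl Mg scalar_mxC.
Qed.

Lemma annihilator_comm s s' : ann s *m ann s' = ann s' *m ann s.
Proof. by apply: annihilator_comm_mx; rewrite annihilator_comm_mx. Qed.

Lemma perm_annihilator s s' : perm_eq s s' -> ann s = ann s'.
Proof.
elim: s s' => [|l s IHs] s' ss'; first by rewrite perm_sym in ss'; rewrite (perm_nilP ss').
have ls' : l \in s' by rewrite -(perm_mem ss') mem_head.
case/splitPr: ls' ss' => s1 s2.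
rewrite perm_sym (perm_catCA s1 [:: l] s2) /= perm_cons perm_sym => /IHs IH.
rewrite /= IH !annihilator_cat /= !mulmxA; congr (_ *m _).
by rewrite -(annihilator_comm_mx (M := g - _)) // mulmxBl mulmxBr scalar_mxC.
Qed.

Lemma annihilator_subset s s' : uniq s -> uniq s' -> {subset s <= s'} ->
  exists r, ann s' = ann s *m ann r.
Proof.
move=> us us' ss'; exists [seq x <- s' | x \notin s].
rewrite -annihilator_cat; apply: perm_annihilator.
rewrite perm_sym; apply: (perm_trans _ (permEl (perm_filterC (mem s) s'))).
rewrite perm_cat2r.
apply: uniq_perm; rewrite ?filter_uniq // => x.
by rewrite mem_filter /=; case xs: (x \in s); rewrite //= ss'.
Qed.

Lemma annihilator_eigen s l (v : 'cV_n) : g *m v = lam l *: v ->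
  ann s *m v = (\prod_(x <- s) (lam l - lam x)) *: v.
Proof.
move=> gv; elim: s => [|x s IHs] /=; first by rewrite big_nil scale1r mul1mx.
rewrite -mulmxA IHs -scalemxAr mulmxBl gv mul_scalar_mx -scalerBl scalerA.
by rewrite big_cons mulrC.
Qed.

(** Membership in the sum of the eigenspaces with labels in L, phrased as lying in every subspace
    that contains them. *)
Definition eigenspanned (v : 'cV[F]_n) : Prop := forall Z : 'cV_n -> Prop,
  submod Z -> (forall l u, L l -> g *m u = lam l *: u -> Z u) -> Z v.

(** With u = ann s v an eigenvector for the head l, and c the nonzero product of the differences lam
    l - lam x, the vector v - c^-1 u is killed by ann s. *)
Lemma annihilated_eigenspanned s v : uniq s -> all L s -> ann s *m v = 0 ->
  eigenspanned v.
Proof.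
move=> us Ls sv Z subZ ZL; elim: s us Ls v sv => [|l s IHs] /=.
  by move=> _ _ v; rewrite mul1mx => ->; exact: submod0.
case/andP=> ls us /andP[Ll Ls] v.
rewrite -mulmxA mulmxBl mul_scalar_mx => /eqP; rewrite subr_eq0 => /eqP gu.
set u := ann s *m v in gu.
set c := \prod_(x <- s) (lam l - lam x).
have c0 : c != 0.
  rewrite prodf_seq_neq0; apply/allP => x xs; rewrite subr_eq0.
  apply: contraNneq ls => /lam_inj ->//; exact: (allP Ls).
have -> : v = (v - c^-1 *: u) + c^-1 *: u by rewrite subrK.
apply: submodD => //; last by apply: submodZ => //; exact: ZL gu.
apply: IHs => //; rewrite mulmxBr -scalemxAr (annihilator_eigen _ gu) scalerA.
by rewrite mulVf // scale1r subrr.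
Qed.

(** Choose s0 of minimal rank. Enlarging s0 by s cannot lower the rank, so the image of ann s0
    already lies in that of ann s: it is the smallest of all these images. *)
Lemma minimal_annihilator : exists2 s0, uniq s0 && all L s0 &
  forall s, uniq s -> all L s -> exists Z, ann s0 = ann s *m Z.
Proof.
pose P k := `[< exists2 s, uniq s && all L s & \rank (ann s) = k >].
have exP : exists k, P k by exists (\rank (ann [::])); apply/asboolP; exists [::].
case: (ex_minnP exP) => k /asboolP[s0 us0 rs0] mink; exists s0 => // s us Ls.
case/andP: us0 => us0 Ls0.
pose s1 := undup (s0 ++ s).
have us1 : uniq s1 by exact: undup_uniq.
have [r0 e0] : exists r, ann s1 = ann s0 *m ann r.
  by apply: annihilator_subset => // x xs; rewrite mem_undup mem_cat xs.
have [r e] : exists r, ann s1 = ann s *m ann r.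
  by apply: annihilator_subset => // x xs; rewrite mem_undup mem_cat xs orbT.
have le : (k <= \rank (ann s1))%N.
  apply: mink; apply/asboolP; exists s1 => //; rewrite us1; apply/allP => x.
  by rewrite mem_undup mem_cat => /orP[]; exact: allP.
have sub : ((ann s1)^T <= (ann s0)^T)%MS by rewrite e0 trmx_mul submxMl.
have : ((ann s0)^T <= (ann s1)^T)%MS.
  by rewrite -(geq_leqif (mxrank_leqif_sup sub)) !mxrank_tr rs0.
case/submxP=> Z ZE; exists (ann r *m Z^T); rewrite mulmxA -e.
by apply: trmx_inj; rewrite trmx_mul trmxK.
Qed.

(** Choose an eigenbasis and a label in L for each of its vectors; [pr l] keeps the basis vectors
    labelled l. Injectivity of lam on L makes this independent of the choices on eigenvectors, and
    finitely many labels occur. *)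
Lemma eigenprojections : (forall v, eigenspanned v) ->
  exists pr : T -> 'M[F]_n,
  [/\ forall l, g *m pr l = lam l *: pr l,
     forall l (v : 'cV_n), L l -> g *m v = lam l *: v -> pr l *m v = v,
     forall l l' (v : 'cV_n), L l' -> l != l' -> g *m v = lam l' *: v -> pr l *m v = 0
   & exists s : seq T, forall l, l \notin s -> pr l = 0].
Proof.
move=> spg.
have [N Nu QN] : exists2 N : 'M[F]_n, N \in unitmx &
    forall i, exists2 l, L l & g *m (row i N)^T = lam l *: (row i N)^T.
  apply: (@spanning_rows _ _ (fun q => exists2 l, L l & g *m q^T = lam l *: q^T)).
  move=> v vq; apply/trmx_inj; rewrite trmx0; apply: eq_mulmx_cV => x.
  rewrite mul0mx; apply: (spg x _ (mx0_submod v^T)) => l u Ll gu.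
  by apply: trmx_inj; rewrite trmx_mul trmxK trmx0; apply: vq; exists l; rewrite ?trmxK.
pose wgt i := s2val (cid2 (QN i)).
have Lw i : L (wgt i) by rewrite /wgt; case: cid2.
have gw i : g *m (row i N)^T = lam (wgt i) *: (row i N)^T by rewrite /wgt; case: cid2.
pose P := N^T; have Pu : P \in unitmx by rewrite unitmx_tr.
have gP : g *m P = P *m diag_mx (\row_i lam (wgt i)).
  apply/matrixP => a b; rewrite mul_mx_diag !mxE.
  have /matrixP/(_ a 0) := gw b; rewrite !mxE => e.
  rewrite mulrC -e; apply: eq_bigr => c _; by rewrite !mxE.
pose dl l := diag_mx (\row_i (wgt i == l)%:R : 'rV[F]_n).
have key l (v : 'cV_n) : L l -> g *m v = lam l *: v ->
    forall i, (invmx P *m v) i 0 != 0 -> wgt i = l.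
  move=> Ll gv i vi; apply: lam_inj; [exact: Lw | exact: Ll |].
  have := congr1 (mulmx (invmx P)) gv.
  rewrite -{1}[v](mulKVmx Pu) [g *m _]mulmxA gP -mulmxA mulKmx // -scalemxAr.
  rewrite mul_diag_mx => /matrixP/(_ i 0); rewrite [LHS]mxE [X in X * _]mxE [RHS]mxE.
  exact: (mulIf vi).
exists (fun l => P *m dl l *m invmx P); split.
- move=> l; rewrite !mulmxA gP -!mulmxA scalemxAr; congr (_ *m _).
  rewrite !mulmxA scalemxAl; congr (_ *m _).
  apply/matrixP => a b; rewrite mul_diag_mx !mxE.
  by case: eqP => [->|]; rewrite ?mul0rn ?mulr0 //; case: (a == b); rewrite ?mulr0.
- move=> l v Ll gv; rewrite -!mulmxA -[RHS](mulKVmx Pu); congr (_ *m _).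
  apply/colP => i; rewrite mul_diag_mx [LHS]mxE [X in X * _]mxE.
  have := key l v Ll gv i; set y := (_ *m v) i 0.
  case: (eqVneq (wgt i) l) => [_ _|nl k0]; first by rewrite mul1r.
  by rewrite mul0r; apply/esym/eqP; apply: contraNT nl => /k0 ->.
- move=> l l' v Ll' ll' gv; rewrite -!mulmxA -[RHS](mulmx0 _ P); congr (_ *m _).
  apply/colP => i; rewrite mul_diag_mx [LHS]mxE [X in X * _]mxE [RHS]mxE.
  have := key l' v Ll' gv i; set y := (_ *m v) i 0.
  case: (eqVneq (wgt i) l) => [wl k0|_ _]; last by rewrite mul0r.
  by rewrite mul1r; apply/eqP; apply: contraNT ll' => /k0 <-; rewrite wl.
- exists [seq wgt i | i <- enum 'I_n] => l lw.
  suff -> : dl l = 0 by rewrite mulmx0 mul0mx.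
  apply/matrixP => a b; rewrite !mxE; case: eqP => [e|]; last by rewrite mul0rn.
  by case/negP: lw; rewrite -e; apply: map_f; rewrite mem_enum.
Qed.
End OneSpace.

Lemma annihilator_intertwine n n' (g : 'M[F]_n) (g' : 'M[F]_n') (M : 'M_(n', n))
    c (f : T -> T) s : (forall l, lam l = c * lam (f l)) ->
  M *m g = c *: (g' *m M) ->
  M *m annihilator g s = c ^+ size s *: (annihilator g' (map f s) *m M).
Proof.
move=> lamf Mg; elim: s => [|l s IHs] /=; first by rewrite mulmx1 mul1mx scale1r.
have -> : M *m ((g - (lam l)%:M) *m annihilator g s)
   = c *: ((g' - (lam (f l))%:M) *m (M *m annihilator g s)).
  rewrite !mulmxA scalemxAl; congr (_ *m _).
  by rewrite mulmxBr Mg mulmxBl scalerBr mul_mx_scalar mul_scalar_mx scalerA -lamf.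
by rewrite IHs -scalemxAr scalerA mulmxA -exprS.
Qed.
End Eigenprojections.

(** * Torus-fixed representations *)

Section Representations.
Variables (F : fieldType) (w : nat -> nat) (N : nat) (d5 : pred nat).

(** Indexing by [nat] identifies the space to the right of position k with the one to the left of
    k.+1 by conversion, without transport along brane subtypes. *)
Record rep := Rep {
  rA : forall k, 'M[F]_(w k, w k.+1);
  rb : forall k, 'rV[F]_(w k.+1);
  ra : forall k, 'cV[F]_(w k);
  rX : forall k, 'M[F]_(w k);
  rC : forall k, 'M[F]_(w k, w k.+1);
  rD : forall k, 'M[F]_(w k.+1, w k) }.

Definition is_D5 k := (k < N)%N && d5 k.
Definition is_NS5 k := (k < N)%N && ~~ d5 k.

(* On both sides of a D3 brane k the moment map equations identify B', - D C,
   resp. B, - C D, with one endomorphism rX k. *)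
Record rep_point (r : rep) : Prop := RepPoint {
  rp_moment : forall k, is_D5 k ->
    rX r k *m rA r k - rA r k *m rX r k.+1 + ra r k *m rb r k = 0;
  rp_CD : forall k, is_NS5 k -> rX r k = - (rC r k *m rD r k);
  rp_DC : forall k, is_NS5 k -> rX r k.+1 = - (rD r k *m rC r k);
  rp_S1 : forall k, is_D5 k -> forall S : 'cV[F]_(w k.+1) -> Prop, submod S ->
    (forall v, S v -> S (rX r k.+1 *m v)) -> (forall v, S v -> rA r k *m v = 0) ->
    (forall v, S v -> rb r k *m v = 0) -> forall v, S v -> v = 0;
  rp_S2 : forall k, is_D5 k -> forall T : 'cV[F]_(w k) -> Prop, submod T ->
    (forall v, T v -> T (rX r k *m v)) -> (forall v, T (rA r k *m v)) ->
    T (ra r k) -> forall v, T v }.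

Record rep_closed (r : rep) (S : forall k, 'cV[F]_(w k) -> Prop) : Prop :=
  RepClosed {
  rc_sub : forall k, submod (@S k);
  rc_a : forall k, is_D5 k -> S k (ra r k);
  rc_A : forall k v, is_D5 k -> S k.+1 v -> S k (rA r k *m v);
  rc_Ainv : forall k v, is_D5 k -> S k (rA r k *m v) -> S k.+1 v;
  rc_X : forall k v, S k v -> S k (rX r k *m v);
  rc_C : forall k v, is_NS5 k -> S k.+1 v -> S k (rC r k *m v);
  rc_D : forall k v, is_NS5 k -> S k v -> S k.+1 (rD r k *m v) }.

Definition rep_generated (r : rep) : Prop :=
  forall S, rep_closed r S -> forall k v, S k v.

Definition below (T : zmodType) (f : nat -> T) i := if i is i'.+1 then f i' else 0.

Definition tie_at (n : nat -> nat -> nat) u k := n u k != n u k.+1.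
(** Whether D lowers the string index by one at the NS5 brane k (and C keeps it), or the other way
    round. Left of u the map C matches the tops of the strings, right of u the map D does; a tie
    shortens one string at the top, hence the two cases are opposite. *)
Definition shifts (n : nat -> nat -> nat) u k := (u < k)%N == tie_at n u k.

(** The normal form. For each u the vectors e k u i form a Jordan block with i = 0 killed by X, and
    ep is the dual basis. At u, the top of the left string is a, A keeps indices while they exist on
    the left, and b reads the first index that A cannot reach. *)
Record frame (r : rep) (n : nat -> nat -> nat)
    (e : forall k, nat -> nat -> 'cV[F]_(w k))
    (ep : forall k, nat -> nat -> 'rV[F]_(w k)) : Prop := Frame {
  fr_dual : forall k u i u' i', is_D5 u -> is_D5 u' ->
    (i < n u k)%N -> (i' < n u' k)%N ->
    ep k u i *m e k u' i' = ((u == u') && (i == i'))%:R%:M;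
  fr_total : forall k, \sum_(u < N | d5 u) \sum_(i < n u k) e k u i *m ep k u i = 1%:M;
  fr_X : forall k u i, is_D5 u -> (i < n u k)%N ->
    rX r k *m e k u i = below (e k u) i;
  fr_a : forall k, is_D5 k -> ra r k = below (e k k) (n k k);
  fr_A : forall k u i, is_D5 k -> is_D5 u -> (i < n u k.+1)%N ->
    rA r k *m e k.+1 u i = if (i < n u k)%N then e k u i else 0;
  fr_b : forall k u i, is_D5 k -> is_D5 u -> (i < n u k.+1)%N ->
    rb r k *m e k.+1 u i = ((u == k) && (i == n k k))%:R%:M;
  fr_D : forall k u i, is_NS5 k -> is_D5 u -> (i < n u k)%N ->
    rD r k *m e k u i = (if shifts n u k then below (e k.+1 u) else e k.+1 u) i;
  fr_C : forall k u i, is_NS5 k -> is_D5 u -> (i < n u k.+1)%N ->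
    rC r k *m e k.+1 u i = - (if shifts n u k then e k u else below (e k u)) i }.

(** Numbers of ties at u crossing each D3 brane: growing towards u by steps of at most one at NS5
    branes, with a free jump at u, where ties to the left end and ties to the right begin. *)
Record profile (n : nat -> nat -> nat) : Prop := Profile {
  pf_0 : forall u, is_D5 u -> n u 0%N = 0%N;
  pf_N : forall u k, is_D5 u -> (N <= k)%N -> n u k = 0%N;
  pf_D5 : forall u k, is_D5 u -> is_D5 k -> k != u -> n u k = n u k.+1;
  pf_left : forall u k, is_D5 u -> is_NS5 k -> (k < u)%N ->
    (n u k <= n u k.+1 <= (n u k).+1)%N;
  pf_right : forall u k, is_D5 u -> is_NS5 k -> (u < k)%N ->
    (n u k.+1 <= n u k <= (n u k.+1).+1)%N }.

(** * A representation fixed by one torus element: weights and strings *)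

Section FixedRepresentation.
Variable r : rep.
Hypotheses (rpt : rep_point r) (rgen : rep_generated r).
Variables (g : forall k, 'M[F]_(w k)) (t : nat -> F) (h : F).
Hypothesis h0 : h != 0.
Hypothesis gA : forall k, is_D5 k -> rA r k *m g k.+1 = g k *m rA r k.
Hypothesis gb : forall k, is_D5 k -> rb r k *m g k.+1 = (t k * h) *: rb r k.
Hypothesis ga : forall k, is_D5 k -> g k *m ra r k = t k *: ra r k.
Hypothesis gX : forall k, rX r k *m g k = h *: (g k *m rX r k).
Hypothesis gC : forall k, is_NS5 k -> rC r k *m g k.+1 = h *: (g k *m rC r k).
Hypothesis gD : forall k, is_NS5 k -> rD r k *m g k = g k.+1 *m rD r k.

Local Notation label := (nat * int)%type.
Definition D5_label (l : label) := is_D5 l.1.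
Definition weight (l : label) : F := t l.1 * h ^ l.2.
Definition lower (l : label) : label := (l.1, l.2 - 1).
Definition upper (l : label) : label := (l.1, l.2 + 1).
Hypothesis weight_inj : {in D5_label &, injective weight}.

Lemma lowerK : cancel lower upper.
Proof. by case=> u j; rewrite /lower /upper /= subrK. Qed.
Lemma upperK : cancel upper lower.
Proof. by case=> u j; rewrite /lower /upper /= addrK. Qed.

Lemma weight_lower l : weight l = h * weight (lower l).
Proof.
case: l => u j; rewrite /weight /lower /= mulrCA; congr (_ * _).
by rewrite -{2}[h]expr1z -expfzDr // addrC subrK.
Qed.

Local Notation ann k := (annihilator weight (g k)).

Lemma annX k s : rX r k *m ann k s
  = h ^+ size s *: (ann k (map lower s) *m rX r k).
Proof. by apply: annihilator_intertwine => // l; exact: weight_lower. Qed.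

Lemma annC k s : is_NS5 k -> rC r k *m ann k.+1 s
  = h ^+ size s *: (ann k (map lower s) *m rC r k).
Proof. by move=> Vk; apply: annihilator_intertwine => [l|]; [exact: weight_lower | exact: gC]. Qed.

Lemma annA k s : is_D5 k -> rA r k *m ann k.+1 s = ann k s *m rA r k.
Proof.
move=> Uk.
have e : rA r k *m g k.+1 = 1 *: (g k *m rA r k) by rewrite scale1r gA.
have := @annihilator_intertwine _ _ weight _ _ _ _ _ 1 id s _ e.
by rewrite map_id expr1n scale1r; apply => l; rewrite mul1r.
Qed.

Lemma annD k s : is_NS5 k -> rD r k *m ann k s = ann k.+1 s *m rD r k.
Proof.
move=> Vk.
have e : rD r k *m g k = 1 *: (g k.+1 *m rD r k) by rewrite scale1r gD.
have := @annihilator_intertwine _ _ weight _ _ _ _ _ 1 id s _ e.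
by rewrite map_id expr1n scale1r; apply => l; rewrite mul1r.
Qed.

Lemma map_lower_D5 s : all D5_label s -> all D5_label (map lower s).
Proof. by rewrite all_map; apply: sub_all => -[]. Qed.
Lemma map_upper_D5 s : all D5_label s -> all D5_label (map upper s).
Proof. by rewrite all_map; apply: sub_all => -[]. Qed.

Let annihilated k (v : 'cV[F]_(w k)) :=
  exists s, [/\ uniq s, all D5_label s & ann k s *m v = 0].

(** The vectors lying in the image of every annihilator and killed by A form a subspace to which
    (S1) applies, so they vanish. For s1 containing both s and the minimal s0, the vector ann s1 v
    is of this kind. *)
Let annihilatedAinv k v : is_D5 k -> annihilated (rA r k *m v) ->
  annihilated v.
Proof.
move=> Uk [s [us Ls sv]].
pose Rk (v : 'cV_(w k.+1)) := forall s, uniq s -> all D5_label s ->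
  exists u, v = ann k.+1 s *m u.
have [s0 /andP[us0 Ls0] min0] := minimal_annihilator D5_label weight (g k.+1).
pose s1 := undup (s0 ++ s).
have us1 : uniq s1 by exact: undup_uniq.
have Ls1 : all D5_label s1.
  apply/allP => x; rewrite mem_undup mem_cat => /orP[]; exact: allP.
exists s1; split=> //.
have [q0 e0] : exists q, ann k.+1 s1 = ann k.+1 s0 *m ann k.+1 q.
  by apply: annihilator_subset => // x xs; rewrite mem_undup mem_cat xs.
have [q e] : exists q, ann k.+1 s1 = ann k.+1 s *m ann k.+1 q.
  by apply: annihilator_subset => // x xs; rewrite mem_undup mem_cat xs orbT.
apply: (rp_S1 rpt Uk (S := fun x => Rk x /\ rA r k *m x = 0)).
- split; first by split=> [s2 _ _|]; [exists 0|]; rewrite mulmx0.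
  move=> c x y [Rx Ax] [Ry Ay]; split; last first.
    by rewrite mulmxDr -scalemxAr Ax Ay scaler0 addr0.
  move=> s2 us2 Ls2; have [x' xE] := Rx _ us2 Ls2; have [y' yE] := Ry _ us2 Ls2.
  by exists (c *: x' + y'); rewrite mulmxDr -scalemxAr xE yE.
- move=> x [Rx Ax]; split.
    (* X carries the annihilator of the raised labels to that of s2. *)
    move=> s2 us2 Ls2; have [||u uE] := Rx (map upper s2).
    + by rewrite map_inj_uniq //; exact: can_inj upperK.
    + exact: map_upper_D5.
    exists (h ^+ size s2 *: (rX r k.+1 *m u)).
    rewrite uE mulmxA annX -map_comp (eq_map upperK) map_id size_map.
    by rewrite -scalemxAl -scalemxAr mulmxA.
  have /(congr1 (mulmx^~ x)) := rp_moment rpt Uk.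
  rewrite mul0mx mulmxDl mulmxBl -!mulmxA Ax mulmx0 sub0r.
  (* The label (k, 1) has weight t_k h, the weight of b, so b kills the image of g - t_k h. *)
  have [|//|u uE] := Rx [:: (k, 1)]; first by [].
    by rewrite /= andbT.
  have -> : rb r k *m x = 0.
    rewrite uE /= mulmx1 mulmxA mulmxBr gb // mul_mx_scalar /weight /= expr1z.
    by rewrite subrr mul0mx.
  by rewrite mulmx0 addr0 => /eqP; rewrite oppr_eq0 => /eqP.
- by move=> x [].
- move=> x [Rx _]; have [|//|u uE] := Rx [:: (k, 1)]; first by [].
    by rewrite /= andbT.
  rewrite uE /= mulmx1 mulmxA mulmxBr gb // mul_mx_scalar /weight /= expr1z.
  by rewrite subrr mul0mx.
- split.
    move=> s2 us2 Ls2; have [Z ZE] := min0 _ us2 Ls2.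
    by exists (Z *m (ann k.+1 q0 *m v)); rewrite e0 ZE !mulmxA.
  rewrite e annihilator_comm !mulmxA annA // -(mulmxA _ (rA r k)) annA //.
  by rewrite -!mulmxA sv mulmx0.
Qed.

(** Vectors killed by some annihilator form a closed family, so generation makes every vector one of
    them; the weights are distinct, which gives the decomposition. *)
Lemma spanned_by_eigenvectors k (v : 'cV[F]_(w k)) :
  eigenspanned D5_label weight (g k) v.
Proof.
suff [s [us Ls sv]] : annihilated v.
  exact (annihilated_eigenspanned weight_inj us Ls sv).
apply: (rgen (S := fun k v => annihilated v)); split=> {k v} [k|k Uk|k v Uk|k v Uk|k v|k v Vk|k v Vk].
- split; first by exists [::]; rewrite mulmx0.
  move=> c x y [s1 [us1 Ls1 s1x]] [s2 [us2 Ls2 s2y]].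
  exists (undup (s1 ++ s2)).
  have us : uniq (undup (s1 ++ s2)) by exact: undup_uniq.
  have [q1 e1] : exists q, ann k (undup (s1 ++ s2)) = ann k s1 *m ann k q.
    by apply: annihilator_subset => // z zs; rewrite mem_undup mem_cat zs.
  have [q2 e2] : exists q, ann k (undup (s1 ++ s2)) = ann k s2 *m ann k q.
    by apply: annihilator_subset => // z zs; rewrite mem_undup mem_cat zs orbT.
  split=> //.
    apply/allP => z; rewrite mem_undup mem_cat => /orP[]; exact: allP.
  have -> : ann k (undup (s1 ++ s2)) *m (c *: x + y)
     = c *: (ann k q1 *m (ann k s1 *m x)) + ann k q2 *m (ann k s2 *m y).
    rewrite mulmxDr -scalemxAr {1}e1 e2 !mulmxA.
    by rewrite (annihilator_comm _ _ s1) (annihilator_comm _ _ s2).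
  by rewrite s1x s2y !mulmx0 scaler0 addr0.
- exists [:: (k, 0)]; split=> //; first by rewrite /= andbT.
  by rewrite /= mulmx1 mulmxBl ga // mul_scalar_mx /weight /= expr0z mulr1 subrr.
- case=> s [us Ls sv]; exists s; split=> //.
  by rewrite mulmxA -annA // -mulmxA sv mulmx0.
- exact: annihilatedAinv.
- case=> s [us Ls sv]; exists (map lower s); split.
  + by rewrite map_inj_uniq //; exact: can_inj lowerK.
  + exact: map_lower_D5.
  + have := congr1 (mulmx (rX r k)) sv; rewrite mulmxA annX mulmx0 -scalemxAl.
    rewrite -mulmxA => /eqP; rewrite scaler_eq0 expf_eq0 (negbTE h0) andbF.
    by move/eqP.
- case=> s [us Ls sv]; exists (map lower s); split.
  + by rewrite map_inj_uniq //; exact: can_inj lowerK.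
  + exact: map_lower_D5.
  + have := congr1 (mulmx (rC r k)) sv; rewrite mulmxA annC // mulmx0 -scalemxAl.
    rewrite -mulmxA => /eqP; rewrite scaler_eq0 expf_eq0 (negbTE h0) andbF.
    by move/eqP.
- case=> s [us Ls sv]; exists s; split=> //.
  by rewrite mulmxA -annD // -mulmxA sv mulmx0.
Qed.

Let projections k := eigenprojections weight_inj (spanned_by_eigenvectors (k := k)).
Definition proj k : label -> 'M[F]_(w k) := sval (cid (projections k)).

Definition wt k (l : label) (v : 'cV[F]_(w k)) := g k *m v = weight l *: v.

Lemma wt_proj k l v : wt l (proj k l *m v).
Proof.
rewrite /proj; case: cid => p [/= pw _ _ _]; rewrite /wt mulmxA pw.
by rewrite -scalemxAl.
Qed.

Lemma proj_id k l (v : 'cV[F]_(w k)) : D5_label l -> wt l v -> proj k l *m v = v.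
Proof. by rewrite /proj; case: cid => p [/= _ + _ _]; apply. Qed.

Lemma proj_neq k l l' (v : 'cV[F]_(w k)) : D5_label l' -> l != l' -> wt l' v ->
  proj k l *m v = 0.
Proof. by rewrite /proj; case: cid => p [/= _ _ + _]; apply. Qed.

Lemma proj_supp k : exists s : seq label, forall l, l \notin s -> proj k l = 0.
Proof. by rewrite /proj; case: cid => p []. Qed.

Lemma wt_submod k l : submod (@wt k l).
Proof.
split; first by rewrite /wt mulmx0 scaler0.
by move=> c u v; rewrite /wt mulmxDr -scalemxAr scalerDr => -> ->; rewrite !scalerA mulrC.
Qed.

Lemma eq_on_weights k m (M M' : 'M[F]_(m, w k)) :
  (forall l v, D5_label l -> wt l v -> M *m v = M' *m v) -> M = M'.
Proof.
move=> MM; apply: eq_mulmx_cV => v.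
apply: (@spanned_by_eigenvectors k v (fun v => M *m v = M' *m v)).
  split; first by rewrite !mulmx0.
  by move=> c x y Mx My; rewrite !mulmxDr -!scalemxAr Mx My.
by move=> l u Ll lu; exact: MM lu.
Qed.

Let proj_intertwine k k' (M : 'M[F]_(w k', w k)) (f : label -> label) :
  injective f -> (forall l, D5_label l -> D5_label (f l)) ->
  (forall l v, D5_label l -> wt l v -> wt (f l) (M *m v)) ->
  forall l, M *m proj k l = proj k' (f l) *m M.
Proof.
move=> injf Lf fM l; apply: eq_on_weights => l' v Ll' l'v.
rewrite -!mulmxA; have [e|ll'] := eqVneq l l'.
  by subst l'; rewrite !proj_id //; [exact: Lf | exact: fM].
rewrite (proj_neq Ll' ll' l'v) mulmx0; apply/esym/(@proj_neq _ _ (f l')).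
- exact: Lf.
- by apply: contraNneq ll' => /injf ->.
- exact: fM.
Qed.

Lemma wtA k l v : is_D5 k -> wt l v -> wt l (rA r k *m v).
Proof. by move=> Uk lv; rewrite /wt mulmxA -gA // -mulmxA lv -scalemxAr. Qed.
Lemma wtD k l v : is_NS5 k -> wt l v -> wt l (rD r k *m v).
Proof. by move=> Vk lv; rewrite /wt mulmxA -gD // -mulmxA lv -scalemxAr. Qed.
Lemma wtX k l (v : 'cV_(w k)) : wt l v -> wt (lower l) (rX r k *m v).
Proof.
move=> lv; apply: (scalerI h0); rewrite mulmxA (scalemxAl h (g k *m _)) -gX.
rewrite -mulmxA lv.
by rewrite -scalemxAr scalerA -weight_lower.
Qed.
Lemma wtC k l v : is_NS5 k -> wt l v -> wt (lower l) (rC r k *m v).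
Proof.
move=> Vk lv; apply: (scalerI h0).
rewrite mulmxA (scalemxAl h (g k *m _)) -gC // -mulmxA lv.
by rewrite -scalemxAr scalerA -weight_lower.
Qed.
Lemma wta k : is_D5 k -> wt (k, 0) (ra r k).
Proof. by move=> Uk; rewrite /wt ga // /weight expr0z mulr1. Qed.

Lemma wtb k l v : is_D5 k -> D5_label l -> l != (k, 1) -> wt l v -> rb r k *m v = 0.
Proof.
move=> Uk Ll lk lv; have := congr1 (mulmx (rb r k)) lv.
rewrite mulmxA gb // -scalemxAl -scalemxAr => /eqP.
rewrite -subr_eq0 -scalerBl scaler_eq0 => /orP[|/eqP//].
rewrite subr_eq0 => /eqP e; case/eqP: lk; by apply: weight_inj; rewrite ?unfold_in.
Qed.

Lemma proj_A k l : is_D5 k -> rA r k *m proj k.+1 l = proj k l *m rA r k.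
Proof.
move=> Uk; apply: (proj_intertwine (f := id)) => // l' v _; exact: wtA.
Qed.
Lemma proj_D k l : is_NS5 k -> rD r k *m proj k l = proj k.+1 l *m rD r k.
Proof.
move=> Vk; apply: (proj_intertwine (f := id)) => // l' v _; exact: wtD.
Qed.
Lemma proj_X k l : rX r k *m proj k (upper l) = proj k l *m rX r k.
Proof.
rewrite -{2}(upperK l); apply: (proj_intertwine (f := lower)) => //.
- exact: can_inj lowerK.
- by move=> l' v _; exact: wtX.
Qed.
Lemma proj_C k l : is_NS5 k -> rC r k *m proj k.+1 (upper l) = proj k l *m rC r k.
Proof.
move=> Vk; rewrite -{2}(upperK l); apply: (proj_intertwine (f := lower)) => //.
- exact: can_inj lowerK.
- by move=> l' v _; exact: wtC.
Qed.

(** A graded form of generation, obtained by applying it to the vectors all of whose weight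
    components lie in S. *)
Lemma weight_generation (S : forall k, label -> 'cV[F]_(w k) -> Prop) :
  (forall k l, D5_label l -> submod (@S k l)) ->
  (forall k, is_D5 k -> S k (k, 0) (ra r k)) ->
  (forall k l v, is_D5 k -> D5_label l -> wt l v -> S k.+1 l v ->
    S k l (rA r k *m v)) ->
  (forall k l v, is_D5 k -> D5_label l -> wt l v -> S k l (rA r k *m v) ->
    S k.+1 l v) ->
  (forall k l v, D5_label l -> wt l v -> S k l v -> S k (lower l) (rX r k *m v)) ->
  (forall k l v, is_NS5 k -> D5_label l -> wt l v -> S k.+1 l v ->
    S k (lower l) (rC r k *m v)) ->
  (forall k l v, is_NS5 k -> D5_label l -> wt l v -> S k l v ->
    S k.+1 l (rD r k *m v)) ->
  forall k l v, D5_label l -> wt l v -> S k l v.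
Proof.
move=> subS Sa SA SAi SX SC SD k l v Ll lv; rewrite -(proj_id Ll lv).
apply: (rgen (S := fun k v => forall l, D5_label l -> S k l (proj k l *m v))) Ll.
split=> {k l v lv} [k|k Uk l Ll|k v Uk Sv l Ll|k v Uk Sv l Ll|k v Sv l Ll|k v Vk Sv l Ll|k v Vk Sv l Ll].
- split=> [l Ll|c u v Su Sv l Ll].
    by rewrite mulmx0; exact: submod0 (subS _ _ Ll).
  by rewrite mulmxDr -scalemxAr; apply: (subS k l Ll).2; [exact: Su|exact: Sv].
- have [->|lk] := eqVneq l (k, 0).
    by rewrite proj_id //; [exact: Sa|exact: wta].
  by rewrite (proj_neq _ lk (wta Uk)) //; exact: submod0 (subS _ _ Ll).
- rewrite mulmxA -proj_A // -mulmxA; apply: SA => //; [exact: wt_proj|exact: Sv].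
- apply: SAi => //; first exact: wt_proj.
  by rewrite mulmxA proj_A // -mulmxA; exact: Sv.
- rewrite mulmxA -proj_X -mulmxA -{1}(upperK l).
  by apply: SX; [|exact: wt_proj|exact: Sv].
- rewrite mulmxA -proj_C // -mulmxA -{1}(upperK l).
  by apply: SC => //; [exact: wt_proj|exact: Sv].
- rewrite mulmxA -proj_D // -mulmxA.
  by apply: SD => //; [exact: wt_proj|exact: Sv].
Qed.

Hypotheses (w0 : w 0 = 0%N) (wN : forall k, (N <= k)%N -> w k = 0%N).

Lemma proj_b k : is_D5 k -> rb r k *m proj k.+1 (k, 1) = rb r k.
Proof.
move=> Uk; apply: eq_on_weights => l v Ll lv; rewrite -mulmxA.
have [e|lk] := eqVneq (k, 1) l; first by rewrite e proj_id.
by rewrite (proj_neq Ll lk lv) mulmx0 (wtb Uk Ll _ lv) // eq_sym.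
Qed.

Lemma XA_comm k (v : 'cV_(w k.+1)) : is_D5 k -> rb r k *m v = 0 ->
  rX r k *m (rA r k *m v) = rA r k *m (rX r k.+1 *m v).
Proof.
move=> Uk bv; have /(congr1 (mulmx^~ v)) := rp_moment rpt Uk.
rewrite mul0mx mulmxDl mulmxBl -!mulmxA bv mulmx0 addr0 => /eqP.
by rewrite subr_eq0 => /eqP.
Qed.

Lemma XD_comm k (v : 'cV_(w k)) : is_NS5 k ->
  rX r k.+1 *m (rD r k *m v) = rD r k *m (rX r k *m v).
Proof.
by move=> Vk; rewrite (rp_CD rpt Vk) (rp_DC rpt Vk) !mulNmx mulmxN !mulmxA.
Qed.

Lemma XC_comm k (v : 'cV_(w k.+1)) : is_NS5 k ->
  rX r k *m (rC r k *m v) = rC r k *m (rX r k.+1 *m v).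
Proof.
by move=> Vk; rewrite (rp_CD rpt Vk) (rp_DC rpt Vk) !mulNmx mulmxN !mulmxA.
Qed.

Lemma b_other k u j (v : 'cV_(w k.+1)) : is_D5 k -> is_D5 u -> k != u ->
  wt (u, j) v -> rb r k *m v = 0.
Proof.
move=> Uk Uu ku; apply: wtb => //.
by rewrite xpair_eqE negb_and eq_sym ku.
Qed.

(** The kernel of A among vectors without components of label (k, i) is stable under X, because b
    sees only the label (k, 1); (S1) makes it zero. *)
Lemma A_inj k u j v : is_D5 k -> is_D5 u -> k != u ->
  wt (u, j) v -> rA r k *m v = 0 -> v = 0.
Proof.
move=> Uk Uu ku lv Av.
have bx x : proj k.+1 (k, 1) *m x = 0 -> rb r k *m x = 0.
  by move=> px; rewrite -proj_b // -mulmxA px mulmx0.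
apply: (rp_S1 rpt Uk (S := fun x => rA r k *m x = 0 /\
  forall i, proj k.+1 (k, i) *m x = 0)).
- split=> [|c x y [Ax px] [Ay py]]; first by split=> *; rewrite mulmx0.
  split=> [|i]; first by rewrite mulmxDr -scalemxAr Ax Ay scaler0 addr0.
  by rewrite mulmxDr -scalemxAr px py scaler0 addr0.
- move=> x [Ax px]; split=> [|i].
    by rewrite -XA_comm ?bx // Ax mulmx0.
  by rewrite mulmxA -proj_X -mulmxA px mulmx0.
- by move=> x [].
- by move=> x [_ px]; exact: bx.
- split=> // i; apply: proj_neq lv => //.
  by rewrite xpair_eqE negb_and ku.
Qed.

(** Apply (S2) to the vectors whose components labelled by u all lie in im A: a has label (k, 0), so
    it belongs to them trivially. *)
Lemma A_surj k u j v : is_D5 k -> is_D5 u -> k != u -> wt (u, j) v ->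
  exists2 x, wt (u, j) x & rA r k *m x = v.
Proof.
move=> Uk Uu ku lv.
suff /(_ j)[x xE] : forall i, exists x, rA r k *m x = proj k (u, i) *m v.
  exists (proj k.+1 (u, j) *m x); first exact: wt_proj.
  by rewrite mulmxA proj_A // -mulmxA xE !proj_id.
apply: (rp_S2 rpt Uk (T := fun y => forall i, exists x, rA r k *m x = proj k (u, i) *m y)) => {v lv}.
- split=> [i|c x y Tx Ty i]; first by exists 0; rewrite !mulmx0.
  have [x' xE] := Tx i; have [y' yE] := Ty i.
  by exists (c *: x' + y'); rewrite !mulmxDr -!scalemxAr xE yE.
- move=> y Ty i; have [x xE] := Ty (i + 1).
  have lx := wt_proj (u, i + 1) x.
  exists (rX r k.+1 *m (proj k.+1 (u, i + 1) *m x)).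
  rewrite -XA_comm //; last exact: (b_other Uk Uu ku lx).
  rewrite [rA r k *m _]mulmxA proj_A // -mulmxA xE proj_id //; last exact: wt_proj.
  by rewrite mulmxA (proj_X k (u, i)) -mulmxA.
- by move=> y i; exists (proj k.+1 (u, i) *m y); rewrite !mulmxA proj_A.
- move=> i; exists 0; rewrite mulmx0; apply/esym.
  apply: (proj_neq _ _ (wta Uk)) => //.
  by rewrite xpair_eqE negb_and eq_sym ku.
Qed.

(** * Strings of the endomorphism X *)

Section Strings.
Definition Xpow k i (v : 'cV[F]_(w k)) := iter i (mulmx (rX r k)) v.

Lemma XpowS k i (v : 'cV_(w k)) : Xpow i.+1 v = Xpow i (rX r k *m v).
Proof. exact: iterSr. Qed.

Lemma XpowZ k i c (v : 'cV_(w k)) : Xpow i (c *: v) = c *: Xpow i v.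
Proof. by elim: i => //= i ->; rewrite -scalemxAr. Qed.

Lemma XpowD k i j (v : 'cV_(w k)) : Xpow (i + j) v = Xpow i (Xpow j v).
Proof. exact: iterD. Qed.

Lemma Xpow0 k i : Xpow i (0 : 'cV_(w k)) = 0.
Proof. by elim: i => //= i ->; rewrite mulmx0. Qed.

Lemma wt_Xpow k u j i (v : 'cV_(w k)) : wt (u, j) v -> wt (u, j - i%:Z) (Xpow i v).
Proof.
move=> lv; elim: i => [|i IHi]; first by rewrite subr0.
have -> : j - i.+1%:Z = j - i%:Z - 1 by lia.
exact: (wtX IHi).
Qed.

Lemma Xpow_A k u j i (v : 'cV_(w k.+1)) : is_D5 k -> is_D5 u -> k != u ->
  wt (u, j) v -> Xpow i (rA r k *m v) = rA r k *m Xpow i v.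
Proof.
move=> Uk Uu ku; elim: i j v => // i IHi j v lv; rewrite !XpowS.
rewrite XA_comm //; last exact: b_other lv.
exact: IHi (wtX lv).
Qed.

Lemma Xpow_D k i (v : 'cV_(w k)) : is_NS5 k ->
  Xpow i (rD r k *m v) = rD r k *m Xpow i v.
Proof. by move=> Vk; elim: i v => // i IHi v; rewrite !XpowS XD_comm ?IHi. Qed.

Lemma Xpow_C k i (v : 'cV_(w k.+1)) : is_NS5 k ->
  Xpow i (rC r k *m v) = rC r k *m Xpow i v.
Proof. by move=> Vk; elim: i v => // i IHi v; rewrite !XpowS XC_comm ?IHi. Qed.

(* The string of G, placed in degree om: [rX] lowers the degree by one. *)
Definition in_string k (G : 'cV[F]_(w k)) (om j : int) v :=
  v = 0 \/ exists (i : nat) c, j = om - i%:Z /\ v = c *: Xpow i G.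

Lemma in_string_submod k (G : 'cV[F]_(w k)) om j : submod (in_string G om j).
Proof.
split; first by left.
move=> c x y [->|[i [a [ij ->]]]]; first by rewrite scaler0 add0r.
case=> [->|[i' [a' [ij' ->]]]].
  by right; exists i, (c * a); rewrite addr0 scalerA.
right; exists i, (c * a + a'); split=> //.
have -> : i' = i by move: ij'; rewrite ij; lia.
by rewrite scalerA scalerDl.
Qed.

Lemma in_stringX k (G : 'cV[F]_(w k)) om j v : in_string G om j v ->
  in_string G om (j - 1) (rX r k *m v).
Proof.
case=> [->|[i [a [-> ->]]]]; first by left; rewrite mulmx0.
right; exists i.+1, a; rewrite -scalemxAr; split=> //; lia.
Qed.
End Strings.

(** Recursion on the distance m = u - k. The sign in front of C makes D send the generator at k to X
    times the generator at k.+1. *)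
Fixpoint left_gen_rec m k : 'cV[F]_(w k) :=
  if m is m'.+1 then
    if d5 k then rA r k *m left_gen_rec m' k.+1
    else - (rC r k *m left_gen_rec m' k.+1)
  else ra r k.
Fixpoint left_deg_rec m k : int :=
  if m is m'.+1 then
    if d5 k then left_deg_rec m' k.+1 else left_deg_rec m' k.+1 - 1
  else 0.
Definition left_gen u k := left_gen_rec (u - k) k.
Definition left_deg u k := left_deg_rec (u - k) k.

Lemma left_gen_id u : left_gen u u = ra r u.
Proof. by rewrite /left_gen subnn. Qed.
Lemma left_deg_id u : left_deg u u = 0.
Proof. by rewrite /left_deg subnn. Qed.
Lemma left_genE u k : (k < u)%N -> left_gen u k =
  if d5 k then rA r k *m left_gen u k.+1 else - (rC r k *m left_gen u k.+1).
Proof. by rewrite -subn_gt0 /left_gen subnS; case: (u - k)%N. Qed.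
Lemma left_degE u k : (k < u)%N -> left_deg u k =
  if d5 k then left_deg u k.+1 else left_deg u k.+1 - 1.
Proof. by rewrite -subn_gt0 /left_deg subnS; case: (u - k)%N. Qed.

Lemma D5_true k : is_D5 k -> d5 k = true. Proof. by case/andP. Qed.
Lemma NS5_false k : is_NS5 k -> d5 k = false. Proof. by case/andP=> _ /negbTE. Qed.
Lemma D5_lt k : is_D5 k -> (k < N)%N. Proof. by case/andP. Qed.
Lemma D5_or_NS5 k : (k < N)%N -> if d5 k then is_D5 k else is_NS5 k.
Proof. by rewrite /is_D5 /is_NS5 => ->; case: (d5 k). Qed.

Lemma wt_left_gen u k : is_D5 u -> (k <= u)%N ->
  wt (u, left_deg u k) (left_gen u k).
Proof.
move=> Uu; move: {2}(u - k)%N (erefl (u - k)%N) => m.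
elim: m k => [|m IHm] k um ku.
  have -> : k = u by lia.
  by rewrite left_gen_id left_deg_id; exact: wta.
have lku : (k < u)%N by lia.
have := D5_or_NS5 (ltn_trans lku (D5_lt Uu)).
rewrite left_genE // left_degE //; case: (d5 k) => kN.
  by apply: wtA => //; apply: IHm => //; lia.
apply: (submodN (wt_submod _ _)); apply: (wtC (l := (_, _))) => //.
by apply: IHm => //; lia.
Qed.

Section Generation.
Variable u : nat.
Hypothesis Uu : is_D5 u.

(** The candidate for the part generated by a_u: strings up to u, then preimages by A (from u itself
    on) and images by D. Proving that it is everything yields both the strings on the left and the
    surjectivity of D on the right. *)
Fixpoint string_family k : int -> 'cV[F]_(w k) -> Prop :=
  match k with
  | 0 => fun _ _ => True
  | k'.+1 =>
    if (k' < u)%N then in_string (left_gen u k'.+1) (left_deg u k'.+1)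
    else if d5 k' then fun j v => string_family j (rA r k' *m v)
    else fun j v => exists v', [/\ wt (u, j) v', string_family j v' & v = rD r k' *m v']
  end.

Lemma string_family_left k : (k <= u)%N -> forall j v,
  string_family (k := k) j v <-> in_string (left_gen u k) (left_deg u k) j v.
Proof.
case: k => [_ j v|k ku j v]; last by rewrite /= ku.
by split=> // _; left; exact: cV0_eq.
Qed.

Lemma string_family_submod k j : submod (string_family (k := k) j).
Proof.
elim: k j => [|k IHk] j /=; first by split.
case: (k < u)%N; first exact: in_string_submod.
case: (d5 k).
  split; first by rewrite mulmx0; exact: submod0 (IHk j).
  by move=> c x y Sx Sy; rewrite mulmxDr -scalemxAr; exact: (IHk j).2.
split.
  exists 0; split; [exact: submod0 (wt_submod _ _)|exact: submod0 (IHk j)|].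
  by rewrite mulmx0.
move=> c _ _ [x [lx Sx ->]] [y [ly Sy ->]]; exists (c *: x + y); split.
- exact: (wt_submod _ _).2.
- exact: (IHk j).2.
- by rewrite mulmxDr -scalemxAr.
Qed.

Lemma string_familyX k j v : wt (u, j) v -> string_family (k := k) j v ->
  string_family (j - 1) (rX r k *m v).
Proof.
elim: k j v => [//|k IHk] j v lv.
have [Nk|kN] := leqP N k.+1.
  move=> _; rewrite (cV0_eq (_ *m v) 0 (wN Nk)); exact: submod0 (string_family_submod _ _).
rewrite /=; case: ltnP => ku; first exact: in_stringX.
have := D5_or_NS5 (ltnW kN); case: (d5 k) => hk.
  move=> Sv; have := IHk _ _ (wtA hk lv) Sv.
  have /(congr1 (mulmx^~ v)) := rp_moment rpt hk.
  rewrite mul0mx mulmxDl mulmxBl -!mulmxA => e SX.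
  have -> : rA r k *m (rX r k.+1 *m v) =
     rX r k *m (rA r k *m v) + ra r k *m (rb r k *m v).
    by apply/eqP; rewrite eq_sym -subr_eq0 addrAC e.
  apply: submodD => //; first exact: string_family_submod.
  have [e1|bn] := eqVneq (u, j) (k, 1); last first.
    rewrite (wtb hk _ bn lv) // mulmx0; exact: submod0 (string_family_submod _ _).
  (* The correction a b v in A X v = X A v + a b v survives only in weight (u, 1) at u itself, where
     it is a multiple of a_u, the start of the string. *)
  case: e1 => uk j1; subst k j; rewrite subrr.
  rewrite [rb r u *m v]mx11_scalar mul_mx_scalar.
  apply: submodZ; first exact: string_family_submod.
  apply/string_family_left => //; right; exists 0%N, 1; split.
    by rewrite left_deg_id.
  by rewrite scale1r left_gen_id.
case=> x [lx Sx vE]; exists (rX r k *m x); split; first exact: wtX lx.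
  exact: IHk.
by rewrite vE XD_comm.
Qed.

(** The family satisfies the closure conditions of [weight_generation]: preimages by A use
    injectivity left of u and the definition from u on; C and D move along strings by the
    factorizations of X. *)
Lemma string_family_full k j v : wt (u, j) v -> string_family (k := k) j v.
Proof.
move=> lv.
have := @weight_generation (fun k l v => l.1 = u -> string_family (k := k) l.2 v).
have Uj : D5_label (u, j) by [].
move/(_ _ _ _ _ _ _ _ k (u, j) v Uj lv) => /=; apply=> // {k j v lv Uj}.
- move=> k l _; split=> [lu|c x y Sx Sy lu]; first exact: submod0 (string_family_submod _ _).
  by apply: (string_family_submod _ _).2; [exact: Sx | exact: Sy].
- move=> k Uk /= ku; subst k; apply/string_family_left => //.
  by right; exists 0%N, 1; rewrite left_deg_id left_gen_id scale1r.
- move=> k [u' j] v Uk Ll lv IH /= eu; subst u'; have {}IH := IH erefl.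
  have [ku|uk] := ltnP k u; last by move: IH; rewrite /= ltnNge uk /= (D5_true Uk).
  apply/string_family_left; first exact: ltnW.
  move/string_family_left: IH => /(_ ku)[->|[i [c [jE ->]]]]; first by left; rewrite mulmx0.
  right; exists i, c; rewrite (left_degE ku) (left_genE ku) (D5_true Uk); split=> //.
  rewrite -scalemxAr (Xpow_A (u := u) (j := left_deg u k.+1)) //; first by lia.
  exact: wt_left_gen.
- move=> k [u' j] v Uk Ll lv IH /= eu; subst u'; have {}IH := IH erefl.
  have [ku|uk] := ltnP k u; last by rewrite (D5_true Uk).
  have nku : k != u by lia.
  move/string_family_left: IH => /(_ (ltnW ku)) IH.
  case: IH => [Av|[i [c [jE Av]]]]; first by left; exact: (A_inj Uk Uu nku lv).
  right; exists i, c; move: jE; rewrite (left_degE ku) (D5_true Uk) => /= jE; split=> //.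
  have lG := wt_left_gen Uu ku.
  apply/eqP; rewrite -subr_eq0; apply/eqP/(A_inj Uk Uu nku (j := j)).
    apply: (submodB (wt_submod _ _)) => //; apply: (submodZ (wt_submod _ _)).
    by rewrite jE; exact: wt_Xpow.
  rewrite mulmxBr Av (left_genE ku) (D5_true Uk) (Xpow_A i Uk Uu nku lG).
  by rewrite -scalemxAr subrr.
- move=> k [u' j] v Ll lv IH /= eu; subst u'; have {}IH := IH erefl.
  exact: string_familyX.
- move=> k [u' j] v Vk Ll lv IH /= eu; subst u'; have {}IH := IH erefl.
  have d5k := NS5_false Vk.
  have [ku|uk] := ltnP k u.
    apply/string_family_left; first exact: ltnW.
    move/string_family_left: IH => /(_ ku)[->|[i [c [jE ->]]]]; first by left; rewrite mulmx0.
    right; exists i, (- c); rewrite (left_degE ku) (left_genE ku) d5k; split; first by rewrite /= in jE; lia.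
    by rewrite -scaleN1r XpowZ (Xpow_C i _ Vk) scalerA mulrN1 opprK -scalemxAr.
  move: IH; rewrite /= ltnNge uk d5k /= => -[x [lx Sx ->]].
  rewrite mulmxA -[_ *m rD r k]opprK -(rp_CD rpt Vk) mulNmx.
  apply: (submodN (string_family_submod _ _)); exact: string_familyX.
- move=> k [u' j] v Vk Ll lv IH /= eu; subst u'; have {}IH := IH erefl.
  have d5k := NS5_false Vk.
  have [ku|uk] := ltnP k u; last by rewrite d5k; exists v.
  move/string_family_left: IH => /(_ (ltnW ku))[->|[i [c [jE ->]]]]; first by left; rewrite mulmx0.
  right; exists i.+1, c; move: jE; rewrite (left_degE ku) (left_genE ku) d5k /= => jE; split; first by lia.
  rewrite -scalemxAr -Xpow_D // mulmxN mulmxA -mulNmx -(rp_DC rpt Vk).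
  by rewrite -XpowS.
Qed.

Lemma left_string k j v : (k <= u)%N -> wt (u, j) v ->
  in_string (left_gen u k) (left_deg u k) j v.
Proof. by move=> ku lv; apply/string_family_left => //; exact: string_family_full. Qed.

Lemma D_surj k j v : (u < k)%N -> is_NS5 k -> wt (u, j) v ->
  exists2 x, wt (u, j) x & v = rD r k *m x.
Proof.
move=> uk Vk lv; have := string_family_full lv.
rewrite /= ltnNge (ltnW uk) /= (NS5_false Vk) => -[x [lx _ ->]].
by exists x.
Qed.
End Generation.

Lemma wt_nilpotent k u j (v : 'cV_(w k)) : is_D5 u -> wt (u, j) v ->
  exists m, Xpow m v = 0.
Proof.
move=> Uu lv; have [s sP] := proj_supp k.
(* Only the labels in s carry weight vectors; lowering by one more than the largest distance leaves
   them. *)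
pose m := (\max_(l <- s) absz (j - l.2)%R).+1.
exists m; have := wt_Xpow m lv; set l := (u, _) => ll.
rewrite -(proj_id (l := l) Uu ll) sP ?mul0mx //.
apply/negP => ls; have /= := @leq_bigmax_seq _ s xpredT (fun l => absz (j - l.2)%R) l ls isT.
by rewrite -/m; rewrite /l /=; lia.
Qed.

Definition slen k (v : 'cV[F]_(w k)) : nat :=
  if pselect (exists m, Xpow m v == 0) is left e then ex_minn e else 0%N.

Lemma slen_uniq k m (v : 'cV_(w k)) : Xpow m v = 0 ->
  (forall i, (i < m)%N -> Xpow i v != 0) -> slen v = m.
Proof.
move=> mv minm; rewrite /slen; case: pselect => [e|[]]; last by exists m; apply/eqP.
case: ex_minnP => p /eqP pv minp; apply/eqP; rewrite eqn_leq minp ?mv //=.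
by rewrite leqNgt; apply/negP => /minm; rewrite pv eqxx.
Qed.

(** * The space directly right of u *)

Section OneString.
Variables (u : nat) (Uu : is_D5 u).

Lemma slenP k j (v : 'cV_(w k)) : wt (u, j) v ->
  Xpow (slen v) v = 0 /\ forall i, (i < slen v)%N -> Xpow i v != 0.
Proof.
move=> lv; rewrite /slen; case: pselect => [e|[]]; last first.
  by have [m mv] := wt_nilpotent Uu lv; exists m; apply/eqP.
case: ex_minnP => p /eqP pv minp; split=> // i ip.
by apply: contraTN ip => /minp; rewrite -leqNgt.
Qed.

Lemma slen_le k j (v : 'cV_(w k)) m : wt (u, j) v ->
  (Xpow m v == 0) = (slen v <= m)%N.
Proof.
move=> lv; have [v0 vi] := slenP lv; apply/idP/idP => [mv|sm].
  by rewrite leqNgt; apply/negP => /vi; rewrite mv.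
by rewrite -(subnK sm) XpowD v0 Xpow0.
Qed.

Lemma slen0 k (v : 'cV_(w k)) j : wt (u, j) v -> (slen v == 0%N) = (v == 0).
Proof. by move=> lv; rewrite -leqn0 -(slen_le _ lv). Qed.

Lemma slenZ k j (v : 'cV_(w k)) c : wt (u, j) v -> c != 0 -> slen (c *: v) = slen v.
Proof.
move=> lv c0; have [v0 vi] := slenP lv; apply: slen_uniq => [|i iv].
  by rewrite XpowZ v0 scaler0.
by rewrite XpowZ scaler_eq0 negb_or c0 vi.
Qed.

Local Notation nm := (slen (ra r u)).
Local Notation X1 := (rX r u.+1).

Lemma A_string j (v : 'cV_(w u.+1)) : wt (u, j) v -> rA r u *m v = 0 \/
  exists (i : nat) c, [/\ j = - i%:Z, c != 0, (i < nm)%N & rA r u *m v = c *: Xpow i (ra r u)].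
Proof.
move=> lv; have [->|Av0] := eqVneq (rA r u *m v) 0; first by left.
case: (left_string Uu (leqnn u) (wtA Uu lv)) => [->|]; first by left.
rewrite left_deg_id left_gen_id => -[i [c [jE Av]]]; right; exists i, c.
split=> //; first by rewrite jE sub0r.
  by apply: contraNneq Av0 => c0; rewrite Av c0 scale0r.
rewrite ltnNge -(slen_le _ (wta Uu)); apply: contraNN Av0 => /eqP e.
by rewrite Av e scaler0.
Qed.

(** The line of v is stable under X and killed by A, so (S1) gives b v != 0; this fixes the weight,
    and the moment equation a b v = 0 forces a_u = 0. *)
Lemma socle_A_eq0 j (v : 'cV_(w u.+1)) : wt (u, j) v -> X1 *m v = 0 ->
  rA r u *m v = 0 -> v != 0 -> [/\ rb r u *m v != 0, nm = 0%N & j = 1].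
Proof.
move=> lv Xv Av v0.
have bv : rb r u *m v != 0.
  apply: contraNneq v0 => bv; apply/eqP.
  apply: (rp_S1 rpt Uu (S := fun x => exists c, x = c *: v)); last by exists 1; rewrite scale1r.
  - split; first by exists 0; rewrite scale0r.
    by move=> c _ _ [x ->] [y ->]; exists (c * x + y); rewrite scalerDl scalerA.
  - by move=> _ [c ->]; exists 0; rewrite -scalemxAr Xv scaler0 scale0r.
  - by move=> _ [c ->]; rewrite -scalemxAr Av scaler0.
  - by move=> _ [c ->]; rewrite -scalemxAr bv scaler0.
split=> //; last first.
  apply: contraNeq bv => j1; rewrite (wtb Uu _ _ lv) //.
  by apply: contraNneq j1 => -[->].
apply/eqP; rewrite (slen0 (wta Uu)).
have /(congr1 (mulmx^~ v)) := rp_moment rpt Uu.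
rewrite mul0mx mulmxDl mulmxBl -!mulmxA Av Xv !mulmx0 subr0 add0r.
rewrite [rb r u *m v]mx11_scalar mul_mx_scalar => /eqP.
rewrite scaler_eq0 => /orP[/eqP e|//]; case/eqP: bv.
by rewrite [LHS]mx11_scalar e -scalemx1 scale0r.
Qed.

(** If A v != 0, it is a multiple of X^i a killed by X, so it is the last nonzero vector of the
    string of a. If A v = 0, the formula holds with an empty string. *)
Lemma socle_weight j (v : 'cV_(w u.+1)) : wt (u, j) v -> X1 *m v = 0 -> v != 0 ->
  j = 1 - nm%:Z.
Proof.
move=> lv Xv v0; have [Av|Av] := eqVneq (rA r u *m v) 0.
  by have [_ -> ->] := socle_A_eq0 lv Xv Av v0.
have [/eqP|[i [c [jE c0 ilt Ae]]]] := A_string lv; first by rewrite (negbTE Av).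
have bv : rb r u *m v = 0.
  by apply: (wtb Uu _ _ lv) => //; apply/eqP => -[e]; move: jE; rewrite e; lia.
have : Xpow i.+1 (ra r u) == 0.
  have := XA_comm Uu bv; rewrite Xv mulmx0 Ae -scalemxAr => /eqP.
  by rewrite scaler_eq0 (negbTE c0).
rewrite (slen_le _ (wta Uu)) jE; lia.
Qed.

(** A, or b when A vanishes, has one-dimensional image on this weight. Subtract a multiple of v to
    kill that image; a nonzero remainder would contradict [socle_A_eq0]. *)
Lemma socle_line j (v x : 'cV_(w u.+1)) : wt (u, j) v -> wt (u, j) x ->
  X1 *m v = 0 -> X1 *m x = 0 -> v != 0 -> exists c, x = c *: v.
Proof.
move=> lv lx Xv Xx v0.
have lc c : wt (u, j) (x - c *: v).
  by apply: (submodB (wt_submod _ _)) => //; exact: (submodZ (wt_submod _ _)).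
have Xc c : X1 *m (x - c *: v) = 0.
  by rewrite mulmxBr -scalemxAr Xv Xx scaler0 subrr.
have [Av|Av] := eqVneq (rA r u *m v) 0.
  have [bv n0 j1] := socle_A_eq0 lv Xv Av v0.
  have Ay y : wt (u, j) y -> rA r u *m y = 0.
    by case/A_string => // -[i [c [_ _]]]; rewrite n0.
  pose c := (rb r u *m x) 0 0 / (rb r u *m v) 0 0; exists c.
  apply/eqP; rewrite -subr_eq0; apply: contraT => y0.
  have [] := socle_A_eq0 (lc c) (Xc c) (Ay _ (lc c)) y0.
  move=> + _ _; rewrite mulmxBr -scalemxAr.
  suff -> : rb r u *m x = c *: (rb r u *m v) by rewrite subrr eqxx.
  rewrite [rb r u *m x]mx11_scalar [rb r u *m v]mx11_scalar scale_scalar_mx.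
  rewrite /c divfK //; apply: contraNneq bv => e.
  by apply/eqP; rewrite [LHS]mx11_scalar e -scalemx1 scale0r.
have [/eqP|[i [c [jE c0 ilt Ae]]]] := A_string lv; first by rewrite (negbTE Av).
have [c' Ae'] : exists c', rA r u *m x = c' *: Xpow i (ra r u).
  have [->|[i' [c' [jE' _ _ ->]]]] := A_string lx; first by exists 0; rewrite scale0r.
  by exists c'; have -> : i' = i by move: jE'; rewrite jE; lia.
exists (c' / c); apply/eqP; rewrite -subr_eq0; apply: contraT => y0.
have Ay : rA r u *m (x - (c' / c) *: v) = 0.
  by rewrite mulmxBr -scalemxAr Ae Ae' scalerA divfK // subrr.
have [_ n0 _] := socle_A_eq0 (lc _) (Xc _) Ay y0.
by rewrite n0 in ilt.
Qed.

Lemma middle_slen j (v : 'cV_(w u.+1)) : wt (u, j) v -> v != 0 ->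
  j = (slen v)%:Z - nm%:Z.
Proof.
move=> lv v0; have := v0; rewrite -(slen0 lv); case: (slen v) (slenP lv) => // m [m0 mi] _.
have lm := wt_Xpow m lv; have := socle_weight lm m0 (mi _ (ltnSn m)); lia.
Qed.

(** The degree determines the string length, because all strings end in the same degree. Two vectors
    of equal degree have proportional ends, and the difference, having a shorter string, must be
    zero. *)
Lemma middle_line j (v x : 'cV_(w u.+1)) : wt (u, j) v -> wt (u, j) x ->
  v != 0 -> exists c, x = c *: v.
Proof.
move=> lv lx v0; have [->|x0] := eqVneq x 0; first by exists 0; rewrite scale0r.
have sE : slen v = slen x.
  by have := middle_slen lv v0; rewrite (middle_slen lx x0); lia.
have := v0; rewrite -(slen0 lv).
case: (slen v) sE (slenP lv) => // m sE [m0 mi] _.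
have [mx _] := slenP lx; rewrite -sE in mx.
have [c cE] := socle_line (wt_Xpow m lv) (wt_Xpow m lx) m0 mx (mi _ (ltnSn m)).
exists c; apply/eqP; rewrite -subr_eq0; apply: contraT => y0.
have ly : wt (u, j) (x - c *: v).
  by apply: (submodB (wt_submod _ _)) => //; exact: (submodZ (wt_submod _ _)).
have : Xpow m (x - c *: v) == 0.
  have XB i (y z : 'cV_(w u.+1)) : Xpow i (y - z) = Xpow i y - Xpow i z.
    by elim: i => //= i ->; rewrite mulmxBr.
  by rewrite XB XpowZ cE subrr.
rewrite (slen_le _ ly).
by have := middle_slen ly y0; rewrite (middle_slen lx x0) -sE; lia.
Qed.

(** Take a vector with the longest string; lengths are bounded because finitely many weights occur.
    Each weight space is at most a line, so its string meets all of them. *)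
Lemma middle_gen : exists G : 'cV_(w u.+1), wt (u, (slen G)%:Z - nm%:Z) G /\
  forall j v, wt (u, j) v -> in_string G ((slen G)%:Z - nm%:Z) j v.
Proof.
pose P m := `[< exists v : 'cV_(w u.+1), [/\ wt (u, m%:Z - nm%:Z) v, v != 0 & slen v = m] >].
have slP j (v : 'cV_(w u.+1)) : wt (u, j) v -> v != 0 -> P (slen v).
  by move=> lv v0; apply/asboolP; exists v; rewrite -(middle_slen lv v0).
have [exP|nP] := pselect (exists m, P m); last first.
  exists 0; split; first by rewrite /wt mulmx0 scaler0.
  move=> j v lv; left; apply/eqP; apply: contraT => v0.
  by case: nP; exists (slen v); exact: slP lv v0.
have [s sP] := proj_supp u.+1.
have ubP m : P m -> (m <= \max_(l <- s) absz (l.2 + nm%:Z)%R)%N.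
  move=> /asboolP[v [lv v0 _]].
  have ls : (u, m%:Z - nm%:Z) \in s.
    apply: contraT => /sP e; case/eqP: v0.
    by have := proj_id (l := (u, _)) Uu lv; rewrite e mul0mx => <-.
  have := @leq_bigmax_seq _ s xpredT (fun l => absz (l.2 + nm%:Z)%R) _ ls isT.
  by rewrite /= subrK absz_nat.
case: (ex_maxnP exP ubP) => m /asboolP[G [lG G0 sG]] maxm.
exists G; rewrite sG; split=> // j v lv; have [->|v0] := eqVneq v 0; first by left.
have sm := maxm _ (slP _ _ lv v0); right; exists (m - slen v)%N.
have jE := middle_slen lv v0.
have lX := wt_Xpow (m - slen v) lG.
have e : m%:Z - nm%:Z - (m - slen v)%N%:Z = j by rewrite jE; lia.
rewrite e in lX.
have [|c cE] := middle_line lX lv; last by exists c; rewrite -cE e.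
have [_ Gi] := slenP lG; apply: Gi; rewrite sG.
have : slen v != 0%N by rewrite (slen0 lv).
lia.
Qed.

Lemma in_stringZ k (G : 'cV[F]_(w k)) om j c v : c != 0 ->
  in_string G om j v -> in_string (c *: G) om j v.
Proof.
move=> c0 [->|[i [a [jE ->]]]]; first by left.
by right; exists i, (a / c); split=> //; rewrite XpowZ scalerA divfK.
Qed.

(** The last two clauses fix the scalar left free in the generator: the lower ends of the two
    strings at u are matched by A, or b is set to 1 when the left string is empty. *)
Definition middle_spec (G : 'cV[F]_(w u.+1)) : Prop :=
  [/\ wt (u, (slen G)%:Z - nm%:Z) G,
    forall j v, wt (u, j) v -> in_string G ((slen G)%:Z - nm%:Z) j v,
    (0 < slen G)%N -> (0 < nm)%N ->
      rA r u *m Xpow (slen G).-1 G = Xpow nm.-1 (ra r u)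
  & (0 < slen G)%N -> nm = 0%N -> rb r u *m Xpow (slen G).-1 G = 1%:M].

Lemma middle_normalized : exists G, middle_spec G.
Proof.
have [G [lG strG]] := middle_gen.
have [sG|] := posnP (slen G).
  by exists G; split=> //; rewrite sG.
case sG: (slen G) => [|s] // _.
have [G0 Gi] := slenP lG; rewrite sG in G0 Gi.
have f0 := Gi _ (ltnSn s); have Xf : X1 *m Xpow s G = 0 by [].
have lf := wt_Xpow s lG.
have jf := socle_weight lf Xf f0.
have scaled c : c != 0 -> (0 < nm -> rA r u *m (c *: Xpow s G) = Xpow nm.-1 (ra r u))%N ->
    (nm = 0%N -> rb r u *m (c *: Xpow s G) = 1%:M) -> exists G, middle_spec G.
  move=> c0 cA cb; exists (c *: G); rewrite /middle_spec (slenZ lG c0); split.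
  - exact: (submodZ (wt_submod _ _)).
  - by move=> j v /strG; exact: in_stringZ.
  - by move=> _; rewrite sG /= XpowZ.
  - by move=> _; rewrite sG /= XpowZ.
have [Af|Af] := eqVneq (rA r u *m Xpow s G) 0.
  have [bf n0 _] := socle_A_eq0 lf Xf Af f0.
  pose beta := (rb r u *m Xpow s G) 0 0.
  have beta0 : beta != 0.
    by apply: contraNneq bf => e; rewrite [_ *m _]mx11_scalar -/beta e -scalemx1 scale0r.
  apply: (scaled beta^-1); rewrite ?invr_eq0 ?n0 // => _.
  by rewrite -scalemxAr [rb r u *m _]mx11_scalar -/beta scale_scalar_mx mulVf.
have [/eqP|[i [c [jE c0 ilt Ae]]]] := A_string lf; first by rewrite (negbTE Af).
apply: (scaled c^-1); rewrite ?invr_eq0 // => n0; last by rewrite n0 in ilt.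
by rewrite -scalemxAr Ae scalerA mulVf // scale1r; congr Xpow; lia.
Qed.
End OneString.

Definition middle u : 'cV[F]_(w u.+1) :=
  xget 0 [set G | middle_spec G]%classic.

Lemma middleP u : is_D5 u -> middle_spec (middle u).
Proof.
by move=> Uu; have [G GP] := middle_normalized Uu; exact: (xgetPex 0 (ex_intro _ G GP)).
Qed.

Definition A_preimage k l (y : 'cV[F]_(w k)) : 'cV[F]_(w k.+1) :=
  xget 0 [set x | wt l x /\ rA r k *m x = y]%classic.

Lemma A_preimageP k l (y : 'cV_(w k)) :
  (exists2 x, wt l x & rA r k *m x = y) ->
  wt l (A_preimage l y) /\ rA r k *m A_preimage l y = y.
Proof.
case=> x lx xE; rewrite /A_preimage; case: xgetP => [z -> []|/(_ x)[]] //.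
Qed.

Fixpoint gen u k : 'cV[F]_(w k) :=
  match k with
  | 0 => left_gen u 0
  | k'.+1 =>
    if (k' < u)%N then left_gen u k'.+1
    else if k' == u then middle k'
    else if d5 k' then
      A_preimage (u, (slen (middle u))%:Z - (slen (ra r u))%:Z) (gen u k')
    else rD r k' *m gen u k'
  end.

(** Constant to the right of u, where generators are transported by D and by preimages under A, both
    preserving weights. *)
Definition deg u k : int := if (k <= u)%N then left_deg u k
  else (slen (middle u))%:Z - (slen (ra r u))%:Z.

Lemma deg_right u k : (u < k)%N -> deg u k = deg u u.+1.
Proof. by move=> uk; rewrite /deg ltnn (leqNgt k) uk. Qed.

Lemma gen_left u k : (k <= u)%N -> gen u k = left_gen u k.
Proof. by case: k => // k ku; rewrite /= ku. Qed.

Lemma gen_mid u : gen u u.+1 = middle u.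
Proof. by rewrite /= ltnn eqxx. Qed.

Lemma is_D5_neq_NS5 u k : is_D5 u -> is_NS5 k -> k != u.
Proof. by move=> /D5_true du /NS5_false; apply: contraFneq => ->. Qed.

Section Generators.
Variable u : nat.
Hypothesis Uu : is_D5 u.

Lemma gen_spec k : wt (u, deg u k) (gen u k) /\
  forall j v, wt (u, j) v -> in_string (gen u k) (deg u k) j v.
Proof.
have [ku|] := leqP k u.
  rewrite gen_left // /deg ku; split; first exact: wt_left_gen.
  by move=> j v; exact: left_string.
elim: k => // k IHk; rewrite ltnS leq_eqVlt => /orP[/eqP e|uk].
  subst k; rewrite gen_mid /deg ltnNge leqnn /=.
  by have [] := middleP Uu.
have [lG strG] := IHk uk.
have degS : deg u k.+1 = deg u k by rewrite (deg_right uk) deg_right // ltnS ltnW.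
rewrite degS /= ltnNge (ltnW uk) /= (gtn_eqF uk).
have [Nk|kN] := leqP N k.
  have e := wN (leqW Nk).
  by split=> [|j v _]; [exact: cV0_eq | left; exact: cV0_eq].
have := D5_or_NS5 kN; case: (d5 k) => hk; last first.
  split; first exact: wtD.
  move=> j v /(D_surj Uu uk hk)[x lx ->].
  have [->|[i [c [jE ->]]]] := strG _ _ lx; first by left; rewrite mulmx0.
  by right; exists i, c; rewrite Xpow_D // scalemxAr.
have ku : k != u by rewrite gtn_eqF.
have -> : (slen (middle u))%:Z - (slen (ra r u))%:Z = deg u u.+1.
  by rewrite /deg ltnn.
have degk : deg u u.+1 = deg u k by rewrite -(deg_right uk).
rewrite degk.
have [lA AE] := A_preimageP (A_surj hk Uu ku lG).
split=> // j v lv.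
have [Av|[i [c [jE Av]]]] := strG _ _ (wtA hk lv).
  by left; exact: (A_inj hk Uu ku lv).
right; exists i, c; split=> //; apply/eqP; rewrite -subr_eq0; apply/eqP.
apply: (A_inj hk Uu ku (j := j)).
  apply: (submodB (wt_submod _ _)) => //; apply: (submodZ (wt_submod _ _)).
  by rewrite jE; exact: wt_Xpow.
by rewrite mulmxBr -scalemxAr -(Xpow_A i hk Uu ku lA) AE Av subrr.
Qed.

Lemma gen_wt k : wt (u, deg u k) (gen u k). Proof. by have [] := gen_spec k. Qed.
Lemma gen_string k j v : wt (u, j) v -> in_string (gen u k) (deg u k) j v.
Proof. by have [_] := gen_spec k; apply. Qed.

Lemma gen_A k : is_D5 k -> k != u -> rA r k *m gen u k.+1 = gen u k.
Proof.
move=> Uk ku; have [klt|ukl] := ltnP k u.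
  by rewrite !gen_left ?(ltnW klt) // (left_genE klt) D5_true.
have uk : (u < k)%N by rewrite ltn_neqAle eq_sym ku.
rewrite /= ltnNge ukl /= (negbTE ku) D5_true //.
have lG := gen_wt k; rewrite /deg leqNgt uk in lG.
by have [] := A_preimageP (A_surj Uk Uu ku lG).
Qed.

Lemma gen_C k : is_NS5 k -> (k < u)%N -> rC r k *m gen u k.+1 = - gen u k.
Proof. by move=> Vk ku; rewrite !gen_left ?(ltnW ku) // (left_genE ku) NS5_false // opprK. Qed.

Lemma gen_D k : is_NS5 k -> (u < k)%N -> rD r k *m gen u k = gen u k.+1.
Proof. by move=> Vk uk /=; rewrite ltnNge (ltnW uk) /= (gtn_eqF uk) NS5_false. Qed.

Definition len k := slen (gen u k).

Lemma Xpow_gen0 k i : (Xpow i (gen u k) == 0) = (len k <= i)%N.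
Proof. exact: slen_le (gen_wt k). Qed.

Lemma len_D5 k : is_D5 k -> k != u -> len k = len k.+1.
Proof.
move=> Uk ku.
suff eqX i : (len k <= i)%N = (len k.+1 <= i)%N.
  by apply/eqP; rewrite eqn_leq eqX leqnn -eqX leqnn.
rewrite -!Xpow_gen0 -(gen_A Uk ku) (Xpow_A i Uk Uu ku (gen_wt _)).
apply/eqP/eqP => [|->]; last by rewrite mulmx0.
exact: (A_inj Uk Uu ku (wt_Xpow i (gen_wt _))).
Qed.

Lemma CD_X k (v : 'cV_(w k)) : is_NS5 k -> rC r k *m (rD r k *m v) = - (rX r k *m v).
Proof. by move=> Vk; rewrite (rp_CD rpt Vk) mulNmx opprK mulmxA. Qed.
Lemma DC_X k (v : 'cV_(w k.+1)) : is_NS5 k ->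
  rD r k *m (rC r k *m v) = - (rX r k.+1 *m v).
Proof. by move=> Vk; rewrite (rp_DC rpt Vk) mulNmx opprK mulmxA. Qed.

Lemma XpowN k i (v : 'cV_(w k)) : Xpow i (- v) = - Xpow i v.
Proof. by rewrite -scaleN1r XpowZ scaleN1r. Qed.

Lemma gen_D_left k : is_NS5 k -> (k < u)%N -> rD r k *m gen u k = rX r k.+1 *m gen u k.+1.
Proof.
move=> Vk ku; rewrite -[gen u k]opprK -gen_C // mulmxN DC_X // opprK //.
Qed.

Lemma gen_C_right k : is_NS5 k -> (u < k)%N ->
  rC r k *m gen u k.+1 = - (rX r k *m gen u k).
Proof. by move=> Vk uk; rewrite -gen_D // CD_X. Qed.

(** C takes X^i of the generator at k.+1 to X^i of that at k, up to sign, while D takes X^i of the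
    latter to X^(i+1) of the former. *)
Lemma len_left k : is_NS5 k -> (k < u)%N -> (len k <= len k.+1 <= (len k).+1)%N.
Proof.
move=> Vk ku; rewrite -!Xpow_gen0; apply/andP; split.
  have /eqP : Xpow (len k.+1) (gen u k.+1) == 0 by rewrite Xpow_gen0.
  rewrite -[gen u k]opprK -gen_C // XpowN Xpow_C // => ->.
  by rewrite mulmx0 oppr0.
have /eqP : Xpow (len k) (gen u k) == 0 by rewrite Xpow_gen0.
by rewrite XpowS -gen_D_left // Xpow_D // => ->; rewrite mulmx0.
Qed.

Lemma len_right k : is_NS5 k -> (u < k)%N -> (len k.+1 <= len k <= (len k.+1).+1)%N.
Proof.
move=> Vk uk; rewrite -!Xpow_gen0; apply/andP; split.
  have /eqP : Xpow (len k) (gen u k) == 0 by rewrite Xpow_gen0.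
  by rewrite -gen_D // Xpow_D // => ->; rewrite mulmx0.
have /eqP : Xpow (len k.+1) (gen u k.+1) == 0 by rewrite Xpow_gen0.
rewrite XpowS -[rX r k *m _]opprK -gen_C_right // XpowN Xpow_C // => ->.
by rewrite mulmx0 oppr0.
Qed.

Lemma len_dim0 k : w k = 0%N -> len k = 0%N.
Proof.
move=> wk; apply/eqP; rewrite (slen0 Uu (gen_wt k)); apply/eqP; exact: cV0_eq.
Qed.
End Generators.

Lemma len_profile : profile len.
Proof.
split.
- by move=> u Uu; exact: len_dim0.
- by move=> u k Uu Nk; apply: len_dim0 => //; exact: wN.
- by move=> u k Uu Uk ku; exact: len_D5.
- by move=> u k Uu Vk ku; exact: len_left.
- by move=> u k Uu Vk uk; exact: len_right.
Qed.

(** Indexing from the end killed by X aligns the bases on the two sides of u, and turns X into the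
    index shift [below]. *)
Definition bas k u i : 'cV[F]_(w k) := Xpow (len u k - i.+1) (gen u k).
Definition bas_label k u i : label := (u, deg u k - (len u k - i.+1)%N%:Z).

Lemma bas_wt k u i : is_D5 u -> wt (bas_label k u i) (bas k u i).
Proof. by move=> Uu; apply: wt_Xpow; exact: gen_wt. Qed.

Lemma bas_neq0 k u i : is_D5 u -> (i < len u k)%N -> bas k u i != 0.
Proof. by move=> Uu ilt; rewrite Xpow_gen0 // -ltnNge; lia. Qed.

Lemma below_Xpow k u i : is_D5 u -> (i <= len u k)%N ->
  below (bas k u) i = Xpow (len u k - i) (gen u k).
Proof.
move=> Uu; case: i => [_|i _] //=; symmetry; apply/eqP.
by rewrite subn0 Xpow_gen0.
Qed.

Lemma bas_X k u i : is_D5 u -> (i < len u k)%N ->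
  rX r k *m bas k u i = below (bas k u) i.
Proof.
move=> Uu ilt; rewrite below_Xpow // 1?ltnW // /bas.
by rewrite -[LHS]/(Xpow _.+1 _) subnSK.
Qed.

Lemma bas_a k : is_D5 k -> ra r k = below (bas k k) (len k k).
Proof. by move=> Uk; rewrite below_Xpow // subnn /= gen_left // left_gen_id. Qed.

Lemma bas_A_other k u i : is_D5 k -> is_D5 u -> k != u -> 
  rA r k *m bas k.+1 u i = bas k u i.
Proof.
move=> Uk Uu ku; rewrite /bas -(Xpow_A _ Uk Uu ku (gen_wt Uu _)) gen_A //.
by rewrite (len_D5 Uu Uk ku).
Qed.

Lemma len_mid u : len u u.+1 = slen (middle u).
Proof. by rewrite /len gen_mid. Qed.
Lemma len_a u : len u u = slen (ra r u).
Proof. by rewrite /len gen_left // left_gen_id. Qed.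

Lemma bas_mid_wt u i : is_D5 u -> (i < len u u.+1)%N ->
  wt (u, 1 - (len u u)%:Z + i%:Z) (bas u.+1 u i).
Proof.
move=> Uu ilt; have := bas_wt u.+1 i Uu; rewrite /bas_label.
rewrite [deg _ _]/deg ltnn -len_mid -len_a.
suff -> : (len u u.+1)%:Z - (len u u)%:Z - (len u u.+1 - i.+1)%N%:Z
  = 1 - (len u u)%:Z + i%:Z by [].
lia.
Qed.

(** Degrees show that the image is zero or a multiple of the vector with the same index. Applying
    X^i reduces to i = 0, where the normalization of [middle] gives the factor 1. *)
Lemma bas_A_self u i : is_D5 u -> (i < len u u.+1)%N ->
  rA r u *m bas u.+1 u i = if (i < len u u)%N then bas u u i else 0.
Proof.
move=> Uu ilt; have lb := bas_mid_wt Uu ilt.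
have [iu|ui] := ltnP; last first.
  have [//|[m [c [jE _ _ _]]]] := A_string Uu lb; lia.
(* For i below the left length all degrees involved are at most 0, hence differ from 1 and b
   vanishes on them. *)
have XA m : (m <= i)%N -> Xpow m (rA r u *m bas u.+1 u i) = rA r u *m Xpow m (bas u.+1 u i).
  elim: m => // m IHm mi; rewrite -[LHS]/(rX r u *m Xpow m _) IHm ?(ltnW mi) //.
  rewrite XA_comm //; apply: (wtb Uu _ _ (wt_Xpow m lb)) => //.
  by apply/eqP => -[]; lia.
have Xi : Xpow i (bas u.+1 u i) = bas u.+1 u 0.
  by rewrite /bas -XpowD; congr Xpow; lia.
have [_ _ + _] := middleP Uu; rewrite -len_mid -len_a => mA.
have {mA}A0 : rA r u *m bas u.+1 u 0 = bas u u 0.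
  rewrite /bas !subn1 gen_mid mA //; [|lia|lia].
  by rewrite gen_left // left_gen_id.
have [Az|[m [c [jE c0 mlt Ae]]]] := A_string Uu lb.
  have := XA i (leqnn i); rewrite Az Xpow0 Xi A0 => /esym/eqP.
  by rewrite (negbTE (bas_neq0 Uu _)) //; lia.
have eX : Xpow m (ra r u) = bas u u i.
  by rewrite /bas gen_left // left_gen_id; congr Xpow; lia.
have := XA i (leqnn i); rewrite Ae eX XpowZ Xi A0.
have -> : Xpow i (bas u u i) = bas u u 0.
  by rewrite /bas -XpowD; congr Xpow; lia.
move/eqP; rewrite -subr_eq0 -[X in _ - X]scale1r -scalerBl scaler_eq0.
rewrite (negbTE (bas_neq0 Uu _)) ?orbF; last by lia.
by rewrite subr_eq0 => /eqP ->; rewrite scale1r.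
Qed.

(** Only i = [len u u] has degree 1. There A v = 0 and A X v = a, so the moment equation reads a b v
    = a; for an empty left string the value is the normalization. *)
Lemma bas_b_self u i : is_D5 u -> (i < len u u.+1)%N ->
  rb r u *m bas u.+1 u i = (i == len u u)%:R%:M.
Proof.
move=> Uu ilt; have lb := bas_mid_wt Uu ilt.
have [iE|ni] := eqVneq; last first.
  rewrite (wtb Uu _ _ lb) ?raddf0 //; apply/eqP => -[e].
  by case/eqP: ni; move: e; lia.
case lu : (len u u) => [|m].
  have [_ _ _] := middleP Uu; rewrite -len_mid -len_a => /(_ _ lu) <-; last by lia.
  by rewrite /bas iE lu gen_mid subn1.
have := rp_moment rpt Uu => /(congr1 (mulmx^~ (bas u.+1 u i))).
rewrite mul0mx mulmxDl mulmxBl -!mulmxA bas_A_self // iE ltnn mulmx0 sub0r.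
have mlt : (m < len u u.+1)%N by lia.
rewrite bas_X // -?iE // iE lu /= bas_A_self // lu ltnSn.
rewrite [ra r u](bas_a Uu) lu /= => /eqP.
rewrite addrC subr_eq0 [rb r u *m _]mx11_scalar mul_mx_scalar.
rewrite -subr_eq0 -[X in _ - X]scale1r -scalerBl scaler_eq0.
rewrite (negbTE (bas_neq0 Uu _)) ?orbF; last by lia.
by rewrite subr_eq0 => /eqP ->.
Qed.

Lemma shifts_left n u k : (k < u)%N -> shifts n u k = (n u k == n u k.+1).
Proof. by rewrite /shifts /tie_at => ku; rewrite ltnNge (ltnW ku); case: (_ == _ :> nat). Qed.
Lemma shifts_right n u k : (u < k)%N -> shifts n u k = (n u k != n u k.+1).
Proof. by rewrite /shifts /tie_at => ->; case: (_ == _ :> nat). Qed.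

Lemma bas_D k u i : is_NS5 k -> is_D5 u -> (i < len u k)%N ->
  rD r k *m bas k u i = (if shifts len u k then below (bas k.+1 u) else bas k.+1 u) i.
Proof.
move=> Vk Uu ilt; rewrite /bas -Xpow_D //.
case: (ltngtP k u) => [ku|uk|e]; last by have := is_D5_neq_NS5 Uu Vk; rewrite e eqxx.
- have /andP[l1 l2] := len_left Uu Vk ku.
  rewrite shifts_left // gen_D_left // -XpowS; case: ifP => /eqP e.
    by rewrite below_Xpow //; [congr Xpow; lia | lia].
  by congr Xpow; lia.
- have /andP[l1 l2] := len_right Uu Vk uk.
  rewrite shifts_right // gen_D //; case: ifP => /eqP e; last by rewrite e.
  by rewrite below_Xpow //; [congr Xpow; lia | lia].
Qed.

Lemma bas_C k u i : is_NS5 k -> is_D5 u -> (i < len u k.+1)%N ->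
  rC r k *m bas k.+1 u i = - (if shifts len u k then bas k u else below (bas k u)) i.
Proof.
move=> Vk Uu ilt; rewrite /bas -Xpow_C //.
case: (ltngtP k u) => [ku|uk|e]; last by have := is_D5_neq_NS5 Uu Vk; rewrite e eqxx.
- have /andP[l1 l2] := len_left Uu Vk ku.
  rewrite shifts_left // gen_C // XpowN; case: ifP => /eqP e.
    by rewrite e.
  by rewrite below_Xpow //; [congr (- Xpow _ _); lia | lia].
- have /andP[l1 l2] := len_right Uu Vk uk.
  rewrite shifts_right // gen_C_right // XpowN -XpowS; case: ifP => /eqP e.
    by congr (- Xpow _ _); lia.
  by rewrite below_Xpow //; [congr (- Xpow _ _); lia | lia].
Qed.

Lemma proj_bas k u i x : is_D5 u -> (i < len u k)%N ->
  exists c, proj k (bas_label k u i) *m x = c *: bas k u i.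
Proof.
move=> Uu ilt.
have [->|[m [c [jE ->]]]] := gen_string Uu (wt_proj (bas_label k u i) x).
  by exists 0; rewrite scale0r.
by exists c; rewrite /bas; congr (_ *: Xpow _ _); lia.
Qed.

(** The projection to a line is a column times a row; this row is the dual basis covector. *)
Lemma proj_rank1 k u i : exists ep : 'rV[F]_(w k), is_D5 u -> (i < len u k)%N ->
  proj k (bas_label k u i) = bas k u i *m ep.
Proof.
have [[Uu ilt]|nh] := pselect (is_D5 u /\ (i < len u k)%N); last first.
  by exists 0 => Uu ilt; case: nh.
have /choice[c cE] x := proj_bas x Uu ilt.
exists (\row_j c (delta_mx j 0)) => _ _; apply/matrixP => a b.
have /matrixP/(_ a 0) := cE (delta_mx b 0); rewrite -colE !mxE => ->.
by rewrite big_ord1 !mxE mulrC.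
Qed.

Definition cobas k u i : 'rV[F]_(w k) := sval (cid (proj_rank1 k u i)).

Lemma cobasE k u i : is_D5 u -> (i < len u k)%N ->
  proj k (bas_label k u i) = bas k u i *m cobas k u i.
Proof. by rewrite /cobas; case: cid. Qed.

Lemma D5_ordE (u : 'I_N) : d5 u = is_D5 u.
Proof. by rewrite /is_D5 ltn_ord. Qed.

Theorem fixed_frame : frame r len bas cobas.
Proof.
split.
- move=> k u i u' i' Uu Uu' iu iu'.
  have e : bas k u i *m (cobas k u i *m bas k u' i')
     = ((u == u') && (i == i'))%:R *: bas k u i.
    rewrite mulmxA -cobasE //.
    have [/andP[/eqP eu /eqP ei]|ne] := boolP ((u == u') && (i == i')).
      by subst u' i'; rewrite scale1r proj_id //; exact: bas_wt.
    rewrite scale0r; apply: (proj_neq _ _ (bas_wt k i' Uu')) => //.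
    apply: contra ne => /eqP[eu e]; subst u'; rewrite eqxx /=; apply/eqP; lia.
  move: e; rewrite [X in _ *m X]mx11_scalar mul_mx_scalar => /eqP.
  rewrite -subr_eq0 -scalerBl scaler_eq0 (negbTE (bas_neq0 Uu iu)) orbF subr_eq0.
  by move=> /eqP e; rewrite [LHS]mx11_scalar e.
- move=> k; apply: eq_on_weights => -[u0 j] v Uu0 lv; rewrite mul1mx mulmx_suml.
  have [->|v0] := eqVneq v 0.
    by rewrite big1 // => u _; rewrite mulmx0.
  have Uu0' : is_D5 u0 := Uu0.
  have [/eqP|[m [c [jE vE]]]] := gen_string Uu0' lv; first by rewrite (negbTE v0).
  have mlt : (m < len u0 k)%N.
    rewrite ltnNge -(Xpow_gen0 Uu0'); apply: contraNN v0 => /eqP e.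
    by rewrite vE e scaler0.
  pose U0 : 'I_N := Ordinal (D5_lt Uu0').
  have ilt : (len u0 k - m.+1 < len u0 k)%N by lia.
  rewrite (bigD1 U0) /=; last exact: D5_true.
  rewrite [X in _ + X]big1 ?addr0 => [|u /andP[du uU0]]; last first.
    rewrite mulmx_suml big1 // => i _; rewrite -cobasE // -?D5_ordE //.
    apply: (proj_neq _ _ lv) => //; apply: contraNneq uU0 => -[eu _].
    by apply/eqP/val_inj.
  rewrite mulmx_suml (bigD1 (Ordinal ilt)) //= [X in _ + X]big1 ?addr0 => [|i ni].
    rewrite -cobasE // proj_id //.
    suff -> : bas_label k u0 (len u0 k - m.+1) = (u0, j) by [].
    by rewrite /bas_label jE; congr pair; lia.
  rewrite -cobasE //; apply: (proj_neq _ _ lv) => //.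
  apply: contraNneq ni => -[e]; apply/eqP/val_inj => /=.
  by have := ltn_ord i; lia.
- by move=> k u i; exact: bas_X.
- exact: bas_a.
- move=> k u i Uk Uu ilt; have [e|ku] := eqVneq k u.
    by subst u; exact: bas_A_self.
  by rewrite bas_A_other // (len_D5 Uu Uk ku) ilt.
- move=> k u i Uk Uu ilt; have [e|uk] := eqVneq u k.
    by subst u; rewrite bas_b_self.
  have ku : k != u by rewrite eq_sym.
  by rewrite (b_other Uk Uu ku (bas_wt k.+1 i Uu)) raddf0.
- by move=> k u i; exact: bas_D.
- by move=> k u i; exact: bas_C.
Qed.
End FixedRepresentation.
End Representations.

(** * Normal forms *)

Section Frames.
Variables (F : fieldType) (w : nat -> nat) (N : nat) (d5 : pred nat).
Local Notation is_D5 := (is_D5 N d5).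
Local Notation is_NS5 := (is_NS5 N d5).
Variable n : nat -> nat -> nat.
Hypothesis pn : profile N d5 n.

(** In terms of [shifts] the bounds no longer depend on the side of u, so later arguments treat both
    sides at once. *)
Lemma shifts_bounds u k : is_D5 u -> is_NS5 k ->
  if shifts n u k then (n u k.+1 <= n u k <= (n u k.+1).+1)%N
  else (n u k <= n u k.+1 <= (n u k).+1)%N.
Proof.
move=> Uu Vk; case: (ltngtP k u) => [ku|uk|e].
- have := pf_left pn Uu Vk ku; rewrite shifts_left //.
  by case: eqP => // ->; rewrite leqnn leqnSn.
- have := pf_right pn Uu Vk uk; rewrite shifts_right //.
  by case: eqP => //= ->; rewrite leqnn leqnSn.
- by have := is_D5_neq_NS5 Uu Vk; rewrite e eqxx.
Qed.

Section OneFrame.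
Variable r : rep F w.
Variables (e : forall k, nat -> nat -> 'cV[F]_(w k))
  (ep : forall k, nat -> nat -> 'rV[F]_(w k)).
Hypothesis fr : frame N d5 r n e ep.

Lemma D5_ord (u : 'I_N) : d5 u -> is_D5 u.
Proof. by rewrite /is_D5 ltn_ord. Qed.

Lemma frame_span k (S : 'cV[F]_(w k) -> Prop) : submod S ->
  (forall u i, is_D5 u -> (i < n u k)%N -> S (e k u i)) -> forall v, S v.
Proof.
move=> subS Se v; rewrite -[v]mul1mx -(fr_total fr k) mulmx_suml.
apply: (submod_sum subS) => u /D5_ord Uu; rewrite mulmx_suml.
apply: (submod_sum subS) => i _.
rewrite -mulmxA [_ *m v]mx11_scalar mul_mx_scalar.
by apply: (submodZ subS); exact: Se.
Qed.

Lemma frame_ext k m (M M' : 'M[F]_(m, w k)) :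
  (forall u i, is_D5 u -> (i < n u k)%N -> M *m e k u i = M' *m e k u i) -> M = M'.
Proof.
move=> MM; apply: eq_mulmx_cV.
apply: frame_span => //; split=> [|c x y Mx My]; first by rewrite !mulmx0.
by rewrite !mulmxDr -!scalemxAr Mx My.
Qed.

Lemma frame_XA k u i : is_D5 k -> is_D5 u -> (i < n u k.+1)%N ->
  rX r k *m (rA r k *m e k.+1 u i) =
  if (i < n u k)%N then below (e k u) i else 0.
Proof.
move=> Uk Uu ilt; rewrite (fr_A fr) //; case: ifP => iu; first exact: (fr_X fr).
by rewrite mulmx0.
Qed.

Lemma frame_AX k u i : is_D5 k -> is_D5 u -> (i < n u k.+1)%N ->
  rA r k *m (rX r k.+1 *m e k.+1 u i) =
  if (i <= n u k)%N then below (e k u) i else 0.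
Proof.
move=> Uk Uu ilt; rewrite (fr_X fr) //; case: i ilt => [|i] ilt /=.
  by rewrite mulmx0.
by rewrite (fr_A fr) // ltnW.
Qed.

(** X A and A X differ only for u = k and i = n k k, where A X e = a and A e = 0; there b takes the
    value 1. *)
Lemma frame_moment k : is_D5 k ->
  rX r k *m rA r k - rA r k *m rX r k.+1 + ra r k *m rb r k = 0.
Proof.
move=> Uk; apply: frame_ext => u i Uu ilt; rewrite mul0mx mulmxDl mulmxBl.
rewrite -!mulmxA frame_XA // frame_AX // (fr_b fr) // mul_mx_scalar (fr_a fr) //.
have [e1|uk] /= := eqVneq u k.
  subst u; case: (ltngtP i (n k k)) => [_|_|->]; rewrite ?subrr ?scale0r ?addr0 //.
  by rewrite scale1r sub0r addNr.
have e1 : n u k = n u k.+1 by apply: (pf_D5 pn) => //; rewrite eq_sym.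
by rewrite e1 ilt (ltnW ilt) subrr scale0r addr0.
Qed.

Lemma frame_CD k : is_NS5 k -> rX r k = - (rC r k *m rD r k).
Proof.
move=> Vk; apply: frame_ext => u i Uu ilt; rewrite mulNmx -mulmxA.
rewrite (fr_D fr) // (fr_X fr) //; have := shifts_bounds Uu Vk.
case: ifP => sh /andP[l1 l2].
  case: i ilt => [|i] ilt /=; first by rewrite mulmx0 oppr0.
  by rewrite (fr_C fr) // ?sh ?opprK //; lia.
by rewrite (fr_C fr) // ?sh ?opprK //; lia.
Qed.

Lemma frame_DC k : is_NS5 k -> rX r k.+1 = - (rD r k *m rC r k).
Proof.
move=> Vk; apply: frame_ext => u i Uu ilt; rewrite mulNmx -mulmxA.
rewrite (fr_C fr) // (fr_X fr) // mulmxN opprK; have := shifts_bounds Uu Vk.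
case: ifP => sh /andP[l1 l2].
  by rewrite (fr_D fr) // ?sh //; lia.
case: i ilt => [|i] ilt /=; first by rewrite mulmx0.
by rewrite (fr_D fr) // ?sh //; lia.
Qed.

Lemma frame_vanish k (v : 'cV_(w k)) :
  (forall u i, is_D5 u -> (i < n u k)%N -> ep k u i *m v = 0) -> v = 0.
Proof.
move=> epv; rewrite -[v]mul1mx -(fr_total fr k) mulmx_suml big1 // => u /D5_ord Uu.
by rewrite mulmx_suml big1 // => i _; rewrite -mulmxA epv // mulmx0.
Qed.

(** Each coordinate factors through the data: those with i < n u k through A, the others, which
    occur only for u = k, through b X^j with i = n k k + j. *)
Lemma frame_S1 k : is_D5 k -> forall S : 'cV[F]_(w k.+1) -> Prop, submod S ->
  (forall v, S v -> S (rX r k.+1 *m v)) -> (forall v, S v -> rA r k *m v = 0) ->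
  (forall v, S v -> rb r k *m v = 0) -> forall v, S v -> v = 0.
Proof.
move=> Uk S subS SX SA Sb v Sv; apply: frame_vanish => u i Uu ilt.
have [iu|] := boolP ((i < n u k)%N).
  suff <- : ep k u i *m rA r k = ep k.+1 u i by rewrite -mulmxA SA // mulmx0.
  apply: frame_ext => u' i' Uu' ilt'; rewrite -mulmxA (fr_A fr) //.
  rewrite (fr_dual fr) //; case: ifP => iu'; first by rewrite (fr_dual fr).
  rewrite mulmx0; suff -> : (u == u') && (i == i') = false by rewrite raddf0.
  by apply/negP => /andP[/eqP eu /eqP ei]; subst u' i'; rewrite iu in iu'.
rewrite -leqNgt => ui.
have uk : u = k.
  apply/eqP; apply: contraLR ui => uk; rewrite -ltnNge.
  by rewrite (pf_D5 pn Uu Uk) // eq_sym.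
subst u; rewrite -(subnKC ui) in ilt *; move: (i - _)%N ilt => {ui}j.
elim: j v Sv => [|j IHj] v Sv ilt.
  rewrite addn0 in ilt *; suff <- : rb r k = ep k.+1 k (n k k) by exact: Sb.
  apply: frame_ext => u' i' Uu' ilt'; rewrite (fr_b fr) // (fr_dual fr) //.
  by rewrite (eq_sym u') (eq_sym i'); case: eqP => // <-.
have <- : ep k.+1 k (n k k + j)%N *m rX r k.+1 = ep k.+1 k (n k k + j.+1)%N.
  apply: frame_ext => u' i' Uu' ilt'; rewrite -mulmxA (fr_X fr) //.
  rewrite (fr_dual fr) // addnS; case: i' ilt' => [|i'] ilt' /=.
    by rewrite andbF mulmx0 raddf0.
  by rewrite (fr_dual fr) ?eqSS //; lia.
by rewrite -mulmxA; apply: IHj; [exact: SX | lia].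
Qed.

Lemma frame_a_string k (T : 'cV[F]_(w k) -> Prop) : is_D5 k -> T (ra r k) ->
  (forall v, T v -> T (rX r k *m v)) -> forall i, (i < n k k)%N -> T (e k k i).
Proof.
move=> Uk Ta TX i ilt; rewrite -(subKn (ltnW ilt)).
have : (0 < n k k - i)%N by rewrite subn_gt0.
have : (n k k - i <= n k k)%N by exact: leq_subr.
move: (n k k - i)%N => {ilt}j; elim: j => // -[|j] IHj jn _.
  have := fr_a fr Uk; case nE : (n k k) jn => [|m] // _ /= aE.
  by rewrite subn1 /= -aE.
have := TX _ (IHj (ltnW jn) isT); rewrite (fr_X fr) //; last by lia.
by rewrite -(subnSK jn).
Qed.

Lemma frame_S2 k : is_D5 k -> forall T : 'cV[F]_(w k) -> Prop, submod T ->
  (forall v, T v -> T (rX r k *m v)) -> (forall v, T (rA r k *m v)) ->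
  T (ra r k) -> forall v, T v.
Proof.
move=> Uk T subT TX TA Ta; apply: frame_span => // u i Uu ilt.
have [uk|uk] := eqVneq u k; first by subst u; exact: frame_a_string.
have en : n u k = n u k.+1 by apply: (pf_D5 pn) => //; rewrite eq_sym.
suff <- : rA r k *m e k.+1 u i = e k u i by [].
by rewrite (fr_A fr) // -?en // ilt.
Qed.

Lemma frame_point : rep_point N d5 r.
Proof.
split; [exact: frame_moment | exact: frame_CD | exact: frame_DC |
  exact: frame_S1 | exact: frame_S2].
Qed.

(** All basis vectors of u are reached from a_u: by X at u, by A and C to the left, by preimages
    under A and by D to the right. *)
Lemma frame_generated : rep_generated N d5 r.
Proof.
move=> S [subS Sa SA SAi SX SC SD] k.
apply: frame_span => // u i Uu.
have left_ m : (m <= u)%N -> forall i, (i < n u (u - m))%N -> S _ (e (u - m) u i).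
  elim: m => [_ {}i|m IHm mu {}i].
    rewrite subn0 => ilt; apply: (@frame_a_string u (S u)) => //; first exact: Sa.
    exact: SX.
  have {IHm} := IHm (ltnW mu).
  have -> : (u - m = (u - m.+1).+1)%N by lia.
  have : (u - m.+1 < u)%N by lia.
  move: (u - m.+1)%N => {mu m}m mu IH ilt.
  have := D5_or_NS5 d5 (ltn_trans mu (D5_lt Uu)); case: (d5 m) => hm.
    have mneq : m != u by rewrite ltn_eqF.
    have en := pf_D5 pn Uu hm mneq.
    have -> : e m u i = rA r m *m e m.+1 u i by rewrite (fr_A fr) -?en // ilt.
    by apply: SA => //; apply: IH; rewrite -en.
  have := shifts_bounds Uu hm; have := fr_C fr hm Uu; case: ifP => sh frC.
    move/andP=> [l1 l2]; have := pf_left pn Uu hm mu; move=> /andP[l3 l4].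
    have ilt' : (i < n u m.+1)%N by lia.
    rewrite -[e m u i]opprK -frC //; apply: (submodN (subS _)).
    by apply: SC => //; exact: IH.
  move/andP=> [l1 l2].
  have tie : n u m.+1 = (n u m).+1.
    by move/negbT: sh; rewrite shifts_left // => /eqP; lia.
  (* At a tie C lowers the index, but the string at m.+1 is longer by one, so the index i.+1 is
     available. *)
  have ilt' : (i.+1 < n u m.+1)%N by lia.
  have := frC i.+1 ilt'; rewrite /= => eqC; rewrite -[e m u i]opprK -eqC.
  by apply: (submodN (subS _)); apply: SC => //; exact: IH.
have [ku|uk] := leqP k u.
  by move=> ilt; have := left_ (u - k)%N (leq_subr _ _); rewrite subKn //; apply.
elim: k uk i => // k IHk; rewrite ltnS leq_eqVlt => /orP[/eqP uk|uk] i ilt.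
  (* Basis vectors beyond the left string are sent to zero by A, so they enter as preimages of
     zero. *)
  subst k; apply: SAi => //; rewrite (fr_A fr) //; case: ifP => iu.
    by have := left_ 0%N isT; rewrite subn0; apply.
  exact: submod0 (subS _).
have [Nk|kN] := leqP N k; first by rewrite (pf_N pn) // leqW in ilt.
have := D5_or_NS5 d5 kN; case: (d5 k) => hk.
  have en : n u k = n u k.+1 by apply: (pf_D5 pn) => //; rewrite gtn_eqF.
  by apply: SAi => //; rewrite (fr_A fr) // en ilt; apply: IHk => //; rewrite en.
have := shifts_bounds Uu hk; have := fr_D fr hk Uu; case: ifP => sh frD /andP[l1 l2].
  have tie : n u k = (n u k.+1).+1.
    by move: sh; rewrite shifts_right // => /eqP; lia.
  have ilt' : (i.+1 < n u k)%N by lia.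
  by have := frD i.+1 ilt'; rewrite /= => <-; apply: SD => //; exact: IHk.
have en : n u k = n u k.+1.
  by move/negbT: sh; rewrite shifts_right // negbK => /eqP.
by rewrite -frD ?en //; apply: SD => //; apply: IHk; rewrite ?en.
Qed.
End OneFrame.
End Frames.

Record rep_hom (F : fieldType) (w : nat -> nat) (N : nat) (d5 : pred nat)
    (r r' : rep F w) (h : forall k, 'M[F]_(w k)) : Prop := RepHom {
  rh_A : forall k, is_D5 N d5 k -> h k *m rA r k = rA r' k *m h k.+1;
  rh_b : forall k, is_D5 N d5 k -> rb r' k *m h k.+1 = rb r k;
  rh_a : forall k, is_D5 N d5 k -> h k *m ra r k = ra r' k;
  rh_X : forall k, h k *m rX r k = rX r' k *m h k;
  rh_C : forall k, is_NS5 N d5 k -> h k *m rC r k = rC r' k *m h k.+1;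
  rh_D : forall k, is_NS5 N d5 k -> h k.+1 *m rD r k = rD r' k *m h k }.

Section Expansion.
Variables (F : fieldType) (w : nat -> nat) (N : nat) (d5 : pred nat).
Local Notation is_D5 := (is_D5 N d5).
Variables (n : nat -> nat -> nat) (e : forall k, nat -> nat -> 'cV[F]_(w k))
  (ep : forall k, nat -> nat -> 'rV[F]_(w k)).
Hypothesis dual : forall k u i u' i', is_D5 u -> is_D5 u' ->
  (i < n u k)%N -> (i' < n u' k)%N ->
  ep k u i *m e k u' i' = ((u == u') && (i == i'))%:R%:M.

Definition expand k m (f : nat -> nat -> 'cV[F]_m) : 'M[F]_(m, w k) :=
  \sum_(u < N | d5 u) \sum_(i < n u k) f u i *m ep k u i.

Lemma expandE k m (f : nat -> nat -> 'cV[F]_m) u i : is_D5 u -> (i < n u k)%N ->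
  expand k f *m e k u i = f u i.
Proof.
move=> Uu ilt; rewrite /expand mulmx_suml.
rewrite (bigD1 (Ordinal (D5_lt Uu))) ?(D5_true Uu) //= [X in _ + X]big1 ?addr0.
  rewrite mulmx_suml (bigD1 (Ordinal ilt)) //= [X in _ + X]big1 ?addr0.
    by rewrite -mulmxA dual // !eqxx mulmx1.
  move=> i' ni; rewrite -mulmxA dual // eqxx.
  by rewrite -(inj_eq val_inj) /= in ni; rewrite (negbTE ni) raddf0 mulmx0.
move=> u' /andP[du nu]; rewrite mulmx_suml big1 // => i' _.
rewrite -mulmxA dual //; last exact: D5_ord.
by rewrite -(inj_eq val_inj) /= in nu; rewrite (negbTE nu) raddf0 mulmx0.
Qed.
End Expansion.

Section FrameHom.
Variables (F : fieldType) (w : nat -> nat) (N : nat) (d5 : pred nat).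
Local Notation is_D5 := (is_D5 N d5).
Local Notation is_NS5 := (is_NS5 N d5).
Variable n : nat -> nat -> nat.
Hypothesis pn : profile N d5 n.
Variables (r r' : rep F w).
Variables (e e' : forall k, nat -> nat -> 'cV[F]_(w k))
  (ep ep' : forall k, nat -> nat -> 'rV[F]_(w k)).
Hypothesis fr : frame N d5 r n e ep.
Hypothesis fr' : frame N d5 r' n e' ep'.

Definition frame_map k : 'M[F]_(w k) := expand N d5 n ep k (e' k).

Lemma frame_mapE k u i : is_D5 u -> (i < n u k)%N -> frame_map k *m e k u i = e' k u i.
Proof. exact: (expandE (fr_dual fr)). Qed.

Lemma frame_map_below k u i : is_D5 u -> (i <= n u k)%N ->
  frame_map k *m below (e k u) i = below (e' k u) i.
Proof. by move=> Uu; case: i => [_|i ilt] /=; [rewrite mulmx0 | exact: frame_mapE]. Qed.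

(** The structure constants of a frame depend only on n, so matching basis vectors intertwines the
    two representations. *)
Lemma frame_map_hom : rep_hom N d5 r r' frame_map.
Proof.
split.
- move=> k Uk; apply: (frame_ext fr) => u i Uu ilt.
  rewrite -!mulmxA frame_mapE // (fr_A fr) // (fr_A fr') //.
  by case: ifP => iu; [exact: frame_mapE | rewrite mulmx0].
- move=> k Uk; apply: (frame_ext fr) => u i Uu ilt.
  by rewrite -mulmxA frame_mapE // (fr_b fr) // (fr_b fr').
- by move=> k Uk; rewrite (fr_a fr Uk) (fr_a fr' Uk) frame_map_below.
- move=> k; apply: (frame_ext fr) => u i Uu ilt.
  by rewrite -!mulmxA frame_mapE // (fr_X fr) // (fr_X fr') // frame_map_below // ltnW.
- move=> k Vk; apply: (frame_ext fr) => u i Uu ilt.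
  rewrite -!mulmxA frame_mapE // (fr_C fr) // (fr_C fr') // mulmxN; congr (- _).
  have := shifts_bounds pn Uu Vk; case: ifP => sh /andP[l1 l2].
    by apply: frame_mapE => //; lia.
  by apply: frame_map_below => //; lia.
- move=> k Vk; apply: (frame_ext fr) => u i Uu ilt.
  rewrite -!mulmxA frame_mapE // (fr_D fr) // (fr_D fr') //.
  have := shifts_bounds pn Uu Vk; case: ifP => sh /andP[l1 l2].
    by apply: frame_map_below => //; lia.
  by apply: frame_mapE => //; lia.
Qed.

Lemma frame_map_unit k : frame_map k \in unitmx.
Proof.
suff h : expand N d5 n ep' k (e k) *m frame_map k = 1%:M by have [] := mulmx1_unit h.
apply: (frame_ext fr) => u i Uu ilt.
by rewrite -mulmxA frame_mapE // (expandE (fr_dual fr')) // mul1mx.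
Qed.
End FrameHom.

Section FrameTorus.
Variables (F : fieldType) (w : nat -> nat) (N : nat) (d5 : pred nat).
Local Notation is_D5 := (is_D5 N d5).
Local Notation is_NS5 := (is_NS5 N d5).
Variable n : nat -> nat -> nat.
Hypothesis pn : profile N d5 n.
Variables (r : rep F w) (e : forall k, nat -> nat -> 'cV[F]_(w k))
  (ep : forall k, nat -> nat -> 'rV[F]_(w k)).
Hypothesis fr : frame N d5 r n e ep.
Variables (t : nat -> F) (h : F).
Hypotheses (t0 : forall u, t u != 0) (h0 : h != 0).

Definition torus_rep : rep F w := {|
  rA := rA r; rb := fun k => (h * t k) *: rb r k; ra := fun k => (t k)^-1 *: ra r k;
  rX := fun k => h *: rX r k; rC := fun k => h *: rC r k; rD := rD r |}.

(* The vector e k u i has weight t_u h^(i - theta u k). *)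
Definition theta u k : int := (n u u)%:Z - 1
  + \sum_(k <= i < u) (~~ d5 i && shifts n u i)%:Z
  - \sum_(u <= i < k) (~~ d5 i && shifts n u i)%:Z.

Lemma theta_id u : theta u u = (n u u)%:Z - 1.
Proof. by rewrite /theta !big_geq // subr0 addr0. Qed.

Lemma thetaS u k : theta u k = theta u k.+1 + (~~ d5 k && shifts n u k)%:Z.
Proof.
rewrite /theta; have [ku|uk] := ltnP k u.
  rewrite (big_geq (m := u)) ?(ltnW ku) // (big_geq (m := u)) // big_ltn //.
  by ring.
rewrite (big_geq (n := u)) // (big_geq (n := u)) ?leqW // big_nat_recr //=.
by ring.
Qed.

(** The inverse of the weight of e k u i; the offset [theta u u] is the index of a_u in its string,
    which gives a_u weight t_u. *)
Definition scaling u k i : F := (t u)^-1 * h ^ (theta u k - i%:Z).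

Lemma scaling_neq0 u k i : scaling u k i != 0.
Proof. by rewrite mulf_neq0 ?invr_eq0 ?expfz_neq0. Qed.

Lemma scalingS u k i : h * scaling u k i.+1 = scaling u k i.
Proof.
rewrite /scaling mulrCA -{1}[h]expr1z -expfzDr //; congr (_ * _ ^ _); lia.
Qed.

Definition scaled_bas k u i := scaling u k i *: e k u i.
Definition scaled_cobas k u i := (scaling u k i)^-1 *: ep k u i.

Lemma below_scaling k u i c : (forall i', i = i'.+1 -> c = scaling u k i') ->
  c *: below (e k u) i = below (scaled_bas k u) i.
Proof. by case: i => [|i] /= ci; [rewrite scaler0 | rewrite (ci i)]. Qed.

Lemma torus_frame : frame N d5 torus_rep n scaled_bas scaled_cobas.
Proof.
have ne := scaling_neq0.
split; rewrite /scaled_bas /scaled_cobas /=.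
- move=> k u i u' i' Uu Uu' iu iu'.
  rewrite -scalemxAl -scalemxAr scalerA (fr_dual fr) //.
  have [/andP[/eqP -> /eqP ->]|_] := boolP ((u == u') && (i == i')).
    by rewrite mulVf // scale1r.
  by rewrite raddf0 scaler0.
- move=> k; rewrite -(fr_total fr k); apply: eq_bigr => u _; apply: eq_bigr => i _.
  by rewrite -scalemxAl -scalemxAr scalerA mulfV // scale1r.
- move=> k u i Uu ilt; rewrite -scalemxAl -scalemxAr scalerA (fr_X fr) //.
  by apply: below_scaling => i' ->; exact: scalingS.
- move=> k Uk; rewrite (fr_a fr) //; apply: below_scaling => i' nE.
  rewrite /scaling theta_id nE; have -> : i'.+1%:Z - 1 - i'%:Z = 0 by lia.
  by rewrite expr0z mulr1.
- move=> k u i Uk Uu ilt; rewrite -scalemxAr (fr_A fr) //.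
  case: ifP => iu; last by rewrite scaler0.
  by rewrite /scaling (thetaS u k) (D5_true Uk) /= addr0.
- move=> k u i Uk Uu ilt; rewrite -scalemxAl -scalemxAr scalerA (fr_b fr) //.
  have [/andP[/eqP -> /eqP ->]|_] := boolP ((u == k) && (i == n k k)); last first.
    by rewrite raddf0 scaler0.
  have := thetaS k k; rewrite (D5_true Uk) /= addr0 theta_id => thE.
  rewrite /scaling -thE; have -> : (n k k)%:Z - 1 - (n k k)%:Z = -1 by lia.
  rewrite exprN1; have -> : h * t k * ((t k)^-1 * h^-1) = 1.
    by field; rewrite t0 h0.
  by rewrite scale1r.
- move=> k u i Vk Uu ilt; rewrite -scalemxAr (fr_D fr) //.
  have := thetaS u k; rewrite (NS5_false Vk) /=; case: ifP => sh thE.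
    apply: below_scaling => i' ->; rewrite /scaling thE; congr (_ * _ ^ _); lia.
  by rewrite /scaling thE addr0.
- move=> k u i Vk Uu ilt; rewrite -scalemxAl -scalemxAr (fr_C fr) // !scalerN scalerA.
  congr (- _); have := thetaS u k; rewrite (NS5_false Vk) /=; case: ifP => sh thE.
    congr (_ *: _); rewrite /scaling mulrCA -{1}[h]expr1z -expfzDr // thE.
    by congr (_ * _ ^ _); lia.
  apply: below_scaling => i' ->; rewrite scalingS /scaling thE addr0 //.
Qed.

Lemma tr_torus_map k : h = 1 ->
  \tr (frame_map N d5 n e scaled_cobas k) = \sum_(u < N | d5 u) t u *+ n u k.
Proof.
move=> h1; rewrite /frame_map /expand raddf_sum /=; apply: eq_bigr => u du.
rewrite raddf_sum /= -[n u k in RHS]card_ord -sumr_const; apply: eq_bigr => i _.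
rewrite mxtrace_mulC /scaled_cobas -scalemxAl (fr_dual fr) ?D5_ord //.
rewrite !eqxx mxtraceZ mxtrace1 mulr1 /scaling h1.
by rewrite exp1rz mulr1 invrK.
Qed.
End FrameTorus.

(** Compare traces of the identity; characteristic zero recovers the natural number. *)
Lemma frame_dim (F : numFieldType) (w : nat -> nat) N d5 n (r : rep F w) e ep :
  frame N d5 r n e ep -> forall k, (\sum_(u < N | d5 u) n u k)%N = w k.
Proof.
move=> fr k; apply/eqP; rewrite -(eqr_nat F); apply/eqP.
have <- : \tr (1%:M : 'M[F]_(w k)) = (w k)%:R by rewrite mxtrace1.
rewrite natr_sum -(fr_total fr k) raddf_sum; apply: eq_bigr => u du /=.
rewrite raddf_sum /= -[n u k in LHS]card_ord -sumr_const; apply: eq_bigr => i _.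
by rewrite mxtrace_mulC (fr_dual fr) ?D5_ord // !eqxx mxtrace1.
Qed.

Section FrameExistence.
Variables (F : fieldType) (w : nat -> nat) (N : nat) (d5 : pred nat).
Local Notation is_D5 := (is_D5 N d5).
Local Notation is_NS5 := (is_NS5 N d5).
Variable n : nat -> nat -> nat.
Hypothesis nw : forall k, (\sum_(u < N | d5 u) n u k)%N = w k.

Lemma dual_bases k : exists (e : nat -> nat -> 'cV[F]_(w k)) (ep : nat -> nat -> 'rV[F]_(w k)),
  (forall u i u' i', is_D5 u -> is_D5 u' -> (i < n u k)%N -> (i' < n u' k)%N ->
    ep u i *m e u' i' = ((u == u') && (i == i'))%:R%:M) /\
  \sum_(u < N | d5 u) \sum_(i < n u k) e u i *m ep u i = 1%:M.
Proof.
pose s := [seq (u, i) | u <- [seq u <- iota 0 N | d5 u], i <- iota 0 (n u k)].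
have sums (V : nmodType) (f : nat * nat -> V) :
    \sum_(u < N | d5 u) \sum_(i < n u k) f (val u, val i) = \sum_(x <- s) f x.
  rewrite /s big_allpairs_dep big_filter -(big_mkord d5 (fun u => \sum_(i < n u k) f (u, val i))).
  rewrite /index_iota subn0; apply: eq_bigr => u _.
  by rewrite -(big_mkord xpredT (fun i => f (u, i))) /index_iota subn0.
have size_s : size s = w k.
  by rewrite -sum1_size -sums -nw; apply: eq_bigr => u _; rewrite sum1_card card_ord.
have us : uniq s.
  apply: allpairs_uniq_dep; first by rewrite filter_uniq // iota_uniq.
    by move=> u _; exact: iota_uniq.
  by move=> [u i] [u' i'] _ _ /= [-> ->].
have in_s u i : is_D5 u -> (i < n u k)%N -> (u, i) \in s.
  move=> /andP[uN du] ilt; apply/allpairsPdep; exists u, i.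
  by rewrite mem_filter du !mem_iota /= add0n uN add0n ilt.
(* Standard basis vectors, with the pairs (u, i) placed at their positions in the list s. *)
pose e u i : 'cV[F]_(w k) := \col_j (val j == index (u, i) s)%:R.
pose ep u i : 'rV[F]_(w k) := \row_j (val j == index (u, i) s)%:R.
exists e, ep; split.
  move=> u i u' i' Uu Uu' iu iu'; have is_ := in_s _ _ Uu iu; have is' := in_s _ _ Uu' iu'.
  apply/matrixP => a b; rewrite !ord1 !mxE mulr1n.
  have idx : (index (u, i) s < w k)%N by rewrite -size_s index_mem.
  rewrite (bigD1 (Ordinal idx)) //= big1 ?addr0 => [|j nj]; last first.
    by rewrite !mxE -(inj_eq val_inj) /= in nj *; rewrite (negbTE nj) mul0r.
  rewrite !mxE /= eqxx mul1r; congr (_%:R); congr nat_of_bool.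
  by rewrite (inj_in_eq (@index_inj _ _ s)) ?xpair_eqE.
rewrite (sums _ (fun x => e x.1 x.2 *m ep x.1 x.2)).
apply/matrixP => a b; rewrite summxE (big_nth (0, 0)%N) big_mkord !mxE.
have asz : (a < size s)%N by rewrite size_s.
rewrite (bigD1 (Ordinal asz)) //= big1 ?addr0 => [|j nj]; last first.
  rewrite !mxE big_ord1 !mxE -surjective_pairing index_uniq //.
  by rewrite -(inj_eq val_inj) /= eq_sym in nj; rewrite (negbTE nj) mul0r.
rewrite !mxE big_ord1 !mxE -surjective_pairing index_uniq // eqxx mul1r.
by rewrite eq_sym.
Qed.

Lemma frame_exists : exists r e ep, frame (w := w) (F := F) N d5 r n e ep.
Proof.
pose e k := sval (cid (dual_bases k)).
have /= eP k : exists ep : nat -> nat -> 'rV[F]_(w k),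
  (forall u i u' i', is_D5 u -> is_D5 u' -> (i < n u k)%N -> (i' < n u' k)%N ->
    ep u i *m e k u' i' = ((u == u') && (i == i'))%:R%:M) /\
  \sum_(u < N | d5 u) \sum_(i < n u k) e k u i *m ep u i = 1%:M.
  by rewrite /e; case: cid.
pose ep k := sval (cid (eP k)).
have dual k : forall u i u' i', is_D5 u -> is_D5 u' -> (i < n u k)%N -> (i' < n u' k)%N ->
    ep k u i *m e k u' i' = ((u == u') && (i == i'))%:R%:M.
  by rewrite /ep; case: cid => ? [].
have total k : \sum_(u < N | d5 u) \sum_(i < n u k) e k u i *m ep k u i = 1%:M.
  by rewrite /ep; case: cid => ? [].
pose ex := expand N d5 n ep; have exE := expandE dual.
exists {|
  rA := fun k => ex k.+1 _ (fun u i => if (i < n u k)%N then e k u i else 0);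
  rb := fun k => ex k.+1 _ (fun u i => ((u == k) && (i == n k k))%:R%:M);
  ra := fun k => below (e k k) (n k k);
  rX := fun k => ex k _ (fun u => below (e k u));
  rC := fun k => ex k.+1 _ (fun u i => - (if shifts n u k then e k u else below (e k u)) i);
  rD := fun k => ex k _ (fun u i => (if shifts n u k then below (e k.+1 u) else e k.+1 u) i) |}.
by exists e, ep; split=> //= *; rewrite /ex exE.
Qed.
End FrameExistence.

(** * Points and representations *)

Section Translation.
Variables (R : realType) (D : brane_diagram).
Local Notation C := R[i].
Local Notation w := (mult D).
Local Notation N := (nb D).
Local Notation lW W := (lft (val W)).
Local Notation rW W := (rgt (val W)).

Definition D5_pos (k : nat) : bool :=
  if insub k is Some p then @isD5 D p else false.

Local Notation is_D5 := (is_D5 N D5_pos).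
Local Notation is_NS5 := (is_NS5 N D5_pos).

Lemma D5_posE (p : 'I_N) : D5_pos p = isD5 p.
Proof. by rewrite /D5_pos valK. Qed.

Lemma D5_is_D5 (U : D5 D) : is_D5 (lW U).
Proof. by apply/andP; split=> /=; [exact: ltn_ord | rewrite D5_posE; exact: (valP U)]. Qed.
Lemma NS5_is_NS5 (V : NS5 D) : is_NS5 (lW V).
Proof. by apply/andP; split=> /=; [exact: ltn_ord | rewrite D5_posE; exact: (valP V)]. Qed.

Lemma is_D5_ex k : is_D5 k -> exists U : D5 D, k = lW U :> nat.
Proof.
case/andP=> lk; rewrite -[k]/(val (Ordinal lk)) D5_posE => h.
by exists (mkD5 h).
Qed.
Lemma is_NS5_ex k : is_NS5 k -> exists V : NS5 D, k = lW V :> nat.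
Proof.
case/andP=> lk; rewrite -[k]/(val (Ordinal lk)) D5_posE => h.
by exists (mkNS5 h).
Qed.

Lemma forall_D5 (P : nat -> Prop) : (forall U : D5 D, P (lW U)) ->
  forall k, is_D5 k -> P k.
Proof. by move=> PU k /is_D5_ex[U ->]. Qed.
Lemma forall_NS5 (P : nat -> Prop) : (forall V : NS5 D, P (lW V)) ->
  forall k, is_NS5 k -> P k.
Proof. by move=> PV k /is_NS5_ex[V ->]. Qed.

Section Extension.
Variables (T : nat -> Type) (d : forall k, T k).

Definition on_D5 (f : forall U : D5 D, T (lW U)) k : T k :=
  if @idP (k < N)%N is ReflectT lk then
    if @idP (isD5 (Ordinal lk)) is ReflectT h then f (mkD5 h) else d k
  else d k.
Definition on_NS5 (f : forall V : NS5 D, T (lW V)) k : T k :=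
  if @idP (k < N)%N is ReflectT lk then
    if @idP (~~ isD5 (Ordinal lk)) is ReflectT h then f (mkNS5 h) else d k
  else d k.

Lemma on_D5E f (U : D5 D) : on_D5 f (lW U) = f U.
Proof.
rewrite /on_D5; case: U => -[k lk] h /=.
case: {-}_ / idP => [lk'|]; last by [].
rewrite (bool_irrelevance lk' lk).
case: {-}_ / idP => [h'|]; last by [].
by rewrite (bool_irrelevance h' h).
Qed.

Lemma on_NS5E f (V : NS5 D) : on_NS5 f (lW V) = f V.
Proof.
rewrite /on_NS5; case: V => -[k lk] h /=.
case: {-}_ / idP => [lk'|]; last by [].
rewrite (bool_irrelevance lk' lk).
case: {-}_ / idP => [h'|]; last by [].
by rewrite (bool_irrelevance h' h).
Qed.

Lemma on_D5_out f k : ~~ is_D5 k -> on_D5 f k = d k.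
Proof.
rewrite /on_D5 => nk; case: {-}_ / idP => [lk|//].
case: {-}_ / idP => [h|//]; case/negP: nk; apply/andP; split=> //.
by rewrite -[k]/(val (Ordinal lk)) D5_posE.
Qed.
End Extension.

Definition pt_of (r : rep C w) : pt R D := {|
  pA := fun U => rA r (lW U);
  pb := fun U => rb r (lW U);
  pa := fun U => ra r (lW U);
  pB := fun U => rX r (lW U);
  pB' := fun U => rX r (rW U);
  pC := fun V => rC r (lW V);
  pD := fun V => rD r (lW V) |}.

(** X at position k is read off from the 5-brane on its right: B for a D5 brane, - C D for an NS5
    brane. The moment equations say that the 5-brane on the left gives the same endomorphism. *)
Definition rep_of (m : pt R D) : rep C w := {|
  rA := on_D5 (T := fun k => 'M[C]_(w k, w k.+1)) (fun=> 0) (pA m);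
  rb := on_D5 (T := fun k => 'rV[C]_(w k.+1)) (fun=> 0) (pb m);
  ra := on_D5 (T := fun k => 'cV[C]_(w k)) (fun=> 0) (pa m);
  rX := on_D5 (T := fun k => 'M[C]_(w k))
    (on_NS5 (T := fun k => 'M[C]_(w k)) (fun=> 0) (fun V => - (pC m V *m pD m V)))
    (pB m);
  rC := on_NS5 (T := fun k => 'M[C]_(w k, w k.+1)) (fun=> 0) (pC m);
  rD := on_NS5 (T := fun k => 'M[C]_(w k.+1, w k)) (fun=> 0) (pD m) |}.

Lemma mx0_eq a b (M M' : 'M[C]_(a, b)) : a = 0%N -> M = M'.
Proof. by move=> a0; subst a; apply/matrixP => -[]. Qed.

Lemma NS5_not_D5 (V : NS5 D) : ~~ is_D5 (lW V).
Proof. by have /andP[_ h] := NS5_is_NS5 V; rewrite /is_D5 negb_and h orbT. Qed.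

Lemma pt_eq (m m' : pt R D) : (forall U : D5 D, pA m U = pA m' U) ->
  (forall U : D5 D, pb m U = pb m' U) -> (forall U : D5 D, pa m U = pa m' U) ->
  (forall U : D5 D, pB m U = pB m' U) -> (forall U : D5 D, pB' m U = pB' m' U) ->
  (forall V : NS5 D, pC m V = pC m' V) -> (forall V : NS5 D, pD m V = pD m' V) ->
  m = m'.
Proof.
case: m m' => [A b a B B' c d] [A' b' a' B1 B1' c' d'] /= hA hb ha hB hB' hc hd.
by congr Pt; apply/functional_extensionality_dep.
Qed.

Section RepOf.
Variable m : pt R D.
Lemma rep_of_A (U : D5 D) : rA (rep_of m) (lW U) = pA m U.
Proof. exact: (on_D5E (T := fun k => 'M[C]_(w k, w k.+1))). Qed.
Lemma rep_of_b (U : D5 D) : rb (rep_of m) (lW U) = pb m U.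
Proof. exact: (on_D5E (T := fun k => 'rV[C]_(w k.+1))). Qed.
Lemma rep_of_a (U : D5 D) : ra (rep_of m) (lW U) = pa m U.
Proof. exact: (on_D5E (T := fun k => 'cV[C]_(w k))). Qed.
Lemma rep_of_B (U : D5 D) : rX (rep_of m) (lW U) = pB m U.
Proof. exact: (on_D5E (T := fun k => 'M[C]_(w k))). Qed.
Lemma rep_of_C (V : NS5 D) : rC (rep_of m) (lW V) = pC m V.
Proof. exact: (on_NS5E (T := fun k => 'M[C]_(w k, w k.+1))). Qed.
Lemma rep_of_D (V : NS5 D) : rD (rep_of m) (lW V) = pD m V.
Proof. exact: (on_NS5E (T := fun k => 'M[C]_(w k.+1, w k))). Qed.
Lemma rep_of_CD (V : NS5 D) : rX (rep_of m) (lW V) = - (pC m V *m pD m V).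
Proof.
by rewrite /= on_D5_out ?NS5_not_D5 // (on_NS5E (T := fun k => 'M[C]_(w k))).
Qed.

Hypothesis mu : moment_zero m.

Lemma rep_of_B' (U : D5 D) : rX (rep_of m) (rW U) = pB' m U.
Proof.
have [_ m2 _ _ m5] := mu; case: U => -[p lp] hp.
have [lq|] := ltnP p.+1 N; last by move=> Np; exact/mx0_eq/mult_right.
have [hq|hq] := boolP (isD5 (Ordinal lq)).
  have := rep_of_B (mkD5 hq); rewrite /= => ->.
  by have /eqP := m2 _ lp lq hp hq; rewrite subr_eq0 => /eqP <-.
have := rep_of_CD (mkNS5 hq); rewrite /= => ->.
have /eqP := m5 _ lp lq hp hq; rewrite addr_eq0 => /eqP e.
by apply: oppr_inj; rewrite -e opprK.
Qed.

Lemma rep_of_DC (V : NS5 D) : rX (rep_of m) (rW V) = - (pD m V *m pC m V).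
Proof.
have [_ _ m3 m4 _] := mu; case: V => -[p lp] hp.
have [lq|] := ltnP p.+1 N; last by move=> Np; exact/mx0_eq/mult_right.
have [hq|hq] := boolP (isD5 (Ordinal lq)).
  have := rep_of_B (mkD5 hq); rewrite /= => ->.
  by have /eqP := m4 _ lp lq hp hq; rewrite subr_eq0 => /eqP <-.
have := rep_of_CD (mkNS5 hq); rewrite /= => ->.
by have /eqP := m3 _ lp lq hp hq; rewrite subr_eq0 => /eqP ->.
Qed.

Lemma pt_ofK : pt_of (rep_of m) = m.
Proof.
apply: pt_eq; [exact: rep_of_A | exact: rep_of_b | exact: rep_of_a |
  exact: rep_of_B | exact: rep_of_B' | exact: rep_of_C | exact: rep_of_D].
Qed.
End RepOf.

Lemma rep_of_point (m : pt R D) : Mtilde m -> rep_point N D5_pos (rep_of m).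
Proof.
move=> [mu S12]; split.
- apply: forall_D5 => U.
  have [m1 _ _ _ _] := mu; have := m1 U.
  by rewrite -rep_of_A -rep_of_b -rep_of_a -rep_of_B -(rep_of_B' mu).
- by apply: forall_NS5 => V; rewrite rep_of_CD rep_of_C rep_of_D.
- by apply: forall_NS5 => V; rewrite (rep_of_DC mu) rep_of_C rep_of_D.
- apply: forall_D5 => U S subS SB SA Sb v Sv; have [/condS1P S1 _] := S12 U.
  apply: S1 Sv => // x Sx.
  + by rewrite -(rep_of_B' mu); exact: SB.
  + by rewrite -rep_of_A; exact: SA.
  + by rewrite -rep_of_b; exact: Sb.
- apply: forall_D5 => U T subT TB TA Ta v; have [_ /condS2P S2] := S12 U.
  apply: (S2 T) => // [x Tx|x|].
  + by rewrite -rep_of_B; exact: TB.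
  + by rewrite -rep_of_A; exact: TA.
  + by rewrite -rep_of_a; exact: Ta.
Qed.

Lemma pt_of_Mtilde (r : rep C w) : rep_point N D5_pos r -> Mtilde (pt_of r).
Proof.
case=> mu CD DC S1 S2; split; last first.
  move=> U; split; first by apply/condS1P; exact: (S1 _ (D5_is_D5 U)).
  by apply/condS2P; exact: (S2 _ (D5_is_D5 U)).
split=> [U|p lp lq hp hq|p lp lq hp hq|p lp lq hp hq|p lp lq hp hq] /=.
- exact: (mu _ (D5_is_D5 U)).
- by rewrite subrr.
- have := CD _ (NS5_is_NS5 (mkNS5 hq)); have := DC _ (NS5_is_NS5 (mkNS5 hp)).
  by rewrite /= => -> /oppr_inj ->; rewrite subrr.
- by have := DC _ (NS5_is_NS5 (mkNS5 hp)); rewrite /= => ->; rewrite subrr.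
- by have := CD _ (NS5_is_NS5 (mkNS5 hq)); rewrite /= => ->; rewrite subrr.
Qed.

Lemma rep_of_generated (m : pt R D) : moment_zero m -> generated m ->
  rep_generated N D5_pos (rep_of m).
Proof.
move=> mu gen S [subS Sa SA SAi SX SC SD]; apply: gen; split=> //.
- by move=> U; rewrite -rep_of_a; exact: (Sa _ (D5_is_D5 U)).
- by move=> U v; rewrite -rep_of_A; exact: (SA _ _ (D5_is_D5 U)).
- by move=> U v; rewrite -rep_of_A; exact: (SAi _ _ (D5_is_D5 U)).
- by move=> U v; rewrite -rep_of_B; exact: SX.
- by move=> U v; rewrite -(rep_of_B' mu); exact: SX.
- by move=> V v; rewrite -rep_of_C; exact: (SC _ _ (NS5_is_NS5 V)).
- by move=> V v; rewrite -rep_of_D; exact: (SD _ _ (NS5_is_NS5 V)).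
Qed.

Lemma pt_of_generated (r : rep C w) : rep_point N D5_pos r ->
  rep_generated N D5_pos r -> generated (pt_of r).
Proof.
move=> rp gen S [subS Sa SA SAi SB SB' SC SD]; apply: gen.
have SX k v : S k v -> S k (rX r k *m v).
  move=> Sv; have [lk|Nk] := ltnP k N; last first.
    by rewrite (cV0_eq (_ *m v) v) //; exact: mult_right.
  have := D5_or_NS5 D5_pos lk; case: (D5_pos k).
    by case/is_D5_ex => U kU; move: v Sv; rewrite kU => v; exact: SB.
  move=> Vk; rewrite (rp_CD rp Vk) mulNmx -mulmxA; apply: (submodN (subS k)).
  case/is_NS5_ex: Vk v Sv => V -> v Sv.
  by apply: (SC V); exact: (SD V).
split=> //.
- exact: (forall_D5 (P := fun k => S k (ra r k))).
- move=> k v Uk; move: k Uk v; apply: forall_D5 => U v; exact: (SA U).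
- move=> k v Uk; move: k Uk v; apply: forall_D5 => U v; exact: (SAi U).
- move=> k v Uk; move: k Uk v; apply: forall_NS5 => V v; exact: (SC V).
- move=> k v Uk; move: k Uk v; apply: forall_NS5 => V v; exact: (SD V).
Qed.

Lemma rep_hom_pt_hom (r r' : rep C w) h : rep_hom N D5_pos r r' h ->
  pt_hom (pt_of r) (pt_of r') h.
Proof.
case=> hA hb ha hX hC hD; split=> W /=; first exact: (hA _ (D5_is_D5 W)).
- exact: (hb _ (D5_is_D5 W)).
- exact: (ha _ (D5_is_D5 W)).
- exact: hX.
- exact: hX.
- exact: (hC _ (NS5_is_NS5 W)).
- exact: (hD _ (NS5_is_NS5 W)).
Qed.

Definition nat_torus (t : D5 D -> C) : nat -> C :=
  on_D5 (T := fun=> C) (fun=> 1) t.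

Lemma nat_torusE t (U : D5 D) : nat_torus t (lW U) = t U.
Proof. exact: (on_D5E (T := fun=> C)). Qed.

Lemma nat_torus_neq0 t : (forall U, t U != 0) -> forall k, nat_torus t k != 0.
Proof.
move=> t0 k; have [/is_D5_ex[U ->]|nk] := boolP (is_D5 k).
  by rewrite nat_torusE.
by rewrite /nat_torus on_D5_out // oner_neq0.
Qed.

Lemma torus_act_pt_of t h (r : rep C w) :
  torus_act t h (pt_of r) = pt_of (torus_rep r (nat_torus t) h).
Proof.
apply: pt_eq => //= U.
- by rewrite -(nat_torusE t U).
- by rewrite -(nat_torusE t U).
Qed.

End Translation.

(** * Tie diagrams and dimension profiles *)

Section TieDiagrams.
Variable D : brane_diagram.
Local Notation N := (nb D).
Local Notation d5 := (D5_pos D).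
Local Notation is_D5 := (is_D5 N d5).
Local Notation is_NS5 := (is_NS5 N d5).
Implicit Type T : {set 'I_N * 'I_N}.

Definition tie_count T u k : nat :=
  #|[set s in T | (s.1 < k <= s.2)%N && ((val s.1 == u) || (val s.2 == u))]|.

Lemma tie_countE T u k : tie_count T u k =
  (\sum_(s in T) ((s.1 < k <= s.2)%N && ((val s.1 == u) || (val s.2 == u))))%N.
Proof.
rewrite /tie_count -sum1_card [RHS]big_mkcond [LHS]big_mkcond /=; apply: eq_bigr => s _.
by rewrite !inE; case: (s \in T) => //=; case: ifP.
Qed.

(** Passing k != u loses the tie (u, k) and gains the tie (k, u), when present. Both are added on
    opposite sides to avoid subtraction. *)
Lemma tie_count_step T (u k : 'I_N) : (forall s, s \in T -> (s.1 < s.2)%N) -> k != u ->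
  (tie_count T u k + ((k, u) \in T) = tie_count T u k.+1 + ((u, k) \in T))%N.
Proof.
move=> T12 ku; rewrite !tie_countE.
have inT x : (x \in T : nat) = (\sum_(s in T) (s == x))%N.
  have [xT|xT] := boolP (x \in T).
    by rewrite (bigD1 x) //= eqxx big1 // => s /andP[_ /negbTE ->].
  by rewrite big1 // => s sT; case: eqP => // e; rewrite -e sT in xT.
rewrite !inT -!big_split /=; apply: eq_bigr => -[p q] /T12 /= pq.
rewrite !xpair_eqE -!(inj_eq val_inj) /=.
have {}ku : (k : nat) != u by rewrite (inj_eq val_inj).
move: {T12 inT}(p : nat) (q : nat) (k : nat) (u : nat) pq ku => {}p {}q {}k {}u pq ku.
lia.
Qed.

Lemma tie_ends T s : is_tie_diagram T -> s \in T ->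
  (s.1 < s.2)%N /\ isD5 s.1 != isD5 s.2.
Proof. by case=> + _; apply. Qed.

Lemma tie_lt T : is_tie_diagram T -> forall s, s \in T -> (s.1 < s.2)%N.
Proof. by move=> tT s /(tie_ends tT)[]. Qed.

Lemma tie_count_left T (u k : 'I_N) : is_tie_diagram T -> (k < u)%N ->
  (tie_count T u k.+1 = tie_count T u k + ((k, u) \in T))%N.
Proof.
move=> tT ku; rewrite tie_count_step; [|exact: tie_lt|by rewrite -(inj_eq val_inj) ltn_eqF].
case uk: ((u, k) \in T); last by rewrite addn0.
by have /= := tie_lt tT uk; rewrite ltnNge (ltnW ku).
Qed.

Lemma tie_count_right T (u k : 'I_N) : is_tie_diagram T -> (u < k)%N ->
  (tie_count T u k = tie_count T u k.+1 + ((u, k) \in T))%N.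
Proof.
move=> tT uk; rewrite -tie_count_step; [|exact: tie_lt|by rewrite -(inj_eq val_inj) gtn_eqF].
case ku: ((k, u) \in T); last by rewrite addn0.
by have /= := tie_lt tT ku; rewrite ltnNge (ltnW uk).
Qed.

Lemma tie_not_same T (u k : 'I_N) : is_tie_diagram T -> isD5 u = isD5 k ->
  (u, k) \in T = false.
Proof. by move=> tT e; apply/negP => /(tie_ends tT)[_ /=]; rewrite e eqxx. Qed.

Lemma tie_profile T : is_tie_diagram T -> profile N d5 (tie_count T).
Proof.
move=> tT; split.
- move=> u _; apply/eqP; rewrite cards_eq0; apply/eqP/setP => s.
  by rewrite !inE ltn0 andbF.
- move=> u k _ Nk; apply/eqP; rewrite cards_eq0; apply/eqP/setP => s; rewrite !inE.
  by rewrite (leqNgt k) (leq_trans (ltn_ord s.2) Nk) !andbF.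
- move=> u k /is_D5_ex[U ->] /is_D5_ex[K ->] ku.
  have e : isD5 (val U) = isD5 (val K) by rewrite (valP U) (valP K).
  have := tie_count_step (u := val U) (k := val K) (tie_lt tT).
  rewrite !tie_not_same // !addn0; apply.
  by rewrite -(inj_eq val_inj).
- move=> u k /is_D5_ex[U ->] /is_NS5_ex[K ->] ku.
  rewrite (tie_count_left (k := val K) (u := val U)) //; case: (_ \in _) => /=; lia.
- move=> u k /is_D5_ex[U ->] /is_NS5_ex[K ->] uk.
  rewrite (tie_count_right (k := val K) (u := val U)) //; case: (_ \in _) => /=; lia.
Qed.

(** Each tie has exactly one D5 end, so it is counted once. *)
Lemma tie_count_total T k : (forall s, s \in T -> (s.1 < s.2)%N /\ isD5 s.1 != isD5 s.2) ->
  (\sum_(u < N | d5 u) tie_count T u k)%N = #|[set s in T | (s.1 < k <= s.2)%N]|.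
Proof.
move=> tT; under eq_bigr do rewrite tie_countE.
rewrite exchange_big /= -sum1_card [RHS]big_mkcond [LHS]big_mkcond /=.
apply: eq_bigr => s _; rewrite !inE; case sT: (s \in T) => //=.
have [s12 s5] := tT s sT.
case: (s.1 < k <= s.2)%N => /=; last by rewrite big1.
case h1: (isD5 s.1) s5 => /negPf s5.
  rewrite (bigD1 s.1) /=; last by rewrite D5_posE h1.
  rewrite eqxx big1 // => i /andP[i5 i1].
  rewrite !(inj_eq val_inj) eq_sym (negbTE i1) /=.
  by case: eqP => // e; rewrite -e D5_posE in i5; rewrite i5 in s5.
rewrite (bigD1 s.2) /=; last by rewrite D5_posE; case: (isD5 s.2) s5.
rewrite eqxx orbT big1 // => i /andP[i5 i1].
rewrite !(inj_eq val_inj) (eq_sym s.2) (negbTE i1) orbF.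
by case: eqP => // e; rewrite -e D5_posE h1 in i5.
Qed.

Lemma tie_count_mult T k : is_tie_diagram T ->
  (\sum_(u < N | d5 u) tie_count T u k)%N = mult D k.
Proof.
move=> tT; rewrite tie_count_total; last by move=> s; exact: tie_ends.
have [lk|Nk] := ltnP k N.+1; first by have [_ /(_ (Ordinal lk))] := tT.
rewrite mult_right ?(ltnW Nk) //; apply/eqP; rewrite cards_eq0; apply/eqP/setP => s.
by rewrite !inE (leqNgt k) (leq_trans (ltn_ord s.2) (ltnW Nk)) !andbF.
Qed.

(** Whether a tie joins u to an NS5 brane is the jump of the count of u there. *)
Lemma tie_diagram_inj T T' : is_tie_diagram T -> is_tie_diagram T' ->
  (forall u : D5 D, forall k, (k <= N)%N -> tie_count T (val (val u)) k = tie_count T' (val (val u)) k) ->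
  T = T'.
Proof.
move=> tT tT' e; apply/setP => -[p q].
have [pq|qp] := ltnP p q; last first.
  have F T0 : is_tie_diagram T0 -> (p, q) \in T0 = false.
    by move=> t0; apply/negP => /(tie_lt t0) /=; rewrite ltnNge qp.
  by rewrite !F.
have [e5|n5] := eqVneq (isD5 p) (isD5 q).
  by rewrite !tie_not_same.
have inj (a b : bool) x : (x + a = x + b)%N -> a = b by case: a b => -[] //; lia.
case p5: (isD5 p) n5 => n5.
  have /= e1 := e (mkD5 p5) q (ltnW (ltn_ord q)).
  have /= e2 := e (mkD5 p5) q.+1 (ltn_ord q).
  have := tie_count_right tT pq.
  by rewrite e1 e2 (tie_count_right tT' pq) => /inj.
have q5 : isD5 q by case: (isD5 q) n5.
have /= e1 := e (mkD5 q5) p (ltnW (ltn_ord p)).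
have /= e2 := e (mkD5 q5) p.+1 (ltn_ord p).
have := tie_count_left tT pq.
by rewrite e1 e2 (tie_count_left tT' pq) => /inj.
Qed.

(** Put a tie between u and k whenever the profile of u changes at k. The counts obey the same step
    equation as n away from u and agree with it at both ends. *)
Lemma profile_tie_diagram n : profile N d5 n ->
  (forall k, (\sum_(u < N | d5 u) n u k)%N = mult D k) ->
  exists2 T, is_tie_diagram T & forall u k, is_D5 u -> tie_count T u k = n u k.
Proof.
move=> pn nm.
pose T : {set 'I_N * 'I_N} := [set s : 'I_N * 'I_N | (s.1 < s.2)%N &&
  ([&& isD5 s.1, ~~ isD5 s.2 & tie_at n s.1 s.2] ||
   [&& ~~ isD5 s.1, isD5 s.2 & tie_at n s.2 s.1])].
have T12 s : s \in T -> (s.1 < s.2)%N /\ isD5 s.1 != isD5 s.2.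
  by rewrite inE => /andP[-> ]; case: (isD5 s.1); case: (isD5 s.2).
have lt s : s \in T -> (s.1 < s.2)%N by case/T12.
have step (u k : 'I_N) : isD5 u -> k != u ->
    (n u k + ((k, u) \in T) = n u k.+1 + ((u, k) \in T))%N.
  move=> u5 ku; rewrite !inE u5 /=.
  have Uu : is_D5 u by exact: (D5_is_D5 (mkD5 u5)).
  have [k5|k5] /= := boolP (isD5 k).
    rewrite ?andbF ?orbF /= ?addn0.
    by apply: (pf_D5 pn) => //; exact: (D5_is_D5 (mkD5 k5)).
  have Vk : is_NS5 k by exact: (NS5_is_NS5 (mkNS5 k5)).
  rewrite ?orbF /tie_at; case: (ltngtP k u) => [lku|luk|e].
  - by have := pf_left pn Uu Vk lku; case: eqP => /=; lia.
  - by have := pf_right pn Uu Vk luk; case: eqP => /=; lia.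
  - by case/eqP: ku; exact: val_inj.
have cnt u k : is_D5 u -> tie_count T u k = n u k.
  move=> Uu; have c0 : tie_count T u 0 = 0%N.
    by apply/eqP; rewrite cards_eq0; apply/eqP/setP => s; rewrite !inE ltn0 andbF.
  have cN j : (N <= j)%N -> tie_count T u j = 0%N.
    move=> Nj; apply/eqP; rewrite cards_eq0; apply/eqP/setP => s; rewrite !inE.
    by rewrite (leqNgt j) (leq_trans (ltn_ord s.2) Nj) !andbF.
  have [uN u5] := andP Uu; set U := Ordinal uN.
  have {}u5 : isD5 U by rewrite -D5_posE.
  have st (j : 'I_N) : j != U -> (tie_count T u j = n u j) <-> (tie_count T u j.+1 = n u j.+1).
    move=> ju; have := step U j u5 ju; have := @tie_count_step T U j lt ju => /=; lia.
  have [ku|uk] := leqP k u.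
    elim: k ku => [_|k IHk ku]; first by rewrite c0 (pf_0 pn).
    have kN : (k < N)%N by exact: leq_trans ku (ltnW uN).
    apply/(st (Ordinal kN)); last exact: IHk (ltnW ku).
    by rewrite -(inj_eq val_inj) /= ltn_eqF.
  have [Nk|kN] := leqP N k; first by rewrite cN // (pf_N pn).
  (* The step at u is not controlled, so the D3 branes right of u are reached from the right end,
     where both sides vanish. *)
  suff H m : (u < N - m)%N -> tie_count T u (N - m)%N = n u (N - m)%N.
    by rewrite -(subKn (ltnW kN)); apply: H; rewrite subKn // ltnW.
  elim: m => [|m IHm lum]; first by rewrite subn0 cN // (pf_N pn).
  have jN : (N - m.+1 < N)%N by lia.
  apply/(st (Ordinal jN)); first by rewrite -(inj_eq val_inj) /= gtn_eqF.
  have -> : (nat_of_ord (Ordinal jN)).+1 = (N - m)%N by rewrite /=; lia.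
  by apply: IHm; lia.
exists T => //; split=> // x.
rewrite -(tie_count_total x T12) -nm; apply: eq_bigr => u du.
by rewrite cnt // /is_D5 ltn_ord.
Qed.
End TieDiagrams.

(** * Fixed points and tie diagrams *)

Section Isomorphisms.
Variables (R : realType) (D : brane_diagram).
Local Notation C := R[i].
Local Notation w := (mult D).
Local Notation lW W := (lft (val W)).
Local Notation rW W := (rgt (val W)).
Local Notation orbit := (@Defs.orbit R D).
Implicit Types (m : pt R D) (h : forall k, 'M[C]_(w k)).

Lemma pt_hom_comp m m' m'' h h' : pt_hom m m' h -> pt_hom m' m'' h' ->
  pt_hom m m'' (fun k => h' k *m h k).
Proof.
case=> hA hb ha hB hB' hC hD [kA kb ka kB kB' kC kD]; split=> W.
- by rewrite -mulmxA hA !mulmxA kA.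
- by rewrite mulmxA kb hb.
- by rewrite -mulmxA ha ka.
- by rewrite -mulmxA hB !mulmxA kB.
- by rewrite -mulmxA hB' !mulmxA kB'.
- by rewrite -mulmxA hC !mulmxA kC.
- by rewrite -mulmxA hD !mulmxA kD.
Qed.

Lemma pt_hom_inv m m' h : (forall k, h k \in unitmx) -> pt_hom m m' h ->
  pt_hom m' m (fun k => invmx (h k)).
Proof.
move=> hu [hA hb ha hB hB' hC hD].
have conj a b (Y Y' : 'M[C]_(w a, w b)) : h a *m Y = Y' *m h b ->
    invmx (h a) *m Y' = Y *m invmx (h b).
  by move=> e; rewrite -[Y'](mulmxK (hu b)) -e !mulmxA mulVmx // mul1mx.
split=> W; [exact: conj| | | exact: conj..].
- by rewrite -hb mulmxK.
- by rewrite -ha mulKmx.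
Qed.

Lemma generated_iso m m' h : (forall k, h k \in unitmx) -> pt_hom m m' h ->
  generated m -> generated m'.
Proof.
move=> hu [hA hb ha hB hB' hC hD] gen S [subS Sa SA SAi SB SB' SC SD] k v.
rewrite -[v](mulKVmx (hu k)); apply: (gen (fun k x => S k (h k *m x))).
split=> {k v}.
- move=> k; split; first by rewrite mulmx0; exact: submod0 (subS k).
  by move=> c x y Sx Sy; rewrite mulmxDr -scalemxAr; exact: (subS k).2.
- by move=> U; rewrite ha.
- by move=> U v; rewrite mulmxA hA -mulmxA; exact: SA.
- by move=> U v; rewrite mulmxA hA -mulmxA; exact: SAi.
- by move=> U v; rewrite mulmxA hB -mulmxA; exact: SB.
- by move=> U v; rewrite mulmxA hB' -mulmxA; exact: SB'.
- by move=> V v; rewrite mulmxA hC -mulmxA; exact: SC.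
- by move=> V v; rewrite mulmxA hD -mulmxA; exact: SD.
Qed.

Lemma extend_unit (g : gauge R D) : in_gauge_group g -> forall k, extend g k \in unitmx.
Proof.
move=> gu k; rewrite /extend; case: {-}_ / idP => [lk|_]; last exact: unitmx1.
exact: (gu (Ordinal lk)).
Qed.

Lemma orbitP m m' : orbit m m' <-> exists2 h, (forall k, h k \in unitmx) & pt_hom m m' h.
Proof.
split=> [[g gu ->]|[h hu hm]].
  exists (extend g); first exact: extend_unit.
  by rewrite {1}(extend_gauge g); apply: act_hom; rewrite -extend_gauge.
have gu : in_gauge_group (fun x : D3 D => h x) by move=> x; exact: hu.
by exists (fun x => h x) => //; exact: hom_act.
Qed.

Lemma orbit_refl m : orbit m m.
Proof.
apply/orbitP; exists (fun k => 1%:M) => [k|]; first exact: unitmx1.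
by split=> W; rewrite ?mul1mx ?mulmx1.
Qed.

Lemma orbit_eq m m' : orbit m m' -> orbit m = orbit m'.
Proof.
move/orbitP=> [h hu hm]; apply/seteqP; split=> x /orbitP[k ku km]; apply/orbitP.
  exists (fun j => k j *m invmx (h j)) => [j|].
    by rewrite unitmx_mul ku unitmx_inv hu.
  exact: pt_hom_comp (pt_hom_inv hu hm) km.
exists (fun j => k j *m h j) => [j|]; first by rewrite unitmx_mul ku hu.
exact: pt_hom_comp hm km.
Qed.

Lemma torus_act_hom t (x : C) m m' h : pt_hom m m' h ->
  pt_hom (torus_act t x m) (torus_act t x m') h.
Proof.
case=> hA hb ha hB hB' hC hD; split=> W.
- exact: hA.
- by rewrite /= -hb scalemxAl.
- by rewrite /= -ha scalemxAr.
- by rewrite /= -scalemxAr [h _ *m _]hB scalemxAl.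
- by rewrite /= -scalemxAr [h _ *m _]hB' scalemxAl.
- by rewrite /= -scalemxAr [h _ *m _]hC scalemxAl.
- exact: hD.
Qed.

Lemma torus_actK t (x : C) m : in_torus t x ->
  torus_act t x (torus_act (fun U => (t U)^-1) x^-1 m) = m.
Proof.
case=> t0 x0; apply: pt_eq => W //=; rewrite scalerA.
- have -> : x * t W * (x^-1 * (t W)^-1) = 1 by field; rewrite x0 t0.
  by rewrite scale1r.
- by rewrite invrK mulVf // scale1r.
- by rewrite mulfV // scale1r.
- by rewrite mulfV // scale1r.
- by rewrite mulfV // scale1r.
Qed.
End Isomorphisms.

Section FixedPoints.
Variables (R : realType) (D : brane_diagram).
Local Notation C := R[i].
Local Notation w := (mult D).
Local Notation N := (nb D).
Local Notation d5 := (D5_pos D).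
Local Notation is_D5 := (is_D5 N d5).
Local Notation is_NS5 := (is_NS5 N d5).
Local Notation lW W := (lft (val W)).
Local Notation rW W := (rgt (val W)).

Lemma sum_D5 (V : nmodType) (f : nat -> V) :
  \sum_(U : D5 D) f (lW U) = \sum_(u < N | d5 u) f u.
Proof.
rewrite -(big_sub (fun p : 'I_N => isD5 p) (fun p => f p)).
by apply: eq_bigl => p; rewrite D5_posE.
Qed.

(** Multiply by 2^M to make the exponents of 2 natural, then compare 2-adic and 3-adic
    valuations. *)
Lemma weight_separation (F : numFieldType) u j u' j' :
  (3 ^+ u * 2 ^ j = 3 ^+ u' * 2 ^ j' :> F) -> u = u' /\ j = j'.
Proof.
move=> e; pose M := (absz j + absz j')%N.
have n0 : (2 : F) != 0 by rewrite pnatr_eq0.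
have shift (i : int) : (absz i <= M)%N -> exists2 p : nat, p%:Z = i + M%:Z &
   2 ^ i * 2 ^+ M = 2 ^+ p :> F.
  move=> iM; exists (absz (i + M%:Z)); first by lia.
  rewrite !exprnP -expfzDr //; congr (_ ^ _); lia.
have [p pE pj] := shift j (leq_addr _ _); have [p' pE' pj'] := shift j' (leq_addl _ _).
have : (3 ^ u * 2 ^ p = 3 ^ u' * 2 ^ p')%N.
  apply/eqP; rewrite -(eqr_nat F) !natrM !natrX -pj -pj' !mulrA e //.
move=> en.
have l2 q i : logn 2 (3 ^ q * 2 ^ i) = i.
  by rewrite lognM ?expn_gt0 // !lognX logn_prime //= (logn_prime 2) //= muln0 muln1.
have l3 q i : logn 3 (3 ^ q * 2 ^ i) = q.
  by rewrite lognM ?expn_gt0 // !lognX logn_prime //= (logn_prime 3) //= muln0 muln1 addn0.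
split; first by rewrite -(l3 u p) en l3.
have pp : p = p' by rewrite -(l2 u p) en l2.
by rewrite pp in pE; lia.
Qed.

(** The inverse torus element is applied so that the compensating g acts on a_u by 3^u and meets the
    intertwining relations with h = 2; the powers of 3 and 2 separate all weights. *)
Lemma torus_fixed_frame (m : pt R D) (g : gauge R D) : Mtilde m -> generated m ->
  in_gauge_group g ->
  torus_act (fun U : D5 D => (3 ^+ lW U)^-1) 2^-1 m = act g m ->
  exists n e ep, profile N d5 n /\ frame N d5 (rep_of m) n e ep.
Proof.
move=> Mm gen gu gm.
have [mu _] := Mm; pose G := extend g.
have : pt_hom m (act g m) G.
  by rewrite {1}(extend_gauge g); apply: act_hom; rewrite -extend_gauge.
rewrite -gm => -[/= hA hb ha hB hB' hC hD].
have n2 : (2 : C) != 0 by rewrite pnatr_eq0.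
have n3 : (3 : C) != 0 by rewrite pnatr_eq0.
pose r := rep_of m.
have t0 (u : nat) : 3 ^+ u != 0 :> C by rewrite expf_neq0.
have gA : forall k, is_D5 k -> rA r k *m G k.+1 = G k *m rA r k.
  by apply: forall_D5 => U; rewrite rep_of_A hA.
have gb : forall k, is_D5 k -> rb r k *m G k.+1 = (3 ^+ k * 2) *: rb r k.
  apply: forall_D5 => U; rewrite rep_of_b -[in RHS]hb -scalemxAl scalerA.
  suff -> : 3 ^+ lW U * 2 * (2^-1 * (3 ^+ lW U)^-1) = 1 :> C by rewrite scale1r.
  by rewrite mulrA mulfK // mulfV.
have ga : forall k, is_D5 k -> G k *m ra r k = (3 ^+ k) *: ra r k.
  by apply: forall_D5 => U; rewrite rep_of_a ha invrK.
have gC : forall k, is_NS5 k -> rC r k *m G k.+1 = 2 *: (G k *m rC r k).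
  apply: forall_NS5 => V; rewrite rep_of_C hC -scalemxAl scalerA mulfV //.
  by rewrite scale1r.
have gD : forall k, is_NS5 k -> rD r k *m G k = G k.+1 *m rD r k.
  by apply: forall_NS5 => V; rewrite rep_of_D hD.
have gX k : rX r k *m G k = 2 *: (G k *m rX r k).
  have [lk|Nk] := ltnP k N; last exact/mx0_eq/mult_right.
  have := D5_or_NS5 d5 lk; case: (d5 k) => hk.
    have [U kU] := is_D5_ex hk; move: (hB U); rewrite -rep_of_B.
    rewrite -/r; move: k kU lk hk => k -> _ _ ->.
    by rewrite -scalemxAl scalerA mulfV // scale1r.
  rewrite (rp_CD (rep_of_point Mm) hk) mulNmx mulmxN scalerN -mulmxA gD //.
  by rewrite mulmxA gC // -scalemxAl !mulmxA.
have wi : {in D5_label N d5 &, injective (weight (fun u => 3 ^+ u) (2 : C))}.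
  move=> [u j] [u' j'] _ _ /weight_separation /= [-> ->] //.
have rp := rep_of_point Mm; have rg := rep_of_generated mu gen.
have wN k : (N <= k)%N -> w k = 0%N by exact: mult_right.
have fr := fixed_frame rp rg n2 gA gb ga gX gC gD wi (mult_left D) wN.
have pf := len_profile rp rg n2 gA gb ga gX gC gD wi (mult_left D) wN.
by do 3!eexists; split; [exact: pf | exact: fr].
Qed.

Local Notation orbit := (@Defs.orbit R D).
Implicit Types (P : set (pt R D)) (T : {set 'I_N * 'I_N}).

Lemma frame_eq (F : fieldType) (w' : nat -> nat) (r : rep F w') n n' e ep :
  (forall u k, is_D5 u -> n u k = n' u k) -> frame N d5 r n e ep ->
  frame N d5 r n' e ep.
Proof.
move=> nn' [dual total fX fa fA fb fD fC].
have sh u k : is_D5 u -> shifts n' u k = shifts n u k.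
  by move=> Uu; rewrite /shifts /tie_at !nn'.
split.
- by move=> k u i u' i' Uu Uu'; rewrite -!nn' //; exact: dual.
- move=> k; rewrite -(total k); apply: eq_bigr => u /D5_ord Uu.
  by rewrite nn'.
- by move=> k u i Uu; rewrite -nn' //; exact: fX.
- by move=> k Uk; rewrite -nn' //; exact: fa.
- by move=> k u i Uk Uu; rewrite -!nn' //; exact: fA.
- by move=> k u i Uk Uu; rewrite -!nn' //; exact: fb.
- by move=> k u i Vk Uu; rewrite -!nn' // sh //; exact: fD.
- by move=> k u i Vk Uu; rewrite -!nn' // sh //; exact: fC.
Qed.

(* A frame for m indexed by the ties of T: a normal form of m. *)
Definition tie_frame T (m : pt R D) := exists (r : rep C w) e ep,
  pt_of r = m /\ frame N d5 r (tie_count T) e ep.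

Lemma stable_generatedP (m : pt R D) : stable m <-> Mtilde m /\ generated m.
Proof.
split=> [sm|[]]; last exact: generated_stable.
by split; [exact: sm.1 | exact: stable_generated].
Qed.

Lemma stable_orbit (m m' : pt R D) : stable m -> orbit m m' -> stable m'.
Proof.
move=> /stable_generatedP[Mm gm] om; apply/stable_generatedP; split.
  by case: om => g gu ->; exact: act_Mtilde.
by move/orbitP: om => [h hu hm]; exact: generated_iso hu hm gm.
Qed.

Lemma fixed_tie_frame P (m : pt R D) : fixed_points R D P -> P m ->
  exists2 T, is_tie_diagram T & tie_frame T m.
Proof.
case=> -[m0 sm0 PE] fixP Pm; have om : orbit m0 m by rewrite -PE.
have sm := stable_orbit sm0 om; have [Mm gm] := (stable_generatedP m).1 sm.
pose t (U : D5 D) : C := (3 ^+ lW U)^-1.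
have tP : in_torus t 2^-1.
  split=> [U|]; last by rewrite invr_eq0 pnatr_eq0.
  by rewrite invr_eq0 expf_neq0 // pnatr_eq0.
have : P (torus_act t 2^-1 m) by rewrite -(fixP t 2^-1 tP); exists m.
rewrite PE (orbit_eq om) => -[g gu gE].
have [n [e [ep [pn fr]]]] := torus_fixed_frame Mm gm gu gE.
have [T tT nT] := profile_tie_diagram pn (frame_dim fr).
exists T => //; exists (rep_of m), e, ep; split; first by apply: pt_ofK; exact: Mm.1.
by apply: frame_eq fr => u k Uu; rewrite nT.
Qed.

Section TieFrame.
Variables (T : {set 'I_N * 'I_N}) (m : pt R D).
Hypotheses (tT : is_tie_diagram T) (mT : tie_frame T m).

Lemma tie_frame_Mtilde_generated : Mtilde m /\ generated m.
Proof.
have pn := tie_profile tT; have [r [e [ep [<- fr]]]] := mT.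
have rp := frame_point pn fr; split; first exact: pt_of_Mtilde.
by apply: pt_of_generated => //; exact: frame_generated fr.
Qed.

Lemma tie_frame_stable : stable m.
Proof. exact/stable_generatedP/tie_frame_Mtilde_generated. Qed.

Lemma tie_frame_torus t (h : C) : in_torus t h -> exists k : forall j, 'M[C]_(w j),
  [/\ forall j, k j \in unitmx, pt_hom (torus_act t h m) m k &
    h = 1 -> forall x : D3 D, \tr (k x) = \sum_(U : D5 D)
        t U *+ #|[set s in T | covers s x & (s.1 == val U) || (s.2 == val U)]|].
Proof.
case=> t0 h0; have pn := tie_profile tT; have [r [e [ep [<- fr]]]] := mT.
have nt0 := nat_torus_neq0 t0.
have fr' := torus_frame fr nt0 h0.
have hm := rep_hom_pt_hom (frame_map_hom pn fr' fr); rewrite -torus_act_pt_of in hm.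
exists (frame_map N d5 (tie_count T) e (scaled_cobas d5 (tie_count T) ep (nat_torus t) h)).
split=> //; first exact: (frame_map_unit fr' fr).
move=> h1 x; rewrite (tr_torus_map fr) //.
rewrite -(sum_D5 (fun u => nat_torus t u *+ tie_count T u x)).
by apply: eq_bigr => U _; rewrite nat_torusE.
Qed.

Lemma tie_frame_fixed : fixed_points R D (orbit m).
Proof.
split; first by exists m => //; exact: tie_frame_stable.
have sub t (h : C) x : in_torus t h -> orbit m x -> orbit m (torus_act t h x).
  move=> th /orbitP[k ku km]; have [l [lu lm _]] := tie_frame_torus th.
  apply/orbitP; exists (fun j => k j *m invmx (l j)) => [j|].
    by rewrite unitmx_mul ku unitmx_inv lu.
  exact: pt_hom_comp (pt_hom_inv lu lm) (torus_act_hom t h km).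
move=> t h th; apply/seteqP; split=> [_ [x ox <-]|x ox]; first exact: sub.
exists (torus_act (fun U => (t U)^-1) h^-1 x); last exact: torus_actK.
apply: sub => //; case: th => t0 h0; split=> [U|]; rewrite invr_eq0 //.
Qed.

(** Any g undoing t at a point x of the orbit is conjugate to the explicit map in the frame, so it
    has the same traces. *)
Lemma tie_frame_has_tie_diagram : has_tie_diagram (orbit m) T.
Proof.
split=> // x t g /orbitP[k ku km] tt gu gx y.
have [l [lu lm ltr]] := tie_frame_torus tt; rewrite -(ltr erefl y).
have [Mm gm] := tie_frame_Mtilde_generated.
have Mx : Mtilde x.
  by have [g' gu' ->] : orbit m x; [apply/orbitP; exists k | exact: act_Mtilde].
have gtm : generated (torus_act t 1 m).
  by apply: generated_iso gm; [|exact: pt_hom_inv lu lm] => j; rewrite unitmx_inv.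
(* Two homomorphisms from t m to x, one through g and one through the frame map; uniqueness
   identifies them. *)
have h1 : pt_hom (torus_act t 1 m) x (fun j => extend g j *m k j).
  apply: pt_hom_comp (torus_act_hom t 1 km) _.
  by rewrite -[X in pt_hom _ X]gx {1}(extend_gauge g); apply: act_hom; rewrite -extend_gauge.
have h2 : pt_hom (torus_act t 1 m) x (fun j => k j *m l j).
  exact: pt_hom_comp lm km.
have := hom_unique gtm Mx h1 h2 y; rewrite extendE => e.
rewrite -[g y](mulmxK (ku y)) e mxtrace_mulC mulmxA mulVmx ?mul1mx //.
Qed.
End TieFrame.

Lemma tie_frame_orbit T (m m' : pt R D) : is_tie_diagram T ->
  tie_frame T m -> tie_frame T m' -> orbit m = orbit m'.
Proof.
move=> tT [r [e [ep [<- fr]]]] [r' [e' [ep' [<- fr']]]].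
have pn := tie_profile tT; apply/orbit_eq/orbitP.
exists (frame_map N d5 (tie_count T) e' ep).
  exact: (frame_map_unit fr fr').
exact: (rep_hom_pt_hom (frame_map_hom pn fr fr')).
Qed.

Lemma tie_frame_exists T : is_tie_diagram T -> exists m, tie_frame T m.
Proof.
move=> tT.
have [r [e [ep fr]]] := frame_exists C (fun k => tie_count_mult k tT).
by exists (pt_of r), r, e, ep.
Qed.

(** Both diagrams predict the same traces for every t. Comparing t_U = 2 with t_U = 1, all other
    entries being 1, isolates the tie count of U. *)
Lemma has_tie_diagram_unique P T T' : fixed_points R D P ->
  has_tie_diagram P T -> has_tie_diagram P T' -> T = T'.
Proof.
move=> fixP [tT hT] [tT' hT']; have [[m sm PE] fixT] := fixP.
have Pm : P m by rewrite PE; exact: orbit_refl.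
have [T0 tT0 mT0] := fixed_tie_frame fixP Pm.
have cnt T1 (U : D5 D) (k : nat) (lk : (k < N.+1)%N) :
  #|[set s in T1 | covers s (Ordinal lk : D3 D) & (s.1 == val U) || (s.2 == val U)]|
   = tie_count T1 (lW U) k by [].
apply: tie_diagram_inj => // U k kN.
have lk : (k < N.+1)%N by [].
pose t c (U' : D5 D) : C := if U' == U then c else 1.
have key c : c != 0 ->
   \sum_(U' : D5 D) t c U' *+ tie_count T (lW U') k
   = \sum_(U' : D5 D) t c U' *+ tie_count T' (lW U') k.
  move=> c0; have tt : in_torus (t c) 1.
    by split=> [U'|]; rewrite /t; [case: ifP => _ //|]; exact: oner_neq0.
  have [l [lu lm _]] := tie_frame_torus tT0 mT0 tt.
  have lg : in_gauge_group (fun x : D3 D => l x) by move=> x; exact: lu.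
  have la : act (fun x : D3 D => l x) (torus_act (t c) 1 m) = m.
    by rewrite -(hom_act lg lm).
  have e1 := hT _ _ _ Pm tt lg la (Ordinal lk).
  have e2 := hT' _ _ _ Pm tt lg la (Ordinal lk).
  by rewrite e1 in e2.
have := key 1 (oner_neq0 _).
have := key 2; rewrite pnatr_eq0 => /(_ isT).
have split_U c T1 : \sum_(U' : D5 D) t c U' *+ tie_count T1 (lW U') k =
   c *+ tie_count T1 (lW U) k +
   \sum_(U' : D5 D | U' != U) 1 *+ tie_count T1 (lW U') k.
  rewrite (bigD1 U) //= /t eqxx; congr (_ + _); apply: eq_bigr => U' nU.
  by rewrite (negbTE nU).
rewrite !split_U => e2 e1.
have : 1 *+ tie_count T (lW U) k = 1 *+ tie_count T' (lW U) k :> C.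
  set a := tie_count T _ k in e1 e2 *; set b := tie_count T' _ k in e1 e2 *.
  have d : (2 : C) = 1 + 1 by [].
  rewrite d !mulrnDl -!addrA e1 in e2; exact: addIr e2.
by move/eqP; rewrite eqr_nat => /eqP.
Qed.

Lemma fixed_point_tie_diagram P : fixed_points R D P ->
  exists T, [/\ is_tie_diagram T, has_tie_diagram P T &
    exists2 m, tie_frame T m & P = orbit m].
Proof.
move=> fixP; have [[m sm PE] _] := fixP.
have Pm : P m by rewrite PE; exact: orbit_refl.
have [T tT mT] := fixed_tie_frame fixP Pm.
exists T; split=> //; last by exists m.
by rewrite PE; exact: (tie_frame_has_tie_diagram tT mT).
Qed.

Lemma has_tie_diagram_inj P P' T : fixed_points R D P -> fixed_points R D P' ->
  has_tie_diagram P T -> has_tie_diagram P' T -> P = P'.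
Proof.
move=> fP fP' hP hP'.
have [T1 [tT1 hT1 [m1 mT1 ->]]] := fixed_point_tie_diagram fP.
have [T2 [tT2 hT2 [m2 mT2 ->]]] := fixed_point_tie_diagram fP'.
move: mT1 mT2; rewrite -(has_tie_diagram_unique fP hP hT1).
rewrite -(has_tie_diagram_unique fP' hP' hT2); exact: tie_frame_orbit hP.1.
Qed.

Lemma has_tie_diagram_surj T : is_tie_diagram T ->
  exists2 P, fixed_points R D P & has_tie_diagram P T.
Proof.
move=> tT; have [m mT] := tie_frame_exists tT.
exists (orbit m); first exact: (tie_frame_fixed tT mT).
exact: (tie_frame_has_tie_diagram tT mT).
Qed.
End FixedPoints.

Lemma mirror_tie_diagram (D : brane_diagram) (T : {set 'I_(nb D) * 'I_(nb D)}) :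
  @is_tie_diagram D T <-> @is_tie_diagram (mirror D) T.
Proof.
have e (p q : 'I_(nb D)) :
    (@isD5 (mirror D) p != @isD5 (mirror D) q) = (@isD5 D p != @isD5 D q).
  by rewrite /= (inj_eq negb_inj).
by split=> -[T12 Tm]; split=> // s /T12[? s5]; split=> //; rewrite e in s5 *.
Qed.

(** Naturality is expressed by the second clause: corresponding fixed points carry the same set of
    ties, with only the roles of the two kinds of 5-branes exchanged. *)
Theorem theorem4p13 (R : realType) (D : brane_diagram) :
  exists f : set (pt R D) -> set (pt R (mirror D)),
    set_bij (fixed_points R D) (fixed_points R (mirror D)) f /\
    forall P : set (pt R D), fixed_points R D P ->
      exists T : {set 'I_(nb D) * 'I_(nb D)},
        has_tie_diagram P T /\ has_tie_diagram (f P) T.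
Proof.
pose rel (P : set (pt R D)) (P' : set (pt R (mirror D))) :=
  fixed_points R (mirror D) P' /\
  exists T, has_tie_diagram P T /\ has_tie_diagram P' T.
have relP P : fixed_points R D P -> exists P', rel P P'.
  case/fixed_point_tie_diagram=> T [tT hT _].
  have [P' fP' hP'] := has_tie_diagram_surj R ((@mirror_tie_diagram D T).1 tT).
  by exists P'; split=> //; exists T.
(* The value [set0] is only a default for sets P that are not fixed points. *)
pose f P := xget set0 [set P' | rel P P'].
have fP P : fixed_points R D P -> rel P (f P).
  by move=> /relP[P' PP']; rewrite /f; case: xgetP => [Q _ //|/(_ P')].
exists f; split; last by move=> P /fP[].
split.
- by move=> P /fP[].
- move=> P Q; rewrite !inE => fxP fxQ e.
  have [fxf [T [hT hfT]]] := fP P fxP; have [_ [T' [hT' hfT']]] := fP Q fxQ.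
  rewrite -e in hfT'; have TT := has_tie_diagram_unique fxf hfT hfT'.
  by rewrite -TT in hT'; exact: has_tie_diagram_inj hT hT'.
- move=> P' fP'; have [T [tT hT _]] := fixed_point_tie_diagram fP'.
  have [P fxP hP] := has_tie_diagram_surj R ((@mirror_tie_diagram D T).2 tT).
  exists P => //; have [fxf [T' [hT' hfT']]] := fP P fxP.
  rewrite -(has_tie_diagram_unique fxP hP hT') in hfT'.
  exact: has_tie_diagram_inj hfT' hT.
Qed.
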